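(* Let $n\ge 10$. The complexes $\Delta(I)$, $I\in\mathcal{I}_n$, are pairwise non-isomorphic. In particular, there is a constant $c>0$ such that there are at least $c\cdot2^n$ pairwise non-isomorphic centrally symmetric combinatorial $3$-spheres on the vertex set $V_{n+1}$ that are cs-$2$-neighborly.
   Context: Simplicial complexes are finite abstract simplicial complexes; $\overline{A}$ is the simplex of all subsets of a finite set $A$. $V_m=\{\pm1,\dots,\pm m\}$; $-\sigma=\{-v:v\in\sigma\}$, $-\Gamma=\{-\sigma:\sigma\in\Gamma\}$. The join is $\Gamma*\Gamma'=\{\sigma\cup\tau\}$, $\Gamma*v:=\Gamma*\overline{\{v\}}$; a path/cycle $(v_1,\dots,v_m)$ is the 1-dimensional complex with edges $\{v_j,v_{j+1}\}$. $\partial C^*_m$ is the complex of all subsets of $V_m$ with no pair $\{j,-j\}$. For pure $\Delta$ and pure full-dimensional subcomplex $\Gamma$, $\Delta\setminus\Gamma$ is generated by facets of $\Delta$ not in $\Gamma$; $\partial B$ is the boundary of a combinatorial ball $B$. Recursive definition: $\Delta^1_n=(1,\dots,n,-1,\dots,-n,1)$; $\Delta^d_{d+1}=\partial C^*_{d+1}$; $B^{d,j}_n=\emptyset$ for $j<0$; $B^{1,0}_n=\overline{\{-1,n\}}$; $B^{2k-1,k}_n=\Delta^{2k-1}_n\setminus B^{2k-1,k-1}_n$ ($k\ge1$, $n\ge 2k$); $B^{d,i}_n=(B^{d-1,i}_{n-1}*n)\cup((-B^{d-1,i-1}_{n-1})*(-n))$ ($d\ge2$, $n\ge d+1$, $i\le\lfloor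 d/2\rfloor$); $\Delta^d_{n+1}$ is obtained from $\Delta^d_n$ by replacing $B=B^{d,\lceil d/2\rceil-1}_n$ with $\partial B*(n+1)$ and $-B$ with $\partial(-B)*(-n-1)$ (known to be well defined; $\Delta^3_n$ is a combinatorial 3-sphere on $V_n$). Let $\mathcal{I}_n$ be the collection of all sets $I=\{i_1<\dots<i_p\}\subseteq\{3,\dots,n-6\}$ ($p\ge0$) with $i_2-i_1>1$ if $p\ge2$; set $i_{p+1}:=n-2$. Let $B(I)$ be the pure 3-dimensional complex whose facets are: $\{1,2,i,i+2\}$ for $3\le i\le n-2$; $\{1,2,n-1,n\}$; $\{1,-n+2,n-1,n\}$, $\{1,-n+2,-n+1,n\}$, $\{1,-n+2,-n+1,-n\}$; $\{-n+m+1,-n+m,n-1,n\}$ for $2\le m\le i_1$ (if $p=0$, for $2\le m\le n-2$); and for each $1\le j\le p$: $\{1,-n+i_j+2,n-i_j-1,n-i_j+1\}$ and $\{-n+m+1,-n+m,n-i_j-1,n-i_j+1\}$ for $i_j+2\le m\le i_{j+1}$. Let $\partial B(I)$ be the complex generated by the 2-faces of $B(I)$ lying in exactly one facet of $B(I)$. $\Delta(I)$ is the complex whose facets are the facets of $\Delta^3_n$ not in $B(I)\cup-B(I)$, together with $\tau\cup\{n+1\}$ and $-\tau\cup\{-n-1\}$ for all facets $\tau$ of $\partial B(I)$. A complex on $V_m$ is centrally symmetric if it is closed under $\sigma\mapsto-\sigma$ and no face contains a pair $\{v,-v\}$; it is cs-$i$-neighborly if every subset of $V_m$ of size $\le i$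 with no pair $\{v,-v\}$ is a face. *)

(* Defs.v *)
From HB Require Import structures.
From mathcomp Require Import all_boot all_order all_algebra.
From mathcomp Require Import finmap reals.

Set Implicit Arguments.
Unset Strict Implicit.
Unset Printing Implicit Defensive.

Import Order.TTheory GRing.Theory Num.Theory.

Local Open Scope fset_scope.
Local Open Scope ring_scope.

(* A complex is stored as the set of all its faces, the empty face included.
   [fset0] is the void complex (no face at all), not the complex whose only
   face is the empty one. *)
Notation cplx T := {fset {fset T}}.

Section Complexes.
Variable T : choiceType.
Implicit Types (K L F : cplx T) (s t : {fset T}).

Definition is_complex K : Prop :=
  fset0 \in K /\ forall s t, s \in K -> t `<=` s -> t \in K.

Definition vertices K : {fset T} := \bigcup_(s <- K) s.

Definition simplex s : cplx T := fpowerset s.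

Definition generated F : cplx T := \bigcup_(s <- F) simplex s.

Definition facets K : cplx T :=
  [fset s in K | ~~ [exists t : K, s `<` val t]].

Definition join K L : cplx T := [fset s `|` t | s in K, t in L].

Definition cone K (v : T) : cplx T := join K (simplex [fset v]).

(* The operation written K \ L for pure complexes. *)
Definition delete K L : cplx T := generated [fset s in facets K | s \notin L].

(* For K pure of dimension d: generated by the (d-1)-faces, which have d
   elements, lying in exactly one facet. *)
Definition boundary (d : nat) K : cplx T :=
  generated [fset s in K |
    (#|` s| == d) && (#|` [fset t in facets K | s `<=` t]| == 1%N)].

(* The 1-dimensional complex with edges {v_j, v_(j+1)}. *)
Definition path_complex (p : seq T) : cplx T :=
  generated [fset [fset e.1; e.2] | e in zip p (behead p)].

End Complexes.

Definition isomorphic (T U : choiceType) (K : cplx T) (L : cplx U) : Prop :=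
  exists f : T -> U,
    {in vertices K &, injective f} /\ [fset f @` s | s : {fset T} in K] = L.

Section PL.
Variable R : realType.

Notation point T := {fsfun T -> R with 0}.

(* The geometric realization |K|, in barycentric coordinates. *)
Definition realization (T : choiceType) (K : cplx T) (x : point T) : Prop :=
  [/\ finsupp x \in K, forall v, 0 <= x v & \sum_(v <- finsupp x) x v = 1].

Definition linform (T : choiceType) (a : T -> R) (x : point T) : R :=
  \sum_(v <- finsupp x) a v * x v.

(* A convex polyhedron, given by finitely many inequalities a(x) <= b. *)
Definition in_polyhedron (T : choiceType) (P : seq ((T -> R) * R))
    (x : point T) : bool :=
  all (fun c => linform c.1 x <= c.2) P.

(* |K| is covered by finitely many convex polyhedra on each of which f is
   affine.  The polyhedra being closed, f is then continuous on |K|. *)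
Definition PL_map (T U : choiceType) (K : cplx T) (f : point T -> point U)
    : Prop :=
  exists (m : nat) (P : 'I_m -> seq ((T -> R) * R))
         (A : 'I_m -> U -> T -> R) (b : 'I_m -> U -> R),
    (forall x, realization K x -> exists i, in_polyhedron (P i) x) /\
    (forall i x, realization K x -> in_polyhedron (P i) x ->
       forall w, f x w = linform (A i w) x + b i w).

Definition PL_homeomorphic (T U : choiceType) (K : cplx T) (L : cplx U)
    : Prop :=
  exists (f : point T -> point U) (g : point U -> point T),
    [/\ forall x, realization K x -> realization L (f x) /\ g (f x) = x,
        forall y, realization L y -> realization K (g y) /\ f (g y) = y,
        PL_map K f & PL_map L g].

Definition simplex_boundary (d : nat) : cplx nat :=
  let A := [fset i | i in iota 0 d.+1] in simplex A `\ A.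

Definition combinatorial_sphere (T : choiceType) (d : nat) (K : cplx T)
    : Prop :=
  is_complex K /\ PL_homeomorphic K (simplex_boundary d.+1).

End PL.

Definition V (m : nat) : {fset int} :=
  [fset i%:Z | i in iota 1 m] `|` [fset - i%:Z | i in iota 1 m].

Definition oppf (s : {fset int}) : {fset int} := [fset - v | v in s].
Definition oppc (K : cplx int) : cplx int := [fset oppf s | s in K].

Definition antipode_free (s : {fset int}) : bool :=
  all (fun v => - v \notin s) s.

Definition centrally_symmetric (K : cplx int) : Prop :=
  (forall s, s \in K -> oppf s \in K) /\ (forall s, s \in K -> antipode_free s).

Definition cs_neighborly (i m : nat) (K : cplx int) : Prop :=
  forall s : {fset int},
    s `<=` V m -> (#|` s| <= i)%N -> antipode_free s -> s \in K.

Definition cross_boundary (m : nat) : cplx int :=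
  [fset s in fpowerset (V m) | antipode_free s].

Definition Delta1 (n : nat) : cplx int :=
  path_complex
    ([seq i%:Z | i <- iota 1 n] ++ [seq - i%:Z | i <- iota 1 n] ++ [:: 1]).

(* Delta^d_m for m >= d + 1, obtained from [cross_boundary d.+1] by the
   successive replacements of B m and -B m; the value for m <= d is junk. *)
Fixpoint Delta_from (d : nat) (B : nat -> cplx int) (m : nat) : cplx int :=
  if m is n.+1 then
    if (n <= d)%N then cross_boundary d.+1
    else delete (Delta_from d B n) (B n `|` oppc (B n))
         `|` cone (boundary d (B n)) n.+1%:Z
         `|` cone (boundary d (oppc (B n))) (- n.+1%:Z)
  else fset0.

(* B^{d,j}_n for j <= floor(d/2), from the family Bp of dimension d - 1. *)
Definition B_low (Bp : nat -> nat -> cplx int) (j n : nat) : cplx int :=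
  cone (Bp j n.-1) n%:Z
  `|` (if j is j'.+1 then cone (oppc (Bp j' n.-1)) (- n%:Z) else fset0).

(* [(Delta_B d).1 n] is Delta^d_n and [(Delta_B d).2 j n] is B^{d,j}_n; note
   that [d./2] is floor(d/2) and [uphalf d] is ceil(d/2).  Only d >= 1 and
   n >= d + 1 are meaningful. *)
Fixpoint Delta_B (d : nat) : (nat -> cplx int) * (nat -> nat -> cplx int) :=
  if d is d'.+1 then
    let low := if (d' == 0)%N then fun _ n => simplex [fset -1; n%:Z]
               else B_low (Delta_B d').2 in
    let Dl := if (d' == 0)%N then Delta1
              else Delta_from d'.+1 (low (uphalf d'.+1).-1) in
    (Dl, fun j n =>
           if (j <= d'.+1./2)%N then low j n
           else if odd d'.+1 && (j == uphalf d'.+1)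
           then delete (Dl n) (low j.-1 n)
           else fset0)
  else (fun=> fset0, fun _ _ => fset0).

Definition Delta (d n : nat) : cplx int := (Delta_B d).1 n.
Definition B (d j n : nat) : cplx int := (Delta_B d).2 j n.

Lemma Delta_1 n : Delta 1 n = Delta1 n. Proof. by []. Qed.

Lemma Delta_base d : (2 <= d)%N -> Delta d d.+1 = cross_boundary d.+1.
Proof. by case: d => [|[|d]] // _; rewrite /Delta /= ltnS leqnn. Qed.

Lemma B_10 n : B 1 0 n = simplex [fset -1; n%:Z]. Proof. by []. Qed.

Lemma B_top k n : (0 < k)%N ->
  B k.*2.-1 k n = delete (Delta k.*2.-1 n) (B k.*2.-1 k.-1 n).
Proof.
case: k => // k _.
have low_top : B k.+1.*2.-1 k n = (if k == 0%N then simplex [fset -1; n%:Z]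
    else B_low (Delta_B k.*2).2 k n).
  by rewrite /B doubleS /= uphalf_double leqnn double_eq0; case: (k == 0%N).
rewrite [k.+1.-1]/= low_top /B /Delta doubleS /= uphalf_double odd_double.
by rewrite doubleK ltnn eqxx double_eq0; case: (k == 0%N).
Qed.

Lemma B_rec d j n : (2 <= d)%N -> (j <= d./2)%N ->
  B d j n = cone (B d.-1 j n.-1) n%:Z
    `|` (if j is j'.+1 then cone (oppc (B d.-1 j' n.-1)) (- n%:Z) else fset0).
Proof. by case: d => [|[|d]] // _ hj; rewrite {1}/B [LHS]/= hj. Qed.

Lemma Delta_step d n : (2 <= d)%N -> (d < n)%N ->
  let Bn := B d (uphalf d).-1 n in
  Delta d n.+1 = delete (Delta d n) (Bn `|` oppc Bn)
    `|` cone (boundary d Bn) n.+1%:Z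
    `|` cone (boundary d (oppc Bn)) (- n.+1%:Z).
Proof.
case: d => [|[|d]] // _ hn Bn.
have -> : Bn = B_low (Delta_B d.+1).2 (uphalf d.+2).-1 n.
  have h : ((uphalf d.+2).-1 <= d.+2./2)%N.
    by rewrite uphalf_half; case: (odd _); rewrite ?add0n ?leq_pred ?leqnn.
  by rewrite /Bn /B [LHS]/= [X in if X then _ else _]h.
by rewrite /Delta /= leqNgt hn.
Qed.

(* A set {i_1 < ... < i_p} is represented by its increasing enumeration. *)
Definition index_sets (n : nat) : pred (seq nat) :=
  fun I => [&& sorted ltn I, all (fun i => 3 <= i <= n - 6)%N I
    & (2 <= size I)%N ==> (1 < nth 0 I 1 - nth 0 I 0)%N].

(* [idx n I k] is i_(k+1); the default value implements i_(p+1) := n - 2. *)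
Definition idx (n : nat) (I : seq nat) (k : nat) : nat := nth (n - 2)%N I k.

Definition BI_facets (n : nat) (I : seq nat) : seq {fset int} :=
  let N : int := n%:Z in
  [seq [fset 1; 2; i%:Z; i%:Z + 2] | i <- index_iota 3 n.-1]
  ++ [:: [fset 1; 2; N - 1; N];
         [fset 1; - N + 2; N - 1; N];
         [fset 1; - N + 2; - N + 1; N];
         [fset 1; - N + 2; - N + 1; - N]]
  ++ [seq [fset - N + m%:Z + 1; - N + m%:Z; N - 1; N]
       | m <- index_iota 2 (idx n I 0).+1]
  ++ flatten [seq
       let i := (idx n I k)%:Z in
       [fset 1; - N + i + 2; N - i - 1; N - i + 1]
       :: [seq [fset - N + m%:Z + 1; - N + m%:Z; N - i - 1; N - i + 1]
            | m <- index_iota (idx n I k + 2) (idx n I k.+1).+1]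
       | k <- iota 0 (size I)].

Definition BI (n : nat) (I : seq nat) : cplx int :=
  generated [fset s | s in BI_facets n I].

Definition DeltaI (n : nat) (I : seq nat) : cplx int :=
  let F := facets (boundary 3 (BI n I)) in
  generated
    ([fset s in facets (Delta 3 n) | s \notin BI n I `|` oppc (BI n I)]
     `|` [fset t `|` [fset n%:Z + 1] | t in F]
     `|` [fset oppf t `|` [fset - n%:Z - 1] | t in F]).

(* Main.v *)
(* B^{3,1}_n and B(I) are stacked: their facets can be listed so that each one
   joins a new vertex to a triangle of an earlier one.  Replacing a stacked
   ball by the cone over its boundary amounts to a stellar subdivision of one
   facet followed by bistellar moves, so it preserves the PL type; it also
   keeps every edge.  Starting from the cross-polytope, this shows that
   Delta(I) is a PL sphere whose only missing edges are the pairs {v, -v}.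

   An isomorphism f from Delta(I) to Delta(J) therefore commutes with v -> -v.
   Say that an edge {a, b} misses c if c is none of a, -a, b, -b and {a, b, c}
   is not a face.  The edge {2, 3} misses only -1, whereas every edge other than
   {2, 3}, {n-2, n} and their antipodes misses at least two vertices.  Up to
   sign, f thus maps {2, 3} to {2, 3} or to {n-2, n}.  Following f along the
   link of {2, 3}, a cycle, excludes {n-2, n} and the reflection of this cycle
   by exhibiting a face sent to a non-face, and otherwise shows that f fixes
   1, 4, ..., n.  Finally i is in I if and only if the triangle
   {1, n-i-1, n-i+1} is interior to B(I), that is, missing from Delta(I).

   The sets {3} u J with J contained in {5, ..., n-6} give 2^(n-10) spheres. *)
Require Import Defs.
From HB Require Import structures.
From mathcomp Require Import all_boot all_order all_algebra.
From mathcomp Require Import finmap reals zify ring.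

Set Implicit Arguments.
Unset Strict Implicit.
Unset Printing Implicit Defensive.

Import Order.TTheory GRing.Theory Num.Theory.

Local Open Scope fset_scope.
Local Open Scope ring_scope.

(* The [oppf] of mathcomp's fraction.v shadows the one of Defs. *)
Local Notation oppf := Defs.oppf.

(** * PL homeomorphisms *)

(** The construction runs on sets of four-element facets rather than on complexes, and the invariant
    [cs_sphere] bundles what the next replacement consumes: purity, at most two facets on a
    triangle, symmetry, all edges and the PL type. Edges survive because a stacked 3-ball has no
    interior edge. The PL maps are explicit: both sides of a bistellar move live in the same
    coordinates, and weight is moved from one vertex set to another. Everything about Delta(I) comes
    from two dual observations on the stages k of the construction. A removed facet has a vertex of
    absolute value k and one of absolute value k - 1, so a facet that skips one of these levels is
    never removed again. Conversely no stage creates a face on old vertices, so a triangle stays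
    missing once it is interior to a replaced ball, or once its vertex k + 1 is added while the
    other two vertices share no facet of B^{3,1}_k. Both observations reduce to linear arithmetic on
    explicit lists of facets. The hypothesis n >= 10 makes 10 and -10 old vertices, which serve as
    missed vertices for the edges among the small vertices. *)

Section PLTheory.
Variable R : realType.

Local Notation point T := {fsfun T -> R with 0}.

Section LinearForms.
Variable T : choiceType.
Implicit Types (x y : point T) (S : {fset T}) (a : T -> R).

Lemma linformE a x S : finsupp x `<=` S -> linform a x = \sum_(v <- S) a v * x v.
Proof.
move=> sub; rewrite /linform; apply: big_fset_incl => // v _ vx.
by rewrite memNfinsupp in vx; rewrite (eqP vx) mulr0.
Qed.

Lemma weightE x S : finsupp x `<=` S ->
  \sum_(v <- finsupp x) x v = \sum_(v <- S) x v.
Proof.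
move=> sub; apply: big_fset_incl => // v _ vx.
by rewrite memNfinsupp in vx; rewrite (eqP vx).
Qed.

Lemma sum_delta (S : {fset T}) (F : T -> R) w : w \in S ->
  \sum_(v <- S) (v == w)%:R * F v = F w.
Proof.
move=> wS; rewrite (big_fsetD1 w) //= eqxx mul1r big1_fset ?addr0 //.
by move=> i; rewrite !inE => /andP[/negPf -> _] _; rewrite mul0r.
Qed.

Lemma linform_delta w x : linform (fun v => (v == w)%:R) x = x w.
Proof.
rewrite (@linformE _ _ (w |` finsupp x)) ?fsubsetUr // sum_delta //.
by rewrite !inE eqxx.
Qed.

Lemma linformDl a b x : linform (fun v => a v + b v) x = linform a x + linform b x.
Proof. by rewrite -big_split; apply: eq_bigr => v _; rewrite mulrDl. Qed.

Lemma linformZl c a x : linform (fun v => c * a v) x = c * linform a x.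
Proof. by rewrite /linform mulr_sumr; apply: eq_bigr => v _; rewrite mulrA. Qed.

Lemma linform_suml (I : Type) (r : seq I) (a : I -> T -> R) x :
  linform (fun v => \sum_(i <- r) a i v) x = \sum_(i <- r) linform (a i) x.
Proof.
rewrite /linform exchange_big; apply: eq_bigr => v _ /=.
by rewrite mulr_suml.
Qed.

Lemma finsupp_sub x S : (forall v, v \notin S -> x v = 0) -> finsupp x `<=` S.
Proof.
move=> h; apply/fsubsetP => v; rewrite mem_finsupp; apply: contraR => vS.
by rewrite h.
Qed.

End LinearForms.

Lemma PL_homeo_refl (T : choiceType) (K : cplx T) : PL_homeomorphic R K K.
Proof.
exists id, id; split => //.
all: exists 1%N, (fun=> [::]), (fun _ w v => (v == w)%:R), (fun _ _ => 0).
all: by split=> [x _|i x _ _ w]; [exists ord0 | rewrite linform_delta addr0].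
Qed.

Lemma PL_homeo_sym (T U : choiceType) (K : cplx T) (L : cplx U) :
  PL_homeomorphic R K L -> PL_homeomorphic R L K.
Proof. by case=> f [g [h1 h2 h3 h4]]; exists g, f; split. Qed.

(* On a piece where f is affine, the inequalities defining a piece of g pull
   back to inequalities with coefficients [aff a c].1; these are finite sums
   because |L| only involves the vertices of L. *)
Lemma PL_map_comp (T U W : choiceType) (K : cplx T) (L : cplx U)
    (f : point T -> point U) (g : point U -> point W) :
  (forall x, realization K x -> realization L (f x)) ->
  PL_map K f -> PL_map L g -> PL_map K (g \o f).
Proof.
move=> fKL [m [P [A [b [cov aff]]]]] [m' [P' [A' [b' [cov' aff']]]]].
pose V0 := vertices L.
have subV (x : point U) : realization L x -> finsupp x `<=` V0.
  by case=> xL _ _; apply: bigfcup_sup.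
pose pb i (a : U -> R) : (T -> R) * R :=
  (fun v => \sum_(w <- V0) a w * A i w v, \sum_(w <- V0) a w * b i w).
have pbE i a x : realization K x -> in_polyhedron (P i) x ->
    linform a (f x) = linform (pb i a).1 x + (pb i a).2.
  move=> xK xP; rewrite (linformE _ (subV _ (fKL _ xK))) /= linform_suml -big_split.
  by apply: eq_bigr => w _ /=; rewrite linformZl (aff i) // mulrDr.
exists (m * m')%N.
(* Pieces of the composite are indexed by pairs of pieces; [mxvec_index] codes a pair of ordinals as
   a single ordinal. *)
pose p1 (k : 'I_(m * m')) : 'I_m * 'I_m' := enum_val (cast_ord (esym (mxvec_cast m m')) k).
exists (fun k => P (p1 k).1 ++
   [seq ((pb (p1 k).1 c.1).1, c.2 - (pb (p1 k).1 c.1).2) | c <- P' (p1 k).2]).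
exists (fun k w => (pb (p1 k).1 (A' (p1 k).2 w)).1).
exists (fun k w => (pb (p1 k).1 (A' (p1 k).2 w)).2 + b' (p1 k).2 w).
split=> [x xK|k x xK].
  have [i xi] := cov x xK; have [j xj] := cov' (f x) (fKL x xK).
  exists (mxvec_index i j).
  have -> : p1 (mxvec_index i j) = (i, j) by rewrite /p1 /mxvec_index cast_ordK enum_rankK.
  rewrite /in_polyhedron all_cat all_map /=; apply/andP; split => //.
  by apply: sub_all xj => c /=; rewrite lerBrDr -pbE.
case: (p1 k) => i j /=; rewrite /in_polyhedron all_cat all_map => /andP[xi xj] w.
have fj : in_polyhedron (P' j) (f x).
  by apply: sub_all xj => c; rewrite (pbE i) // -lerBrDr.
by rewrite /= (aff' j _ (fKL x xK) fj) (pbE i) // addrA.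
Qed.

Lemma PL_homeo_trans (T U W : choiceType) (K : cplx T) (L : cplx U) (M : cplx W) :
  PL_homeomorphic R K L -> PL_homeomorphic R L M -> PL_homeomorphic R K M.
Proof.
case=> f [g [h1 h2 h3 h4]] [f' [g' [h1' h2' h3' h4']]].
exists (f' \o f), (g \o g'); split => /=.
- by move=> x /h1[/h1'[? e] e']; rewrite e e'.
- by move=> x /h2'[/h2[? e] e']; rewrite e e'.
- by apply: PL_map_comp h3 h3' => x /h1[].
- by apply: PL_map_comp h4' h4 => x /h2'[].
Qed.

End PLTheory.

(** * Bistellar moves *)

Section BistellarMoves.
Variable T : choiceType.
Implicit Types (K L : cplx T) (s t u A B : {fset T}).

(* K contains the star of A, which is A * bd(B) * N for some complex N, and L
   is obtained by replacing it with bd(A) * B * N.  A stellar subdivision at A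
   is the case where B is a single new vertex. *)
Definition bistellar A B K L : Prop :=
  [/\ [/\ [disjoint A & B], A != fset0 & B != fset0],
      (forall t, t \in K -> ~~ (B `<=` t)) /\ (forall t, t \in L -> ~~ (A `<=` t)),
      (forall t, ~~ (A `<=` t) -> ~~ (B `<=` t) -> (t \in K) = (t \in L)) &
      (forall t u, t \in K -> A `<=` t -> u `<=` t `|` B -> ~~ (A `<=` u) -> u \in L)
      /\ (forall t u, t \in L -> B `<=` t -> u `<=` t `|` A -> ~~ (B `<=` u) ->
            u \in K)].

Lemma bistellar_sym A B K L : bistellar A B K L -> bistellar B A L K.
Proof.
case=> [[dAB A0 B0]] [sK sL] e [fw bw]; split=> //; first split=> //; first by rewrite fdisjoint_sym.
by move=> t h1 h2; rewrite e.
Qed.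

Variable R : realType.
Local Notation point := {fsfun T -> R with 0}.
Implicit Types (x y : point).

Definition min_on A y : R := head 0 (sort <=%R [seq y v | v <- A]).

Lemma min_onP A y : A != fset0 ->
  exists2 a, a \in A & min_on A y = y a /\ forall b, b \in A -> y a <= y b.
Proof.
case/fset0Pn=> a0 a0A; rewrite /min_on.
have := mem_sort <=%R [seq y v | v <- A].
have := sort_sorted (@le_total _ R) [seq y v | v <- A].
case: (sort _ _) => [_ /(_ (y a0))|z s]; first by rewrite map_f // in_nil.
rewrite /= (path_sortedE le_trans) => /andP[/allP zs _] mem_s.
have /mapP[a aA za] : z \in [seq y v | v <- A] by rewrite -mem_s mem_head.
exists a => //; split => // b bA; rewrite -za.
have : y b \in z :: s by rewrite mem_s map_f.
by rewrite inE => /predU1P[->|/zs].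
Qed.

Lemma min_on_eq A y a : a \in A -> (forall b, b \in A -> y a <= y b) ->
  min_on A y = y a.
Proof.
move=> aA ha; have [|b bA [-> hb]] := @min_onP A y; first by apply/fset0Pn; exists a.
by apply/le_anti; rewrite ha // hb.
Qed.

(* Shifts as much weight as possible from A to B, evenly on each of them. *)
Definition flip_point A B y : point :=
  let c := #|` A|%:R / #|` B|%:R in
  [fsfun v in finsupp y `|` A `|` B =>
    y v - (v \in A)%:R * min_on A y + (v \in B)%:R * (c * min_on A y)].

Lemma flip_pointE A B y v : flip_point A B y v =
  y v - (v \in A)%:R * min_on A y
      + (v \in B)%:R * (#|` A|%:R / #|` B|%:R * min_on A y).
Proof.
rewrite fsfunE !inE; case: (boolP (v \in A)) => vA; first by rewrite orbT.
case: (boolP (v \in B)) => vB; first by rewrite orbT.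
rewrite !orbF !mul0r subr0 addr0.
by case: (finsuppP y v).
Qed.

(** One piece for each [a] in [A]: the points at which [a] has the least weight in [A]. There the
    minimum is the coordinate of [a], so the shift is linear. *)
Lemma PL_map_flip A B K : A != fset0 -> PL_map K (@flip_point A B).
Proof.
move=> A0; have [a0 a0A] := fset0Pn _ A0.
pose a (i : 'I_(size A)) := nth a0 A i.
have aA i : a i \in A by apply: mem_nth.
pose c : R := #|` A|%:R / #|` B|%:R.
exists (size A).
exists (fun i => [seq (fun v => (v == a i)%:R + -1 * (v == b)%:R, 0) | b <- A]).
exists (fun i w v => (v == w)%:R
  + ((w \in B)%:R * c - (w \in A)%:R) * (v == a i)%:R).
exists (fun _ _ => 0); split=> [y _|i y _ yP w].
  have [b bA [_ hb]] := min_onP y A0.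
  exists (Ordinal (etrans (index_mem b A) bA)).
  rewrite /in_polyhedron all_map; apply/allP => d dA /=.
  rewrite linformDl linformZl !linform_delta /a /= nth_index //.
  by rewrite mulN1r subr_le0 hb.
rewrite linformDl linformZl !linform_delta addr0 flip_pointE (@min_on_eq _ _ (a i)) //.
  by rewrite -/c; ring.
move=> b bA; move: yP; rewrite /in_polyhedron all_map => /allP /(_ b bA) /=.
by rewrite linformDl linformZl !linform_delta mulN1r subr_le0.
Qed.

(** A vertex of [A] outside the support has weight 0, so there is nothing to shift: outside the open
    star of [A] the map is the identity. *)
Lemma flip_point_id A B y : A != fset0 -> (forall v, 0 <= y v) ->
  ~~ (A `<=` finsupp y) -> flip_point A B y = y.
Proof.
move=> A0 y0 /fsubsetPn[b bA by0].
rewrite memNfinsupp in by0.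
have m0 : min_on A y = 0.
  by rewrite (@min_on_eq _ _ b) ?(eqP by0).
by apply/fsfunP => v; rewrite flip_pointE m0 !mulr0 subr0 addr0.
Qed.

(** The set [A] loses its least weight [#|A|] times and [B] receives the same total, which is the
    role of the quotient of cardinalities. The shift exhausts some vertex of [A], so the new support
    lies in the other complex. *)
Lemma flip_pointK A B K L y : bistellar A B K L -> realization K y ->
  realization L (flip_point A B y) /\ flip_point B A (flip_point A B y) = y.
Proof.
case=> [[dAB A0 B0]] [sK sL] e [fw _] [yK y0 y1].
have nB := sK _ yK.
case: (boolP (A `<=` finsupp y)) => Ay; last first.
  rewrite !flip_point_id //; split => //; split => //.
  by rewrite -e.
have [a aA [ma ha]] := min_onP y A0.
have [b bB by0] := fsubsetPn _ _ nB.
rewrite memNfinsupp in by0; move/eqP in by0.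
have m0 : 0 <= y a by [].
pose c : R := #|` A|%:R / #|` B|%:R.
have cA0 : #|` A|%:R != 0 :> R by rewrite pnatr_eq0 cardfs_eq0.
have cB0 : #|` B|%:R != 0 :> R by rewrite pnatr_eq0 cardfs_eq0.
have c0 : 0 <= c by rewrite divr_ge0.
have nAB v : v \in A -> v \in B = false.
  by move=> vA; apply/negbTE; move/fdisjointP: dAB; apply.
have flE v : flip_point A B y v = y v - (v \in A)%:R * y a + (v \in B)%:R * (c * y a).
  by rewrite flip_pointE ma.
have fl0 v : 0 <= flip_point A B y v.
  rewrite flE; case: (boolP (v \in A)) => vA.
    by rewrite (nAB v) // mul1r mul0r addr0 subr_ge0 ha.
  by rewrite mul0r subr0 addr_ge0 // mulr_ge0 // mulr_ge0.
have sub : finsupp (flip_point A B y) `<=` finsupp y `|` B.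
  apply: finsupp_sub => v; rewrite !inE negb_or => /andP[vy vB].
  have vA : v \notin A by apply: contra vy; apply: (fsubsetP Ay).
  rewrite memNfinsupp in vy.
  by rewrite flE (negPf vA) (negPf vB) (eqP vy) !mul0r subr0 addr0.
have nA : ~~ (A `<=` finsupp (flip_point A B y)).
  apply/fsubsetPn; exists a => //.
  by rewrite memNfinsupp flE aA (nAB a) // mul1r mul0r addr0 subrr.
split.
  split=> //; first by apply: (fw _ _ yK).
  rewrite (weightE sub) -[RHS]y1 (@weightE _ _ y (finsupp y `|` B)) ?fsubsetUl //.
  rewrite (eq_bigr _ (fun v _ => flE v)) big_split sumrB /=.
  have sumI (S : {fset T}) (r : R) : S `<=` finsupp y `|` B ->
      \sum_(v <- finsupp y `|` B) (v \in S)%:R * r = #|` S|%:R * r.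
    move=> sS; rewrite -mulr_suml; congr (_ * _).
    rewrite -(big_fset_incl _ sS) /=; last by move=> i _ /negPf->.
    rewrite (eq_big_seq (fun=> 1)); last by move=> i ->.
    by rewrite big_const_seq count_predT iter_addr addr0.
  rewrite !sumI ?fsubsetUr //; last exact: fsubset_trans Ay (fsubsetUl _ _).
  have -> : #|` B|%:R * (c * y a) = #|` A|%:R * y a by rewrite /c; field.
  by rewrite subrK.
(* The vertex [b] had weight 0 before the shift, so afterwards it attains the minimum over [B]. The
   amount shifted can be read off there and shifted back. *)
have mB : min_on B (flip_point A B y) = c * y a.
  have bA : (b \in A) = false by apply/negbTE; apply: contraL bB => /nAB ->.
  have fb : flip_point A B y b = c * y a.
    by rewrite flE by0 bB bA mul0r subr0 add0r mul1r.
  rewrite (@min_on_eq _ _ b) ?fb // {fb} => d dB.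
  have dA : (d \in A) = false by apply/negbTE; apply: contraL dB => /nAB ->.
  by rewrite flE dB dA mul0r subr0 mul1r lerDr.
apply/fsfunP => v; rewrite flip_pointE mB flE.
have -> : #|` B|%:R / #|` A|%:R * (c * y a) = y a.
  by rewrite /c; field; rewrite cA0 cB0.
by ring.
Qed.

Lemma PL_bistellar A B K L : bistellar A B K L -> PL_homeomorphic R K L.
Proof.
move=> h; have h' := bistellar_sym h.
exists (@flip_point A B), (@flip_point B A); split.
- by move=> y /(flip_pointK h).
- by move=> y /(flip_pointK h').
- by apply: PL_map_flip; case: h => [[]].
- by apply: PL_map_flip; case: h => [[]].
Qed.

End BistellarMoves.

(** * The cross-polytope *)

Lemma generatedP (T : choiceType) (F : cplx T) (s : {fset T}) :
  reflect (exists2 t, t \in F & s `<=` t) (s \in generated F).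
Proof.
apply: (iffP (bigfcupP _ _ _ _)) => [[t /andP[tF _]]|[t tF st]].
  by rewrite fpowersetE => st; exists t.
by exists t; rewrite ?tF ?fpowersetE.
Qed.

(** * Invariance under relabelling of vertices *)

Section Relabelling.
Variables (R : realType) (T U : choiceType) (e : T -> U) (h : U -> T).
Variable K : cplx T.
Local Notation VK := (vertices K).
Local Notation eK := [fset e @` (s : {fset T}) | s in K].
Hypothesis eK_inv : forall v, v \in VK -> h (e v) = v.

Definition push_point (x : {fsfun T -> R with 0}) : {fsfun U -> R with 0} :=
  [fsfun w in e @` VK => x (h w)].
Definition pull_point (y : {fsfun U -> R with 0}) : {fsfun T -> R with 0} :=
  [fsfun v in VK => y (e v)].

Let sub_vertices s : s \in K -> s `<=` VK.
Proof. by move=> sK; apply: bigfcup_sup. Qed.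

Let inj_e : {in VK &, injective e}.
Proof. by move=> u v uV vV euv; rewrite -(eK_inv uV) euv eK_inv. Qed.

Let push_pointE x v : v \in VK -> push_point x (e v) = x v.
Proof. by move=> vV; rewrite fsfunE in_imfset // eK_inv. Qed.

Let mem_image s v : s `<=` VK -> v \in VK -> (e v \in e @` s) = (v \in s).
Proof.
move=> sV vV; apply/imfsetP/idP => [[u /= us]|vs]; last by exists v.
by move/inj_e=> -> //; apply: (fsubsetP sV).
Qed.

Let sum_image (F : U -> R) : \sum_(w <- e @` VK) F w = \sum_(v <- VK) F (e v).
Proof. by rewrite big_imfset. Qed.

Lemma PL_homeo_image : PL_homeomorphic R K eK.
Proof.
exists push_point, pull_point; split.
- move=> x [xK x0 x1]; split.
    have supp_push : finsupp (push_point x) = e @` finsupp x.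
      apply/fsetP => w; rewrite mem_finsupp fsfunE.
      case: (boolP (w \in _)) => [/imfsetP[v /= vV ->]|wV].
        by rewrite eK_inv // -mem_finsupp mem_image // sub_vertices.
      rewrite eqxx; apply/esym/negbTE; apply: contra wV => /imfsetP[v /= vx ->].
      by apply/imfsetP; exists v => //=; apply: (fsubsetP (sub_vertices xK)).
    split.
    + by rewrite supp_push; apply/imfsetP; exists (finsupp x).
    + by move=> w; rewrite fsfunE; case: ifP.
    rewrite (@weightE _ _ _ (e @` VK)); last first.
      by rewrite supp_push; apply: subset_imfset; apply/fsubsetP/sub_vertices.
    rewrite sum_image -x1 (weightE (sub_vertices xK)).
    by apply: eq_big_seq => v vV; rewrite push_pointE.
  apply/fsfunP => v; rewrite fsfunE; case: ifP => [vV|/negbT vV].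
    by rewrite push_pointE.
  apply/esym/eqP; rewrite -memNfinsupp; apply: contra vV.
  exact: (fsubsetP (sub_vertices xK)).
- move=> y [/imfsetP[s /= sK suppy] y0 y1].
  have sV := sub_vertices sK.
  have sy v : v \in VK -> (v \in s) = (y (e v) != 0).
    by move=> vV; rewrite -mem_finsupp suppy mem_image.
  have supp_pull : finsupp (pull_point y) = s.
    apply/fsetP => v; rewrite mem_finsupp fsfunE.
    case: (boolP (v \in VK)) => vV; first by rewrite sy.
    by rewrite eqxx; apply/esym/negbTE; apply: contra vV; apply: (fsubsetP sV).
  split; first split.
  + by rewrite supp_pull.
  + by move=> v; rewrite fsfunE; case: ifP.
  + rewrite (@weightE _ _ _ VK) ?supp_pull // -y1.
    rewrite (@weightE _ _ y (e @` VK)) ?suppy; last first.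
      by apply: subset_imfset; apply/fsubsetP.
    rewrite sum_image; apply: eq_big_seq => v vV.
    by rewrite fsfunE vV.
  apply/fsfunP => w; rewrite fsfunE; case: (boolP (w \in _)) => wV.
    by case/imfsetP: wV => v /= vV ->; rewrite eK_inv // fsfunE vV.
  apply/esym/eqP; rewrite -memNfinsupp suppy; apply: contra wV.
  by move=> /imfsetP[v /= vs ->]; apply/imfsetP; exists v => //=; apply: (fsubsetP sV).
(* Both maps are linear, so one piece without inequalities suffices. The membership factor kills the
   coordinates outside the vertex set, where the inverse labelling is arbitrary. *)
- exists 1%N, (fun=> [::]).
  exists (fun _ w v => (w \in e @` VK)%:R * (v == h w)%:R), (fun _ _ => 0).
  split=> [x _|i x _ _ w]; first by exists ord0.
  rewrite linformZl linform_delta addr0 fsfunE.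
  by case: ifP; rewrite ?mul1r ?mul0r.
- exists 1%N, (fun=> [::]).
  exists (fun _ v w => (v \in VK)%:R * (w == e v)%:R), (fun _ _ => 0).
  split=> [x _|i x _ _ w]; first by exists ord0.
  rewrite linformZl linform_delta addr0 fsfunE.
  by case: ifP; rewrite ?mul1r ?mul0r.
Qed.

End Relabelling.

(** * Complexes given by nonfaces *)

Section CrossPolytope.
Variable R : realType.

(** If the sets in [Ns] are disjoint and cover [W], this is the join of the boundaries of the
    simplices on them. One nonface gives the boundary of a simplex and the pairs {v, -v} give the
    cross-polytope, so a single format covers the way from one to the other. *)
Definition avoiding (T : choiceType) (W : {fset T}) (Ns : seq {fset T}) : cplx T :=
  [fset s in fpowerset W | all (fun N : {fset T} => ~~ (N `<=` s)) Ns].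

Lemma avoidingE (T : choiceType) (W : {fset T}) Ns s :
  (s \in avoiding W Ns) = (s `<=` W) && all (fun N : {fset T} => ~~ (N `<=` s)) Ns.
Proof. by rewrite !inE fpowersetE. Qed.

(* Stellar subdivision of bd(A u C) * L at A yields bd(A) * bd(x u C) * L. *)
Lemma avoiding_split (T : choiceType) (W A C : {fset T}) (x : T) Ns :
  A != fset0 -> x \notin W -> [disjoint A & C] -> A `|` C `<=` W ->
  all (fun N => [disjoint N & x |` A]) Ns ->
  bistellar A [fset x] (avoiding W ((A `|` C) :: Ns))
                       (avoiding (x |` W) (A :: (x |` C) :: Ns)).
Proof.
move=> A0 xW dAC ACW /allP dN.
have [AW CW] : A `<=` W /\ C `<=` W by apply/andP; rewrite -fsubUset.
have xA : x \notin A by apply: contra xW; apply: (fsubsetP AW).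
have xC : x \notin C by apply: contra xW; apply: (fsubsetP CW).
have dNx N : N \in Ns -> x \notin N /\ [disjoint N & A].
  move=> /dN /fdisjointP h; split.
    by apply/negP => /h; rewrite !inE eqxx.
  by apply/fdisjointP => v /h; rewrite !inE negb_or => /andP[].
have sub_del (t u : {fset T}) : x \notin t -> t `<=` x |` u -> t `<=` u.
  move=> xt tu; apply/fsubsetP => v vt; have := fsubsetP tu _ vt.
  by rewrite !inE => /orP[/eqP vx|//]; rewrite vx (negPf xt) in vt.
have sub_disj (N u : {fset T}) : [disjoint N & A] -> N `<=` u `|` A -> N `<=` u.
  move=> /fdisjointP dNA Nu; apply/fsubsetP => v vN; have := fsubsetP Nu _ vN.
  by rewrite !inE (negPf (dNA _ vN)) orbF.
split=> //.
- split=> //; first by apply/fdisjointP => v; rewrite !inE; apply: contraTneq => ->.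
  by apply/fset0Pn; exists x; rewrite inE.
- split=> t; rewrite avoidingE /=.
    by case/andP => tW _; rewrite fsub1set; apply: contra xW; apply: (fsubsetP tW).
  by case/and3P.
- move=> t At; rewrite fsub1set !avoidingE /= => xt.
  rewrite !fsubUset (negPf At) /= fsub1set (negPf xt) /=; congr (_ && _).
  by apply/idP/idP => [tW|/(sub_del _ _ xt)//]; apply: fsubset_trans tW (fsubsetUr _ _).
- split=> t u; rewrite !avoidingE /=.
    case/and3P => tW ACt /allP Nt At utx Au; rewrite Au /=; apply/and3P; split.
    + by apply: fsubset_trans utx _; rewrite fsetUC fsetUS.
    + apply: contra ACt; rewrite !fsubUset At /= => /andP[_ Cu].
      by apply: (sub_del _ _ xC); rewrite fsetUC; apply: fsubset_trans utx.
    apply/allP => N NN; apply: contra (Nt _ NN) => Nu.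
    by apply: (sub_del _ _ (dNx N NN).1); rewrite fsetUC; apply: fsubset_trans utx.
  rewrite !fsub1set => /and4P[tW At xCt /allP Nt] xt utA xu.
  apply/and3P; split.
  + apply: sub_del => //; apply: fsubset_trans utA _.
    by rewrite fsubUset tW; apply: fsubset_trans AW (fsubsetUr _ _).
  + apply: contra xCt; rewrite !fsubUset fsub1set xt => /andP[_ Cu] /=.
    apply: sub_disj; first by rewrite fdisjoint_sym.
    exact: fsubset_trans utA.
  apply/allP => N NN; apply: contra (Nt _ NN) => Nu.
  by apply: sub_disj (dNx N NN).2 _; apply: fsubset_trans utA.
Qed.

Lemma image_simplex_boundary (T U : choiceType) (e : T -> U) (A : {fset T}) :
  {in A &, injective e} ->
  [fset e @` (s : {fset T}) | s in simplex A `\ A] = avoiding (e @` A) [:: e @` A].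
Proof.
move=> inj_e; apply/fsetP => t; rewrite avoidingE /= andbT.
apply/imfsetP/andP => [[s /=]|[tA At]].
  rewrite !inE fpowersetE => /andP[sA sub] ->; split.
    by apply: subset_imfset; apply/fsubsetP.
  apply: contra sA => sub'; rewrite eqEfsubset sub /=.
  apply/fsubsetP => v vA; have /(fsubsetP sub') : e v \in e @` A by apply: in_imfset.
  by case/imfsetP => u /= us /inj_e -> //; apply: (fsubsetP sub).
exists [fset v in A | e v \in t] => /=.
  rewrite !inE fpowersetE; apply/andP; split.
    apply: contra At => /eqP sA; apply/fsubsetP => w /imfsetP[v /= vA ->].
    by move: vA; rewrite -{1}sA !inE => /andP[].
  by apply/fsubsetP => v; rewrite !inE => /andP[].
apply/fsetP => w; apply/idP/imfsetP => [wt|[v /=]].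
  have /imfsetP[v /= vA wv] := fsubsetP tA _ wt.
  by exists v; rewrite //= !inE vA -wv.
by rewrite !inE => /andP[_ evt] ->.
Qed.

Lemma eq_avoiding (T : choiceType) (W W' : {fset T}) Ns Ns' :
  W = W' -> Ns =i Ns' -> avoiding W Ns = avoiding W' Ns'.
Proof.
by move=> -> eN; apply/fsetP => s; rewrite !avoidingE (eq_all_r eN).
Qed.

Lemma antipode_freeP (s : {fset int}) :
  reflect (forall v, v \in s -> - v \notin s) (antipode_free s).
Proof. exact: allP. Qed.

Lemma mem_V (m : nat) (v : int) : (v \in V m) = (0 < `|v| <= m)%N.
Proof.
rewrite in_fsetU; apply/orP/idP.
  by case=> /imfsetP[i /=]; rewrite mem_iota => hi ->; lia.
case: v => k hk; [left|right]; apply/imfsetP.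
  by exists k => //=; rewrite mem_iota; lia.
by exists k.+1 => //=; rewrite mem_iota; lia.
Qed.

(** Three stellar subdivisions of the boundary of the simplex on 1, -1, 2, 3, 4. The new vertices
    -2, -3, -4 split the nonface successively into {1, -1} and {-2, 2, 3, 4}, then {-2, 2} and {-3,
    3, 4}, then {-3, 3} and {-4, 4}. *)
Lemma cross_boundary4 : PL_homeomorphic R (cross_boundary 4) (simplex_boundary 4).
Proof.
pose p : seq int := [:: 1; -1; 2; 3; 4].
set A0 := [fset i | i in iota 0 5].
have A0E i : (i \in A0) = (i \in iota 0 5).
  by apply/imfsetP/idP => [[j /= ji ->]//|ii]; exists i.
have inj : {in A0, cancel (nth 0 p) (index^~ p)}.
  by move=> i; rewrite A0E mem_iota => ?; rewrite index_uniq.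
have -> : cross_boundary 4 =
    avoiding ([fset -4] `|` ([fset -3] `|` ([fset -2] `|` [fset 1; -1; 2; 3; 4])))
      [:: [fset -4; 4]; [fset -3; 3]; [fset -2; 2]; [fset 1; -1]].
  apply/fsetP => s; rewrite avoidingE !inE fpowersetE.
  have -> : V 4 = [fset -4] `|` ([fset -3] `|` ([fset -2] `|` [fset 1; -1; 2; 3; 4])).
    by apply/fsetP => v; rewrite mem_V !inE; lia.
  case sW: (s `<=` _) => //=; rewrite !fsubUset !fsub1set.
  apply/antipode_freeP/idP => [h|h v vs].
    have h' (a b : int) : b = - a -> ~~ ((a \in s) && (b \in s)).
      by move=> ->; apply/negP => /andP[/h/negP].
    by rewrite !h'.
  apply/negP => nvs; have := fsubsetP sW _ vs; rewrite !inE => vW; move: h vs nvs.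
  by move: vW => /or4P[/eqP->|/eqP->|/eqP->|/orP[/orP[/orP[/orP[]|]|]|] /eqP->];
     rewrite ?opprK => h vs nvs; move: h; rewrite ?vs ?nvs ?andbF.
apply: PL_homeo_sym.
have := @PL_homeo_image R _ _ (nth 0 p) (index^~ p) (simplex_boundary 4).
rewrite image_simplex_boundary; last exact: can_in_inj inj.
rewrite (_ : nth 0 p @` A0 = [fset 1; -1; 2; 3; 4]); last first.
  apply/fsetP => w; rewrite !inE; apply/imfsetP/idP => [[i /=]|].
    by rewrite A0E mem_iota; case: i => [|[|[|[|[|]]]]] // _ ->.
  by case/orP => [/orP[/orP[/orP[]|]|]|] /eqP ->;
    [exists 0%N|exists 1%N|exists 2%N|exists 3%N|exists 4%N]; rewrite ?A0E.
move=> h; apply: PL_homeo_trans (h _) _ => {h}.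
  move=> v /bigfcupP[s]; rewrite andbT !inE fpowersetE => /andP[_ sA] vs.
  by apply: inj; apply: (fsubsetP sA).
(* A form of [avoiding_split] in which the nonface to be split need not come first in the list. *)
have step (W A C AC xC : {fset int}) (x : int) Ns Ns1 :
    [/\ A != fset0, x \notin W, [disjoint A & C] & AC `<=` W] ->
    AC = A `|` C -> xC = x |` C -> all (fun N => [disjoint N & x |` A]) Ns ->
    Ns1 =i AC :: Ns ->
    PL_homeomorphic R (avoiding W Ns1) (avoiding (x |` W) (A :: xC :: Ns)).
  move=> [h1 h2 h3 h4] eAC -> h5 e1; rewrite (eq_avoiding erefl e1).
  by rewrite eAC in h4 *; apply: PL_bistellar; apply: avoiding_split.
have n0 (a b : int) : [fset a; b] != fset0.
  by apply/fset0Pn; exists a; rewrite !inE eqxx.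
have step1 := step [fset 1; -1; 2; 3; 4] [fset 1; -1] [fset 2; 3; 4] _
  [fset -2; 2; 3; 4] (-2) [::].
apply: PL_homeo_trans (step1 _ _ _ _ _ _ (fun=> erefl)) _ => {step1} //.
- split=> //; first by rewrite !inE.
  by apply/fdisjointP => v; rewrite !inE; lia.
- by apply/fsetP => v; rewrite !inE; lia.
- by apply/fsetP => v; rewrite !inE; lia.
have step2 := step (-2 |` [fset 1; -1; 2; 3; 4]) [fset -2; 2] [fset 3; 4] _
  [fset -3; 3; 4] (-3) [:: [fset 1; -1]].
apply: PL_homeo_trans (step2 [fset -2; 2; 3; 4] _ _ _ _ _ _) _ => {step2}; last 1 first.
- have step3 := step (-3 |` (-2 |` [fset 1; -1; 2; 3; 4])) [fset -3; 3] [fset 4] _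
    [fset -4; 4] (-4) [:: [fset -2; 2]; [fset 1; -1]].
  have := step3 [fset -3; 3; 4] [:: [fset -2; 2]; [fset -3; 3; 4]; [fset 1; -1]].
  case=> {step3} //.
  + split=> //; first by rewrite !inE.
      by apply/fdisjointP => v; rewrite !inE; lia.
    by apply/fsubsetP => v; rewrite !inE; lia.
  + by apply/andP; split; last rewrite andbT; apply/fdisjointP => v; rewrite !inE; lia.
  + by move=> N; rewrite !inE orbCA.
  move=> f [g fg]; apply: PL_homeo_trans (ex_intro _ f (ex_intro _ g fg)) _.
  rewrite (@eq_avoiding _ _ _ _ [:: [fset -4; 4]; [fset -3; 3]; [fset -2; 2];
    [fset 1; -1]] erefl); first exact: PL_homeo_refl.
  by move=> N; rewrite !inE orbCA.
- split=> //; first by rewrite !inE.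
    by apply/fdisjointP => v; rewrite !inE; lia.
  by apply/fsubsetP => v; rewrite !inE; lia.
- by apply/fsetP => v; rewrite !inE; lia.
- by apply/fsetP => v; rewrite !inE; lia.
- by rewrite /= andbT; apply/fdisjointP => v; rewrite !inE; lia.
- by move=> N; rewrite !inE orbC.
Qed.

End CrossPolytope.

(** * Stacked balls *)

Section FacetReplacement.
Variable T : choiceType.
Implicit Types (F G : cplx T) (s t u A B : {fset T}) (x v : T).

Definition pure4 F : Prop := forall s, s \in F -> #|` s| = 4.

(** This bound serves twice: a triangle in two facets of a ball lies in no other facet of the
    sphere, and a vertex in the link of an edge has at most two neighbours there. *)
Definition pseudomanifold F : Prop := forall t s1 s2 s3, #|` t| = 3 ->
  s1 \in F -> s2 \in F -> s3 \in F -> t `<=` s1 -> t `<=` s2 -> t `<=` s3 ->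
  [\/ s1 = s2, s1 = s3 | s2 = s3].

Lemma eq_of_card t s : t `<=` s -> (#|` s| <= #|` t|)%N -> t = s.
Proof. by move=> ts c; apply/eqP; rewrite eqEfcard ts. Qed.

Lemma sub_fsetD1 t s y : t `<=` s -> y \notin t -> t `<=` s `\ y.
Proof.
move=> ts yt; apply/fsubsetP => z zt; rewrite !inE (fsubsetP ts) // andbT.
by apply: contraNneq yt => <-.
Qed.

(* The facets containing A are the A u (B - b), and F' replaces them with the
   (A - y) u B. *)
Definition facet_flip A B F F' : Prop :=
  [/\ [/\ [disjoint A & B], A != fset0 & B != fset0],
      forall s, s \in F -> ~~ (B `<=` s),
      forall s, s \in F -> A `<=` s -> exists2 b, b \in B & s = A `|` (B `\ b),
      forall b, b \in B -> A `|` (B `\ b) \in F &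
      forall s, s \in F' <->
        (s \in F /\ ~~ (A `<=` s)) \/ (exists2 y, y \in A & s = (A `\ y) `|` B)].

(** A face that omits [y] in [A] and lies in a facet A u (B - b) also lies in (A - y) u B, and
    conversely with [b] omitted. Hence faces containing neither [A] nor [B] are common to both
    sides. *)
Lemma facet_flip_bistellar A B F F' :
  facet_flip A B F F' -> bistellar A B (generated F) (generated F').
Proof.
case=> [[dAB A0 B0] noB starA inF F'E]; split=> //.
- split=> t /generatedP[s sF ts].
    by apply: contra (noB _ sF) => Bt; apply: fsubset_trans ts.
  apply/negP => At; have As := fsubset_trans At ts.
  case/F'E: sF => [[_ /negP//]|[y yA es]].
  have := fsubsetP As _ yA; rewrite es !inE eqxx /= => yB.
  by have := fdisjointP dAB _ yA; rewrite yB.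
- move=> t At Bt; apply/generatedP/generatedP => -[s sF ts].
    case: (boolP (A `<=` s)) => As; last by exists s => //; apply/F'E; left.
    have [b bB es] := starA _ sF As; have [y yA yt] := fsubsetPn _ _ At.
    exists (A `\ y `|` B); first by apply/F'E; right; exists y.
    apply: fsubset_trans (sub_fsetD1 ts yt) _; apply/fsubsetP => z.
    by rewrite es !inE => /andP[-> /orP[->//|/andP[_ ->]]]; rewrite orbT.
  case/F'E: sF => [[sF _]|[y yA es]]; first by exists s.
  have [b bB bt] := fsubsetPn _ _ Bt; exists (A `|` B `\ b); first exact: inF.
  apply: fsubset_trans (sub_fsetD1 ts bt) _; apply/fsubsetP => z.
  by rewrite es !inE => /andP[-> /orP[/andP[_ ->]//|->]]; rewrite orbT.
- split=> t u /generatedP[s sF ts].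
    move=> At uB Au; have [b bB es] := starA _ sF (fsubset_trans At ts).
    have [y yA yu] := fsubsetPn _ _ Au; apply/generatedP.
    exists (A `\ y `|` B); first by apply/F'E; right; exists y.
    have uAB : u `<=` A `|` B.
      apply: fsubset_trans uB _; rewrite fsubUset fsubsetUr andbT.
      apply: fsubset_trans ts _; rewrite es fsetUS //.
      exact: fsubsetDl.
    apply: fsubset_trans (sub_fsetD1 uAB yu) _; apply/fsubsetP => z.
    by rewrite !inE => /andP[-> /orP[->//|->]]; rewrite orbT.
  move=> Bt uA Bu; have Bs := fsubset_trans Bt ts.
  case/F'E: sF => [[sF _]|[y yA es]]; first by have := noB _ sF; rewrite Bs.
  have [b bB bu] := fsubsetPn _ _ Bu; apply/generatedP.
  exists (A `|` B `\ b); first exact: inF.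
  have uAB : u `<=` A `|` B.
    apply: fsubset_trans uA _; rewrite fsubUset fsubsetUl andbT.
    apply: fsubset_trans ts _; rewrite es fsetSU //.
    exact: fsubsetDl.
  apply: fsubset_trans (sub_fsetD1 uAB bu) _; apply/fsubsetP => z.
  by rewrite !inE => /andP[-> /orP[->//|->]]; rewrite orbT.
Qed.

Lemma card_disjointU A B : [disjoint A & B] -> #|` A `|` B| = (#|` A| + #|` B|)%N.
Proof. by rewrite cardfsU -fsetI_eq0 => /eqP->; rewrite cardfs0 subn0. Qed.

Lemma facet_flip_pure A B F F' : (#|` A| + #|` B| = 5)%N ->
  facet_flip A B F F' -> pure4 F -> pure4 F'.
Proof.
move=> c [[dAB _ _] _ _ _ F'E] pF s /F'E[[/pF//]|[y yA ->]].
rewrite card_disjointU; last first.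
  by apply: fdisjointWl dAB; apply: fsubsetDl.
by have := cardfsD1 y A; rewrite yA; move: c; clear; lia.
Qed.

(** If [t] contains [B], the facets over it correspond to the vertices of [A] outside [t], and there
    are two of these by counting in the five-element set A u B. Otherwise choose [b] in [B] outside
    [t]: at most one new facet contains [t], and it takes the place of the old facet A u (B - b),
    which also contains [t]. *)
Lemma facet_flip_pseudomanifold A B F F' : (#|` A| + #|` B| = 5)%N ->
  facet_flip A B F F' -> pseudomanifold F -> pseudomanifold F'.
Proof.
move=> c [[dAB A0 B0] noB starA inF F'E] mF t s1 s2 s3 t3 F1 F2 F3 t1 t2 t3'.
case: (boolP (B `<=` t)) => Bt.
  have new s : s \in F' -> t `<=` s -> exists2 y, y \in A `\` t & s = A `\ y `|` B.
    move=> /F'E[[sF _]|[y yA es]] ts.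
      by have := noB _ sF; rewrite (fsubset_trans Bt ts).
    exists y => //; rewrite inE yA andbT; apply/negP => /(fsubsetP ts).
    rewrite es !inE eqxx /= => yB.
    by have := fdisjointP dAB _ yA; rewrite yB.
  have [y1 y1A ->] := new _ F1 t1; have [y2 y2A ->] := new _ F2 t2.
  have [y3 y3A ->] := new _ F3 t3'.
  have c2 : #|` A `\` t| = 2.
    have tAB : t `<=` A `|` B.
      case/F'E: F1 (t1) => [[sF _] ts|[y yA ->] ts].
        by have := noB _ sF; rewrite (fsubset_trans Bt ts).
      by apply: fsubset_trans ts _; rewrite fsetSU // fsubsetDl.
    have e : A `|` B = (A `\` t) `|` t.
      apply/fsetP => z; rewrite !inE; case zt: (z \in t) => /=.
        by have := fsubsetP tAB _ zt; rewrite !inE => ->.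
      rewrite orbF; case: (boolP (z \in B)) => [/(fsubsetP Bt)|_]; first by rewrite zt.
      by rewrite orbF.
    have d : [disjoint A `\` t & t].
      by apply/fdisjointP => z; rewrite inE => /andP[].
    have := card_disjointU dAB; rewrite e (card_disjointU d) t3 c.
    by move/eqP; rewrite -(addn2 3) addnC eqn_add2l => /eqP.
  have [<-|n12] := eqVneq y1 y2; first by constructor 1.
  have [<-|n13] := eqVneq y1 y3; first by constructor 2.
  have [<-|n23] := eqVneq y2 y3; first by constructor 3.
  have : ([fset y1; y2; y3] `<=` A `\` t) by rewrite !fsubUset !fsub1set y1A y2A y3A.
  move/fsubset_leq_card; rewrite c2 -fsetUA cardfsU1 cardfsU1 cardfs1 !inE.
  by rewrite (negPf n23) negb_or eq_sym (negPf n13) eq_sym (negPf n12).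
have [b bB bt] := fsubsetPn _ _ Bt.
have new y s : y \in A -> s = A `\ y `|` B -> t `<=` s ->
    t = A `\ y `|` B `\ b.
  move=> yA -> ts; apply: eq_of_card.
    apply: fsubset_trans (sub_fsetD1 ts bt) _; apply/fsubsetP => z.
    by rewrite !inE => /andP[-> /orP[->//|->]]; rewrite orbT.
  rewrite t3 card_disjointU; last first.
    apply: fdisjointWl (fsubsetDl _ _) _; apply: fdisjointWr (fsubsetDl _ _) dAB.
  have := cardfsD1 y A; have := cardfsD1 b B; rewrite yA bB.
  by move: c; clear; lia.
have tA y s : y \in A -> s = A `\ y `|` B -> t `<=` s -> t `<=` A `|` B `\ b.
  move=> yA es ts; rewrite (new _ _ yA es ts) fsetSU //.
  exact: fsubsetDl.
have eq_new y y' s s' : y \in A -> s = A `\ y `|` B -> t `<=` s ->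
    y' \in A -> s' = A `\ y' `|` B -> t `<=` s' -> s = s'.
  move=> yA es ts yA' es' ts'; have e1 := new _ _ yA es ts.
  have e2 := new _ _ yA' es' ts'; suff yy : y = y' by rewrite es es' yy.
  apply/eqP; apply: contraT => nyy'.
  have : y' \in A `\ y `|` B `\ b by rewrite !inE yA' eq_sym nyy'.
  rewrite -e1 e2 !inE eqxx /= => /andP[_ yB'].
  by have := fdisjointP dAB _ yA'; rewrite yB'.
have [/F'E D1 /F'E D2 /F'E D3] := (And3 F1 F2 F3).
have up z s : s \in F -> ~~ (A `<=` s) -> s = A `|` B `\ z -> False.
  by move=> _ /negP nA es; apply: nA; rewrite es fsubsetUl.
case: D1 D2 D3 => [[f1 n1]|[y1 y1A e1]] [[f2 n2]|[y2 y2A e2]] [[f3 n3]|[y3 y3A e3]].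
- exact: (mF t).
- have [|/(up _ _ f1 n1)//|/(up _ _ f2 n2)//] :=
    mF t _ _ _ t3 f1 f2 (inF b bB) t1 t2 (tA _ _ y3A e3 t3').
  by constructor 1.
- have [|/(up _ _ f1 n1)//|/(up _ _ f3 n3)//] :=
    mF t _ _ _ t3 f1 f3 (inF b bB) t1 t3' (tA _ _ y2A e2 t2).
  by constructor 2.
- by constructor 3; apply: (eq_new y2 y3).
- have [|/(up _ _ f2 n2)//|/(up _ _ f3 n3)//] :=
    mF t _ _ _ t3 f2 f3 (inF b bB) t2 t3' (tA _ _ y1A e1 t1).
  by constructor 3.
- by constructor 2; apply: (eq_new y1 y3).
- by constructor 1; apply: (eq_new y1 y2).
- by constructor 1; apply: (eq_new y1 y2).
Qed.

End FacetReplacement.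

Section StackedBalls.
Variable T : choiceType.
Implicit Types (F : cplx T) (s t u A B : {fset T}) (x v : T).
Implicit Types (Fs : seq {fset T}).

Lemma cardD1 y A n : y \in A -> #|` A| = n.+1 -> #|` A `\ y| = n.
Proof. by move=> yA e; have := cardfsD1 y A; rewrite yA e add1n => -[]. Qed.

Lemma fsetU1_pair v x A : v |` (x |` A) = A `|` [fset x; v].
Proof.
by apply/fsetP => z; rewrite !inE; case: (z == v); case: (z == x); rewrite ?orbT ?orbF.
Qed.

(** Uniqueness compares facets as sets instead of counting positions, so only the membership
    relation of the list matters. *)
Definition bd Fs t : bool := (#|` t| == 3) &&
  has (fun s => (t `<=` s) && all (fun s' => (t `<=` s') ==> (s' == s)) Fs) Fs.

Lemma bdP Fs t : reflect (#|` t| = 3 /\ exists s, [/\ s \in Fs, t `<=` s &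
  forall s', s' \in Fs -> t `<=` s' -> s' = s]) (bd Fs t).
Proof.
apply: (iffP andP) => [[/eqP t3 /hasP[s sF /andP[ts /allP h]]]|[t3 [s [sF ts h]]]].
  split=> //; exists s; split=> // s' sF' ts'.
  by apply/eqP; apply: (implyP (h _ sF')).
split; first exact/eqP.
by apply/hasP; exists s; rewrite // ts; apply/allP => s' sF'; apply/implyP => /h->.
Qed.

Lemma bd_card Fs t : bd Fs t -> #|` t| = 3.
Proof. by case/bdP. Qed.

Definition bd_set Fs : cplx T := [fset t in generated [fset s | s in Fs] | bd Fs t].

Lemma in_bd_set Fs t : (t \in bd_set Fs) = bd Fs t.
Proof.
rewrite !inE; case: (boolP (bd Fs t)) => [/bdP[_ [s [sF ts _]]]|_]; rewrite ?andbF //.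
by rewrite andbT; apply/generatedP; exists s => //; apply/imfsetP; exists s.
Qed.

Definition replace F Fs v : cplx T :=
  [fset s in F | s \notin Fs] `|` [fset v |` t | t in bd_set Fs].

Lemma replaceP F Fs v s : reflect
  ((s \in F /\ s \notin Fs) \/ (exists2 t, bd Fs t & s = v |` t))
  (s \in replace F Fs v).
Proof.
rewrite !inE; apply: (iffP orP) => -[h|h]; [left; exact/andP| right| left; exact/andP| right].
  by case/imfsetP: h => t /=; rewrite in_bd_set => bt ->; exists t.
by case: h => t bt ->; apply/imfsetP; exists t; rewrite //= in_bd_set.
Qed.

(* Most recent facet first. *)
Inductive stacked : seq {fset T} -> Prop :=
| stacked1 s : #|` s| = 4 -> stacked [:: s]
| stackedS x A (G : {fset T}) Fs : stacked Fs -> #|` A| = 3 -> G \in Fs -> A `<=` G ->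
    (forall s, s \in Fs -> x \notin s) -> stacked ((x |` A) :: Fs).

Lemma stacked_pure Fs : stacked Fs -> forall s, s \in Fs -> #|` s| = 4.
Proof.
elim=> [s s4 s'|x A G {}Fs _ IH A3 GF AG xF s]; first by rewrite inE => /eqP->.
rewrite inE => /predU1P[->|/IH//]; rewrite cardfsU1 A3.
by rewrite (contra _ (xF _ GF)) //; apply: fsubsetP.
Qed.

(** The only interior faces of a stacked ball are the gluing triangles. An edge of a gluing triangle
    [A] also lies in a boundary triangle through the vertex [x] glued on top of it. Hence removing
    the interior of the ball destroys no edge. *)
Lemma bd_edge Fs : stacked Fs -> forall e s, s \in Fs -> e `<=` s -> (#|` e| <= 2)%N ->
  exists2 t, bd Fs t & e `<=` t.
Proof.
have sub3 (e s : {fset T}) : e `<=` s -> (#|` e| < #|` s|)%N ->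
    exists2 y, y \in s & y \notin e.
  move=> es c; apply/fsubsetPn; apply: contraTN c => se.
  by rewrite -leqNgt fsubset_leq_card.
elim=> [s s4|x A G {}Fs sFs IH A3 GF AG xF] e s'.
  rewrite inE => /eqP -> es e2; have [|y ys ye] := sub3 _ _ es; first by rewrite s4 ltnW.
  exists (s `\ y); last exact: sub_fsetD1.
  apply/bdP; split; first by rewrite (cardD1 ys s4).
  by exists s; split=> [||s'']; rewrite ?inE ?fsubsetDl // => /eqP.
have xA : x \notin A by apply: contra (xF _ GF); apply: fsubsetP.
have newbd y : y \in A -> bd ((x |` A) :: Fs) (x |` (A `\ y)).
  move=> yA; apply/bdP; split.
    rewrite cardfsU1 !inE (negPf xA) andbF /=.
    by rewrite (cardD1 yA A3).
  exists (x |` A); split; first by rewrite inE eqxx.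
    by rewrite fsetUS // fsubsetDl.
  move=> s''; rewrite inE => /predU1P[//|sF] /fsubsetP/(_ x).
  by rewrite !inE eqxx /= => /(_ isT); rewrite (negPf (xF _ sF)).
have inA e' : e' `<=` A -> (#|` e'| <= 2)%N ->
    exists2 t, bd ((x |` A) :: Fs) t & x |` e' `<=` t.
  move=> eA e2; have [|y yA ye] := sub3 _ _ eA; first by rewrite A3.
  by exists (x |` (A `\ y)); [exact: newbd | rewrite fsetUS // sub_fsetD1].
rewrite inE => /predU1P[-> es e2|sF es e2].
  have [||t bt et] := inA (e `\ x).
  - by rewrite fsubDset.
  - exact: leq_trans (fsubset_leq_card (fsubsetDl _ _)) e2.
  by exists t => //; apply: fsubset_trans et; rewrite -fsubDset.
have [t /bdP[t3 [s1 [sF1 ts1 hs1]]] et] := IH _ _ sF es e2.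
(* The triangle found for the smaller ball leaves the boundary only if it is the gluing triangle. *)
have [tA|ntA] := eqVneq t A.
  have [||u bu eu] := inA e => //; first by rewrite -tA.
  by exists u => //; apply: fsubset_trans eu; apply: fsubsetUr.
exists t => //; apply/bdP; split=> //; exists s1; split=> //; first by rewrite inE sF1 orbT.
move=> s''; rewrite inE => /predU1P[-> txA|]; last exact: hs1.
case/negP: ntA; apply/eqP; apply: eq_of_card; last by rewrite t3 A3.
apply/fsubsetP => z zt; have := fsubsetP txA _ zt; rewrite !inE => /predU1P[zx|//].
by have := xF _ sF1; rewrite -zx (fsubsetP ts1).
Qed.

(** Induction on the stack. Coning off one tetrahedron is a stellar subdivision at [v]. Enlarging
    the ball by the tetrahedron on [x] and [A] changes the outcome by one bistellar move: the two
    facets over [A], with apexes [x] and [v], give way to the three facets containing both [x] and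
    [v]. *)
Lemma replace_stacked (R : realType) F Fs v :
  stacked Fs -> {subset Fs <= F} -> pure4 F -> pseudomanifold F ->
  (forall s, s \in F -> v \notin s) ->
  [/\ PL_homeomorphic R (generated F) (generated (replace F Fs v)),
      pure4 (replace F Fs v) & pseudomanifold (replace F Fs v)].
Proof.
move=> sFs sub pF mF vF.
elim: sFs sub => [s s4 sub|x A G {}Fs sFs IH A3 GF AG xF sub].
  have sF : s \in F by apply: sub; rewrite inE.
  have vs := vF _ sF.
  have flip : facet_flip s [fset v] F (replace F [:: s] v).
    split.
    - split; first by apply/fdisjointP => z zs; rewrite inE; apply: contraNneq vs => <-.
        by rewrite -cardfs_eq0 s4.
      by apply/fset0Pn; exists v; rewrite inE.
    - by move=> s' /vF; rewrite fsub1set.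
    - move=> s' s'F ss'; exists v; rewrite ?inE // fsetDv fsetU0.
      by apply/esym/eq_of_card; rewrite // (pF _ s'F) s4.
    - by move=> b; rewrite inE => /eqP->; rewrite fsetDv fsetU0.
    move=> s'; split=> [/replaceP[[s'F ns]|[t bt ->]]|h].
    - left; split=> //; apply: contra ns => ss'; rewrite inE; apply/eqP/esym.
      by apply: eq_of_card; rewrite // (pF _ s'F) s4.
    - right; case/bdP: bt => t3 [s1 []]; rewrite inE => /eqP -> ts _.
      have : ~~ (s `<=` t) by apply/negP => /fsubset_leq_card; rewrite t3 s4.
      move=> /fsubsetPn[y ys yt]; exists y => //; rewrite fsetUC; congr (_ `|` _).
      apply: eq_of_card; first exact: sub_fsetD1.
      by rewrite (cardD1 ys s4) t3.
    apply/replaceP; case: h => [[s'F ns]|[y ys ->]]; [left|right].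
      by split=> //; rewrite inE; apply: contra ns => /eqP->.
    exists (s `\ y); last by rewrite fsetUC.
    apply/bdP; split; first by rewrite (cardD1 ys s4).
    by exists s; split=> [||s'']; rewrite ?inE ?fsubsetDl // => /eqP.
  have c5 : (#|` s| + #|` [fset v]| = 5)%N by rewrite s4 cardfs1.
  split; first exact: PL_bistellar (facet_flip_bistellar flip).
    exact: facet_flip_pure flip pF.
  exact: facet_flip_pseudomanifold flip mF.
have subF : {subset Fs <= F} by move=> s sF; apply: sub; rewrite inE sF orbT.
have {IH}[h1 p1 m1] := IH subF.
set F1 := replace F Fs v in h1 p1 m1 *; set F2 := replace F _ v.
have xA : x \notin A by apply: contra (xF _ GF); apply: fsubsetP.
have xAF : x |` A \in F by apply: sub; rewrite inE eqxx.
have nxA : x |` A \notin Fs by apply/negP => /xF; rewrite !inE eqxx.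
have vxA := vF _ xAF.
have [vx vA] : v != x /\ v \notin A by move: vxA; rewrite !inE negb_or => /andP[].
have GFF := subF _ GF.
have nG : G <> x |` A by move=> e; move: nxA; rewrite -e GF.
have AxA : A `<=` x |` A by apply: fsubsetUr.
(* The two facets over [A] in [F] are the new tetrahedron and [G]. Hence [A] is a boundary triangle
   of the smaller ball, and its cone with apex [v] is available for the move. *)
have only s : s \in F -> A `<=` s -> s = x |` A \/ s = G.
  move=> sF As; have [/nG//|<-|<-] := mF A _ _ _ A3 GFF xAF sF AG AxA As.
    by right.
  by left.
have bdA : bd Fs A.
  apply/bdP; split=> //; exists G; split=> // s sF As.
  by have [e|//] := only _ (subF _ sF) As; move: nxA; rewrite -e sF.
have xt t : bd Fs t -> x \notin t.
  by case/bdP => _ [s [sF ts _]]; apply: contra (xF _ sF); apply: fsubsetP.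
have vt t : bd Fs t -> v \notin t.
  by case/bdP => _ [s [sF ts _]]; apply: contra (vF _ (subF _ sF)); apply: fsubsetP.
have subA t : A `<=` v |` t -> bd Fs t -> t = A.
  move=> Avt bt; apply/esym/eq_of_card; last by rewrite A3 (bd_card bt).
  apply/fsubsetP => z zA; have := fsubsetP Avt _ zA; rewrite !inE => /predU1P[zv|//].
  by move: vA; rewrite -zv zA.
have dx : [fset x; v] `\ v = [fset x].
  apply/fsetP => z; rewrite !inE.
  by case: (eqVneq z v) => [->|_] /=; rewrite ?(negPf vx) ?orbF.
have dv : [fset x; v] `\ x = [fset v].
  apply/fsetP => z; rewrite !inE.
  by case: (eqVneq z x) => [->|_] /=; rewrite ?[x == v]eq_sym ?(negPf vx).
have flip : facet_flip A [fset x; v] F1 F2.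
  split.
  - split.
    + apply/fdisjointP => z zA; rewrite !inE negb_or.
      by apply/andP; split; [apply: contraNneq xA|apply: contraNneq vA] => <-.
    + by rewrite -cardfs_eq0 A3.
    + by apply/fset0Pn; exists x; rewrite !inE eqxx.
  - move=> s /replaceP[[sF _]|[t bt ->]]; rewrite fsubUset !fsub1set.
      by rewrite (negPf (vF _ sF)) andbF.
    by rewrite !inE (negPf (xt _ bt)) eq_sym (negPf vx).
  - move=> s /replaceP[[sF nsF] As|[t bt ->] At].
      exists v; rewrite ?inE ?eqxx ?orbT // dx fsetUC.
      by have [//|e] := only _ sF As; move: nsF; rewrite e GF.
    by exists x; rewrite ?inE ?eqxx // dv fsetUC (subA _ At bt).
  - move=> b /fset2P[] ->; apply/replaceP; [right|left].
      by exists A; rewrite // dv fsetUC.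
    by rewrite dx fsetUC.
  move=> s; split=> [/replaceP[[sF]|[t]]|].
  - rewrite inE negb_or => /andP[nsx nsF]; left; split.
      by apply/replaceP; left.
    apply/negP => As; have [e|e] := only _ sF As; first by rewrite e eqxx in nsx.
    by move: nsF; rewrite e GF.
  - case/bdP => t3 [s1 [s1F ts1 hs1]] es.
    (* Boundary triangles through [x] consist of [x] and two vertices of [A]; they give the facets
       created by the move. The remaining ones are boundary triangles of the smaller ball other than
       [A]. *)
    case: (boolP (x \in t)) => xint.
      right; have e1 : s1 = x |` A.
        move: s1F; rewrite inE => /predU1P[//|/xF]; apply: contraNeq => _.
        exact: (fsubsetP ts1).
      have : ~~ (A `<=` t).
        apply/negP => At; have : x |` A `<=` t by rewrite fsubUset fsub1set xint.
        by move/fsubset_leq_card; rewrite cardfsU1 xA A3 t3.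
      move=> /fsubsetPn[y yA yt]; exists y => //.
      have yx : y != x by apply: contraNneq xA => <-.
      suff et : t = x |` (A `\ y) by rewrite es et fsetU1_pair.
      apply: eq_of_card.
        apply/fsubsetP => z zt; have := fsubsetP ts1 _ zt; rewrite e1 !inE.
        by case: eqVneq => //= _ ->; rewrite andbT; apply: contraNneq yt => <-.
      rewrite cardfsU1 !inE (negPf xA) andbF t3.
      by rewrite (cardD1 yA A3).
    have ntA : t <> A.
      move=> tA; have e1 := hs1 G; have e2 := hs1 (x |` A).
      apply: nG; rewrite e1 ?inE ?GF ?orbT ?tA // e2 ?inE ?eqxx //.
      by rewrite tA.
    have bt : bd Fs t.
      apply/bdP; split=> //; exists s1; split=> //.
        move: s1F; rewrite inE => /predU1P[e1|//]; case: ntA.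
        apply: eq_of_card; last by rewrite t3 A3.
        apply/fsubsetP => z zt; have := fsubsetP ts1 _ zt; rewrite e1 !inE.
        by move=> /predU1P[zx|//]; rewrite -zx zt in xint.
      by move=> s' s'F ts'; apply: hs1; rewrite // inE s'F orbT.
    left; split; first by apply/replaceP; right; exists t.
    by rewrite es; apply/negP => /subA /(_ bt).
  case=> [[/replaceP[[sF nsF]|[t bt es]] nAs]|[y yA es]]; apply/replaceP.
  - by left; split=> //; rewrite inE negb_or nsF andbT; apply: contraNneq nAs => ->.
  - right; exists t => //; case/bdP: (bt) => t3 [s1 [s1F ts1 hs1]].
    apply/bdP; split=> //; exists s1; split=> //; first by rewrite inE s1F orbT.
    move=> s'; rewrite inE => /predU1P[-> txA|]; last exact: hs1.
    case/negP: nAs; rewrite es (_ : A = t) ?fsubsetUr //.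
    apply/esym/eq_of_card; last by rewrite t3 A3.
    apply/fsubsetP => z zt; have := fsubsetP txA _ zt; rewrite !inE => /predU1P[zx|//].
    by move: (xt _ bt); rewrite -zx zt.
  right; exists (x |` (A `\ y)).
    apply/bdP; split.
      rewrite cardfsU1 !inE (negPf xA) andbF /=.
      by rewrite (cardD1 yA A3).
    exists (x |` A); split; first by rewrite inE eqxx.
      by rewrite fsetUS // fsubsetDl.
    move=> s''; rewrite inE => /predU1P[//|sF] /fsubsetP/(_ x).
    by rewrite !inE eqxx /= => /(_ isT); rewrite (negPf (xF _ sF)).
  by rewrite es fsetU1_pair.
have c5 : (#|` A| + #|` [fset x; v]| = 5)%N by rewrite A3 cardfs2 eq_sym vx.
split.
- exact: PL_homeo_trans h1 (PL_bistellar _ (facet_flip_bistellar flip)).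
- exact: facet_flip_pure flip p1.
- exact: facet_flip_pseudomanifold flip m1.
Qed.

End StackedBalls.

(** * Centrally symmetric spheres *)

Section Antipodes.
Implicit Types (s t : {fset int}) (F : cplx int) (Fs : seq {fset int}) (v w a b : int).

Lemma mem_oppf s v : (v \in oppf s) = (- v \in s).
Proof.
apply/imfsetP/idP => [[w /= ws ->]|vs]; first by rewrite opprK.
by exists (- v); rewrite //= opprK.
Qed.

Lemma oppfK : involutive oppf.
Proof. by move=> s; apply/fsetP => v; rewrite !mem_oppf opprK. Qed.

Lemma card_oppf s : #|` oppf s| = #|` s|.
Proof. by rewrite card_imfset //; apply: oppr_inj. Qed.

Lemma oppfS s t : (oppf s `<=` oppf t) = (s `<=` t).
Proof.
apply/fsubsetP/fsubsetP => h v; last by rewrite !mem_oppf => /h.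
by move=> vs; have := h (- v); rewrite !mem_oppf opprK => ->.
Qed.

Lemma oppfSl s t : (oppf s `<=` t) = (s `<=` oppf t).
Proof. by rewrite -{1}(oppfK t) oppfS. Qed.

Lemma oppfU s t : oppf (s `|` t) = oppf s `|` oppf t.
Proof. by apply/fsetP => v; rewrite !(mem_oppf, inE). Qed.

Lemma oppf1 (v : int) : oppf [fset v] = [fset - v].
Proof. by apply/fsetP => w; rewrite !(mem_oppf, inE) eqr_oppLR. Qed.

Lemma mem_map_oppf Fs s : (s \in map oppf Fs) = (oppf s \in Fs).
Proof. by rewrite -{1}(oppfK s) (mem_map (inv_inj oppfK)). Qed.

Lemma bd_oppf Fs t : bd (map oppf Fs) t = bd Fs (oppf t).
Proof.
apply/bdP/bdP => -[t3 [s [sF ts h]]]; split; rewrite ?card_oppf // in t3 *.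
  exists (oppf s); split; rewrite ?oppfS // -?mem_map_oppf // => s' s'F ts'.
  by rewrite -(h (oppf s')) ?oppfK // ?mem_map_oppf ?oppfK // -oppfSl.
exists (oppf s); split; rewrite ?mem_map_oppf ?oppfK // -?oppfSl // => s'.
by rewrite mem_map_oppf => s'F ts'; rewrite -(h _ s'F) ?oppfK // oppfS.
Qed.

Lemma stacked_oppf Fs : stacked Fs -> stacked (map oppf Fs).
Proof.
elim=> [s s4|x A G {}Fs _ IH A3 GF AG xF] /=.
  by apply: stacked1; rewrite card_oppf.
rewrite oppfU oppf1; apply: (@stackedS _ _ _ (oppf G)) => //.
- by rewrite card_oppf.
- by rewrite mem_map_oppf oppfK.
- by rewrite oppfS.
by move=> s; rewrite mem_map_oppf => /xF; rewrite mem_oppf.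
Qed.

Definition adjacent F (a b : int) : Prop := exists2 s, s \in F & (a \in s) && (b \in s).

Variable R : realType.

(** In [cs_edge] the case [a = b] is allowed, so this field also says that every element of [V k] is
    a vertex. *)
Record cs_sphere F (k : nat) : Prop := CsSphere {
  cs_pure : pure4 F;
  cs_pseudo : pseudomanifold F;
  cs_opp : forall s, s \in F -> oppf s \in F;
  cs_free : forall s, s \in F -> antipode_free s;
  cs_sub : forall s, s \in F -> s `<=` V k;
  cs_edge : forall a b, a \in V k -> b \in V k -> b != - a -> adjacent F a b;
  cs_PL : PL_homeomorphic R (generated F) (simplex_boundary 4) }.

(** By [ball_opp] the ball and its antipode can be replaced one after the other; by [ball_vert] the
    new vertex becomes adjacent to every old one. *)
Record cs_ball F Fs (k : nat) : Prop := CsBall {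
  ball_stacked : stacked Fs;
  ball_sub : {subset Fs <= F};
  ball_opp : forall s, s \in Fs -> oppf s \notin Fs;
  ball_vert : forall a, a \in V k -> exists2 s, s \in Fs & a \in s }.

(** Two successive replacements, so that [replace_stacked] applies to each; [replace2P] recovers the
    symmetric description. *)
Definition replace2 F Fs (v : int) : cplx int :=
  replace (replace F Fs v) (map oppf Fs) (- v).

Lemma notin_V k (s : {fset int}) : s `<=` V k ->
  (k.+1%:Z \notin s) /\ (- k.+1%:Z \notin s).
Proof.
by move=> sV; split; apply/negP => /(fsubsetP sV); rewrite mem_V; clear; lia.
Qed.

Lemma replace2P F Fs k s : cs_sphere F k -> cs_ball F Fs k -> reflect
  ([/\ s \in F, s \notin Fs & oppf s \notin Fs] \/
   exists2 t, bd Fs t & s = k.+1%:Z |` t \/ s = oppf (k.+1%:Z |` t))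
  (s \in replace2 F Fs k.+1%:Z).
Proof.
move=> hF hB; have tV t : bd Fs t -> t `<=` V k.
  case/bdP => _ [s' [sF ts _]]; apply: fsubset_trans ts _.
  by apply: (cs_sub hF); apply: (ball_sub hB).
apply: (iffP (replaceP _ _ _ _)) => [[[/replaceP[[sF nsF]|[t bt es]]]|[t]]|].
- by rewrite mem_map_oppf => h; left.
- by move=> _; right; exists t => //; left.
- rewrite bd_oppf => bt es; right; exists (oppf t) => //; right.
  by rewrite oppfU oppfK oppf1.
case=> [[h1 h2 h3]|[t bt [] ->]].
- by left; split; [apply/replaceP; left | rewrite mem_map_oppf].
- left; split; first by apply/replaceP; right; exists t.
  rewrite mem_map_oppf; apply/negP => /(ball_sub hB)/(cs_sub hF)/notin_V[_].
  by rewrite mem_oppf opprK !inE eqxx.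
right; exists (oppf t); first by rewrite bd_oppf oppfK.
by rewrite oppfU oppf1.
Qed.

Lemma cs_sphere_replace2 F Fs k : cs_sphere F k -> cs_ball F Fs k ->
  cs_sphere (replace2 F Fs k.+1%:Z) k.+1.
Proof.
move=> hF hB; have rP s := @replace2P F Fs k s hF hB.
have tF t : bd Fs t -> exists2 s, s \in F & t `<=` s.
  by case/bdP => _ [s [sF ts _]]; exists s => //; apply: (ball_sub hB).
have tV t : bd Fs t -> t `<=` V k.
  by case/tF => s /(cs_sub hF) sV ts; apply: fsubset_trans sV.
have VS : V k `<=` V k.+1 by apply/fsubsetP => a; rewrite !mem_V; clear; lia.
have vV : k.+1%:Z \in V k.+1 by rewrite mem_V; clear; lia.
have Vopp a m : (- a \in V m) = (a \in V m) by rewrite !mem_V; clear; lia.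
have [h1 p1 m1] : [/\ PL_homeomorphic R (generated F) (generated (replace F Fs k.+1)),
      pure4 (replace F Fs k.+1) & pseudomanifold (replace F Fs k.+1)].
  apply: replace_stacked (ball_stacked hB) (ball_sub hB) (cs_pure hF) (cs_pseudo hF) _.
  by move=> s /(cs_sub hF)/notin_V[].
have [h2 p2 m2] : [/\ PL_homeomorphic R (generated (replace F Fs k.+1))
      (generated (replace2 F Fs k.+1)),
      pure4 (replace2 F Fs k.+1) & pseudomanifold (replace2 F Fs k.+1)].
  apply: replace_stacked p1 m1 _; first exact: stacked_oppf (ball_stacked hB).
    move=> s; rewrite mem_map_oppf => sF; apply/replaceP; left; split.
      by rewrite -(oppfK s); apply: (cs_opp hF); apply: (ball_sub hB).
    by have := ball_opp hB sF; rewrite oppfK.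
  move=> s /replaceP[[/(cs_sub hF)/notin_V[]//]|[t /tV/notin_V[_ vt] ->]].
  by rewrite !inE negb_or vt andbT; clear; lia.
have opp2 s : s \in replace2 F Fs k.+1 -> oppf s \in replace2 F Fs k.+1.
  case/rP => [[h3 h4 h5]|[t bt [] ->]]; apply/rP.
  - by left; split; rewrite ?oppfK //; apply: (cs_opp hF).
  - by right; exists t => //; right.
  - by right; exists t; rewrite ?oppfK //; left.
split=> //.
- have free s : antipode_free s -> antipode_free (oppf s).
    move=> /antipode_freeP h; apply/antipode_freeP => v; rewrite !mem_oppf.
    exact: h.
  have freet t : bd Fs t -> antipode_free (k.+1%:Z |` t).
    move=> bt; have [s sF ts] := tF _ bt; have [v1 v2] := notin_V (tV _ bt).
    have /antipode_freeP hs := cs_free hF sF.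
    apply/antipode_freeP => v; rewrite !inE => /predU1P[->|vt]; rewrite negb_or.
      by rewrite v2 andbT; clear; lia.
    have nvt : - v \notin t by apply: contra (hs _ (fsubsetP ts _ vt)); apply: (fsubsetP ts).
    rewrite eqr_oppLR nvt andbT.
    by apply: contraNneq v2 => <-.
  by move=> s /rP[[/(cs_free hF)//]|[t /freet ft [] -> //]]; apply: free.
- have subt t : bd Fs t -> k.+1%:Z |` t `<=` V k.+1.
    move=> /tV tVk; rewrite fsubUset fsub1set vV /=.
    exact: fsubset_trans tVk VS.
  move=> s /rP[[/(cs_sub hF) sV _ _]|[t /subt tVk [] ->//]].
    exact: fsubset_trans sV VS.
  by apply/fsubsetP => v; rewrite mem_oppf => /(fsubsetP tVk); rewrite Vopp.
- have adjS a b : adjacent (replace2 F Fs k.+1) a b -> adjacent (replace2 F Fs k.+1) b a.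
    by case=> s sF ab; exists s; rewrite // andbC.
  have adjN a b : adjacent (replace2 F Fs k.+1) (- a) (- b) ->
      adjacent (replace2 F Fs k.+1) a b.
    by case=> s /opp2 sF ab; exists (oppf s); rewrite // !mem_oppf.
  have adjB s a b : s \in Fs -> a \in s -> b \in s ->
      exists2 t, bd Fs t & (a \in t) && (b \in t).
    move=> sF aS bS; have [||t bt abt] := bd_edge (ball_stacked hB) (e := [fset a; b]) sF.
    - by rewrite fsubUset !fsub1set aS.
    - by rewrite cardfs2; case: eqP.
    by exists t; move: abt; rewrite // fsubUset !fsub1set.
  (* An edge of a removed facet lies in a boundary triangle of the removed ball, hence in a facet of
     the cone over that boundary. *)
  have old a b : a \in V k -> b \in V k -> b != - a -> adjacent (replace2 F Fs k.+1) a b.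
    move=> aV bV ab; have [s sF /andP[aS bS]] := cs_edge hF aV bV ab.
    case: (boolP (s \in Fs)) => sFs.
      have [t bt /andP[at_ bt_]] := adjB _ _ _ sFs aS bS.
      exists (k.+1%:Z |` t); first by apply/rP; right; exists t => //; left.
      by rewrite !inE at_ bt_ !orbT.
    case: (boolP (oppf s \in Fs)) => osFs.
      have [||t bt /andP[at_ bt_]] := adjB _ (- a) (- b) osFs.
      - by rewrite mem_oppf opprK.
      - by rewrite mem_oppf opprK.
      exists (oppf (k.+1%:Z |` t)); first by apply/rP; right; exists t => //; right.
      by rewrite !mem_oppf !inE at_ bt_ !orbT.
    by exists s; rewrite ?aS //; apply/rP; left.
  (* The ball contains every old vertex, and none of them is interior to it. *)
  have new b : b \in V k -> adjacent (replace2 F Fs k.+1) k.+1%:Z b.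
    move=> bV; have [s sF bS] := ball_vert hB bV.
    have [t bt /andP[bt_ _]] := adjB _ _ _ sF bS bS.
    exists (k.+1%:Z |` t); first by apply/rP; right; exists t => //; left.
    by rewrite !inE bt_ eqxx orbT.
  have Vnew a : a \in V k.+1 -> [\/ a \in V k, a = k.+1%:Z | a = - k.+1%:Z].
    rewrite !mem_V => ha; case: (leqP `|a|%N k) => h.
      by constructor 1; move: ha h; clear; lia.
    by case: a ha h => a ha h; [constructor 2|constructor 3]; move: ha h; clear; lia.
  have self : adjacent (replace2 F Fs k.+1) k.+1%:Z k.+1%:Z.
    have [s sF] : exists s, s \in Fs
      by case: (ball_stacked hB) => [s ?|x A G Fs' *];
        [exists s|exists (x |` A)]; rewrite inE eqxx.
    have s0 : exists b, b \in s.
      by apply/fset0Pn; rewrite -cardfs_eq0 (cs_pure hF (ball_sub hB sF)).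
    have [b /(fsubsetP (cs_sub hF (ball_sub hB sF)))/new[t tF' /andP[kt _]]] := s0.
    by exists t; rewrite ?kt.
  move=> a b /Vnew[aV|->|->] /Vnew[bV|->|->] ab.
  + exact: old.
  + exact/adjS/new.
  + by apply/adjN; rewrite opprK; apply/adjS/new; rewrite Vopp.
  + exact: new.
  + exact: self.
  + by rewrite eqxx in ab.
  + by apply/adjN; rewrite opprK; apply/new; rewrite Vopp.
  + by rewrite opprK eqxx in ab.
  + by apply/adjN; rewrite opprK.
apply: PL_homeo_trans (cs_PL hF); apply: PL_homeo_sym.
exact: PL_homeo_trans h1 h2.
Qed.

End Antipodes.

(** * Pure complexes and their facets *)

Section PureComplexes.
Variable T : choiceType.
Implicit Types (F G : cplx T) (s t u : {fset T}) (Fs : seq {fset T}).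

Lemma facets_generated d F : (forall s, s \in F -> #|` s| = d) ->
  facets (generated F) = F.
Proof.
move=> pF; apply/fsetP => s; rewrite !inE; apply/andP/idP => [[/generatedP[t tF st] ns]|sF].
  have tG : t \in generated F by apply/generatedP; exists t.
  have [->//|nst] := eqVneq s t; case/existsP: ns; exists (FSetSub tG) => /=.
  by rewrite fproperEneq nst.
split; first by apply/generatedP; exists s.
apply/negP => /existsP[[t tG]] /= st; case/generatedP: tG => u uF tu.
have := fproper_ltn_card (fproper_sub_trans st tu).
by rewrite (pF _ sF) (pF _ uF) ltnn.
Qed.

Lemma generatedU F G : generated (F `|` G) = generated F `|` generated G.
Proof.
apply/fsetP => s; rewrite !inE; apply/generatedP/orP => [[t]|].
  by rewrite !inE => /orP[tF|tG] st; [left|right]; apply/generatedP; exists t.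
by case=> /generatedP[t tF st]; exists t; rewrite // inE tF ?orbT.
Qed.

Lemma mem_fset_seq Fs s : (s \in [fset s | s in Fs]) = (s \in Fs).
Proof. by apply/imfsetP/idP => [[t /= tF ->]|sF] //; exists s. Qed.

Lemma boundary_generated Fs : (forall s, s \in Fs -> #|` s| = 4) ->
  boundary 3 (generated [fset s | s in Fs]) = generated (bd_set Fs).
Proof.
move=> pF; congr generated; apply/fsetP => t; rewrite in_bd_set !inE.
rewrite (@facets_generated 4); last by move=> s; rewrite mem_fset_seq => /pF.
have inS s : (s \in [fset s in [fset s | s in Fs] | t `<=` s]) = (s \in Fs) && (t `<=` s).
  by rewrite !inE /= ?mem_fset_seq.
apply/and3P/bdP => [[tG /eqP t3 /cardfs1P[s es]]|[t3 [s [sF ts hs]]]].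
  have := inS s; rewrite es !inE eqxx => /esym/andP[sF ts].
  split=> //; exists s; split=> // s' sF' ts'.
  by have := inS s'; rewrite es !inE sF' ts' => /eqP.
split; [|exact/eqP|].
  by apply/generatedP; exists s; rewrite ?mem_fset_seq.
apply/cardfs1P; exists s; apply/fsetP => s'; rewrite inS inE.
apply/andP/eqP => [[s'F ts']|->//]; exact: hs.
Qed.

Lemma cone_generated F v : cone (generated F) v = generated [fset v |` t | t in F].
Proof.
apply/fsetP => s; apply/imfset2P/generatedP => /=.
  case=> t /generatedP[u uF tu] [w]; rewrite fpowersetE => wv ->.
  exists (v |` u); first by apply/imfsetP; exists u.
  by rewrite fsetUC fsetUSS.
case=> _ /imfsetP[u /= uF ->] su; exists (s `\ v).
  by apply/generatedP; exists u; rewrite // fsubDset.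
exists (s `&` [fset v]); first by rewrite fpowersetE fsubsetIr.
by rewrite fsetUC fsetID.
Qed.

Lemma generated_complex F s0 : s0 \in F -> is_complex (generated F).
Proof.
move=> sF; split; first by apply/generatedP; exists s0.
move=> s t /generatedP[u uF su] ts; apply/generatedP; exists u => //.
exact: fsubset_trans su.
Qed.

End PureComplexes.

(** * The recursive step in terms of facets *)

Section Recursion.
Implicit Types (s t : {fset int}) (F : cplx int) (Fs : seq {fset int}).
Variable R : realType.

Lemma oppc_generated Fs : oppc (generated [fset s | s in Fs]) =
  generated [fset s | s in map oppf Fs].
Proof.
apply/fsetP => s; apply/imfsetP/generatedP => /= [[t /generatedP[u]]|[t]].
  rewrite mem_fset_seq => uF tu ->; exists (oppf u); last by rewrite oppfS.
  by rewrite mem_fset_seq mem_map_oppf oppfK.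
rewrite mem_fset_seq mem_map_oppf => tF st; exists (oppf s); last by rewrite oppfK.
by apply/generatedP; exists (oppf t); rewrite ?mem_fset_seq // oppfS.
Qed.

Lemma mem_generated_ball F Fs k s : cs_sphere R F k -> cs_ball F Fs k -> s \in F ->
  (s \in generated [fset s | s in Fs] `|` oppc (generated [fset s | s in Fs])) =
  (s \in Fs) || (oppf s \in Fs).
Proof.
move=> hF hB sF; rewrite oppc_generated -mem_map_oppf inE.
have memG (Gs : seq {fset int}) : (forall u, u \in Gs -> #|` u| = 4) ->
    (s \in generated [fset s | s in Gs]) = (s \in Gs).
  move=> pG; apply/generatedP/idP => [[t]|sG]; last by exists s; rewrite ?mem_fset_seq.
  by rewrite mem_fset_seq => tG st; rewrite (eq_of_card st) // (pG _ tG) (cs_pure hF).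
rewrite !memG //.
  by apply: stacked_pure; apply/stacked_oppf/(ball_stacked hB).
by apply: stacked_pure; apply: ball_stacked hB.
Qed.

Lemma generated_replace2 F Fs k : cs_sphere R F k -> cs_ball F Fs k ->
  generated (replace2 F Fs k.+1%:Z) =
  generated ([fset s in F |
      s \notin generated [fset s | s in Fs] `|` oppc (generated [fset s | s in Fs])]
    `|` [fset k.+1%:Z |` t | t in bd_set Fs]
    `|` [fset - k.+1%:Z |` t | t in bd_set (map oppf Fs)]).
Proof.
move=> hF hB; congr generated; apply/fsetP => s.
apply/(replace2P _ hF hB)/idP => [[[sF s1 s2]|[t bt es]]|].
- by rewrite 2!in_fsetU !inE /= -in_fsetU (mem_generated_ball hF hB sF) sF negb_or s1 s2.
- rewrite !in_fsetU; case: es => ->.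
    have -> : k.+1%:Z |` t \in [fset k.+1%:Z |` t | t in bd_set Fs].
      by apply/imfsetP; exists t; rewrite //= in_bd_set.
    by rewrite orbT.
  have -> : oppf (k.+1%:Z |` t) \in [fset - k.+1%:Z |` t | t in bd_set (map oppf Fs)].
    apply/imfsetP; exists (oppf t); first by rewrite /= in_bd_set bd_oppf oppfK.
    by rewrite oppfU oppf1.
  by rewrite !orbT.
rewrite !in_fsetU; case/orP => [/orP[]|].
- rewrite !inE /= -in_fsetU => /andP[sF]; rewrite (mem_generated_ball hF hB sF) negb_or.
  by case/andP; left.
- by case/imfsetP => t /=; rewrite in_bd_set => bt ->; right; exists t => //; left.
case/imfsetP => t /=; rewrite in_bd_set bd_oppf => bt ->; right; exists (oppf t) => //.
by right; rewrite oppfU oppfK oppf1.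
Qed.

Lemma Delta_step_generated F Fs n : (3 < n)%N ->
  cs_sphere R F n -> cs_ball F Fs n ->
  Delta 3 n = generated F -> B 3 1 n = generated [fset s | s in Fs] ->
  Delta 3 n.+1 = generated (replace2 F Fs n.+1%:Z).
Proof.
move=> n3 hF hB eD eB; have pFs := stacked_pure (ball_stacked hB).
rewrite Delta_step // eB eD /delete (facets_generated (cs_pure hF)).
rewrite oppc_generated !boundary_generated // ?cone_generated; last first.
  by apply: stacked_pure; apply/stacked_oppf/(ball_stacked hB).
by rewrite (generated_replace2 hF hB) !generatedU oppc_generated.
Qed.

(** The list [Fs] only has to have the same members as [BI_facets]; this leaves the stacking order
    free. *)
Lemma DeltaI_generated F n I Fs : cs_sphere R F n -> cs_ball F Fs n ->
  Delta 3 n = generated F -> BI_facets n I =i Fs ->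
  DeltaI n I = generated (replace2 F Fs n.+1%:Z).
Proof.
move=> hF hB eD eB; have pFs := stacked_pure (ball_stacked hB).
have eBI : BI n I = generated [fset s | s in Fs].
  by congr generated; apply/fsetP => s; rewrite !mem_fset_seq eB.
rewrite /DeltaI eBI eD (facets_generated (cs_pure hF)) boundary_generated //.
rewrite (@facets_generated _ 3); last by move=> t; rewrite in_bd_set => /bd_card.
rewrite (generated_replace2 hF hB); congr generated.
congr (_ `|` _ `|` _).
  apply/fsetP => s; apply/imfsetP/imfsetP => -[t /= tB ->]; exists t; rewrite //=.
    by rewrite fsetUC -addn1 PoszD.
  by rewrite fsetUC -addn1 PoszD.
have -> : - n%:Z - 1 = - n.+1%:Z by clear; lia.
apply/fsetP => s; apply/imfsetP/imfsetP => -[t /=]; rewrite in_bd_set => bt ->.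
  exists (oppf t); first by rewrite /= in_bd_set bd_oppf oppfK.
  by rewrite fsetUC.
rewrite bd_oppf in bt; exists (oppf t); first by rewrite /= in_bd_set.
by rewrite oppfK fsetUC.
Qed.

End Recursion.

(** * The facets of Delta^3_n *)

Section Facets.
Implicit Types (a b c d x y : int) (s t : {fset int}) (Fs : seq {fset int}).

Definition tri a b c : {fset int} := [fset a; b; c].
(** A tetrahedron with a distinguished vertex [x], the shape produced both by [stackedS] and by
    cones. *)
Definition ap x a b c : {fset int} := x |` tri a b c.

Lemma in_tri x a b c : (x \in tri a b c) = [|| x == a, x == b | x == c].
Proof. by rewrite !inE orbA. Qed.

Lemma in_ap x a b c d : (x \in ap a b c d) = [|| x == a, x == b, x == c | x == d].
Proof. by rewrite inE in_tri inE. Qed.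

Lemma tri_sub a b c s : (tri a b c `<=` s) = [&& a \in s, b \in s & c \in s].
Proof. by rewrite !fsubUset !fsub1set andbA. Qed.

Lemma card_tri a b c : a != b -> a != c -> b != c -> #|` tri a b c| = 3.
Proof.
move=> ab ac bc; rewrite /tri -fsetUA cardfsU1 cardfs2 !inE negb_or.
by rewrite (negPf ab) (negPf ac) (negPf bc).
Qed.

Lemma card_ap x a b c : x \notin tri a b c -> a != b -> a != c -> b != c ->
  #|` ap x a b c| = 4.
Proof. by move=> xA *; rewrite cardfsU1 xA card_tri. Qed.

Lemma oppf_ap x a b c : oppf (ap x a b c) = ap (- x) (- a) (- b) (- c).
Proof. by rewrite /ap /tri !oppfU !oppf1. Qed.

Lemma bd_tri Fs a b c s : a != b -> a != c -> b != c -> s \in Fs ->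
  [&& a \in s, b \in s & c \in s] ->
  (forall s', s' \in Fs -> a \in s' -> b \in s' -> c \in s' -> s' = s) ->
  bd Fs (tri a b c).
Proof.
move=> ab ac bc sF abcs h; apply/bdP; split; first exact: card_tri.
exists s; split=> //; first by rewrite tri_sub.
by move=> s' s'F; rewrite tri_sub => /and3P[]; apply: h.
Qed.

Lemma stacked_ap Fs x a b c s : stacked Fs -> a != b -> a != c -> b != c ->
  s \in Fs -> [&& a \in s, b \in s & c \in s] -> (forall s', s' \in Fs -> x \notin s') ->
  stacked (ap x a b c :: Fs).
Proof.
move=> sFs ab ac bc sF abcs xF; apply: (@stackedS _ _ _ s) => //.
  exact: card_tri.
by rewrite tri_sub.
Qed.

Fixpoint desc (f : nat -> {fset int}) (k : nat) : seq {fset int} :=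
  if k is k'.+1 then f k :: desc f k' else [::].

Lemma descP f k s : reflect (exists2 m, (1 <= m <= k)%N & s = f m) (s \in desc f k).
Proof.
elim: k => [|k IH] /=; first by constructor => -[m]; clear; lia.
rewrite inE; apply: (iffP predU1P) => [[->|/IH[m hm ->]]|[m hm es]].
- by exists k.+1; rewrite // leqnn.
- by exists m => //; move: hm; clear; lia.
have [e|ne] := eqVneq m k.+1; first by left; rewrite es e.
by right; apply/IH; exists m => //; move: hm ne; clear; lia.
Qed.

End Facets.

Section FacetsB.
Implicit Types (n m k : nat) (s : {fset int}).

(** Unfolding the recursion of B^{3,1}_n down to dimension 1 gives the join of the edge {n-1, n}
    with the path -1, ..., -(n-2), 1, ..., n-2, which is the cycle on V_{n-2} without one edge, and
    two further tetrahedra. The path edges below and above zero give [fneg] and [fpos], the edge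
    {2-n, 1} gives [fmid], and the antipodal pieces of the recursion give [fend1] and [fend2]. *)
Definition fneg n m := ap (- m.+1%:Z) (- m%:Z) (n%:Z - 1) n%:Z.
Definition fmid n := ap 1 (2 - n%:Z) (n%:Z - 1) n%:Z.
Definition fpos n m := ap m.+1%:Z m%:Z (n%:Z - 1) n%:Z.
Definition fend1 n := ap (1 - n%:Z) 1 (2 - n%:Z) n%:Z.
Definition fend2 n := ap (- n%:Z) 1 (2 - n%:Z) (1 - n%:Z).

Definition facetsB n : seq {fset int} :=
  fend2 n :: fend1 n :: desc (fpos n) (n - 3) ++ fmid n :: desc (fneg n) (n - 3).

Lemma mem_facetsB n s : s \in facetsB n <->
  [\/ exists2 m, (1 <= m <= n - 3)%N & s = fneg n m,
      exists2 m, (1 <= m <= n - 3)%N & s = fpos n m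
    | [\/ s = fmid n, s = fend1 n | s = fend2 n]].
Proof.
rewrite !inE mem_cat inE; split=> [/or3P[/eqP->|/eqP->|/or3P[/descP|/eqP->|/descP]]|].
- by constructor 3; constructor 3.
- by constructor 3; constructor 2.
- by constructor 2.
- by constructor 3; constructor 1.
- by constructor 1.
case=> [/descP->|/descP->|[]->]; rewrite ?eqxx ?orbT //.
Qed.

Lemma facetsB_fneg n m : (1 <= m <= n - 3)%N -> fneg n m \in facetsB n.
Proof. by move=> hm; apply/mem_facetsB; constructor 1; exists m. Qed.
Lemma facetsB_fpos n m : (1 <= m <= n - 3)%N -> fpos n m \in facetsB n.
Proof. by move=> hm; apply/mem_facetsB; constructor 2; exists m. Qed.
Lemma facetsB_fmid n : fmid n \in facetsB n.
Proof. by apply/mem_facetsB; constructor 3; constructor 1. Qed.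
Lemma facetsB_fend1 n : fend1 n \in facetsB n.
Proof. by apply/mem_facetsB; constructor 3; constructor 2. Qed.
Lemma facetsB_fend2 n : fend2 n \in facetsB n.
Proof. by apply/mem_facetsB; constructor 3; constructor 3. Qed.

(** The stack follows the path: the apexes are the path vertices in order, from -2 down to 2-n, then
    1, then 2 up to n-2. Finally [fend1] adds 1-n on top of [fmid], and [fend2] adds -n on top of
    [fend1]. *)
Lemma stacked_facetsB n : (4 <= n)%N -> stacked (facetsB n).
Proof.
move=> n4.
have neg k : (1 <= k <= n - 3)%N -> stacked (desc (fneg n) k).
  elim: k => // k IH hk; case: (posnP k) => [->|k0] /=.
    by apply/stacked1/card_ap; rewrite ?in_tri; move: n4; clear; lia.
  apply: (@stacked_ap _ _ _ _ _ (fneg n k)); try by move: n4 hk; clear; lia.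
  - by apply: IH; move: k0 hk; clear; lia.
  - by apply/descP; exists k; rewrite // leqnn k0.
  - by rewrite !in_ap !eqxx !orbT.
  by move=> s /descP[m hm ->]; rewrite in_ap; move: n4 hm hk; clear; lia.
have mid : stacked (fmid n :: desc (fneg n) (n - 3)).
  apply: (@stacked_ap _ _ _ _ _ (fneg n (n - 3))); try by move: n4; clear; lia.
  - by apply: neg; move: n4; clear; lia.
  - by apply/descP; exists (n - 3)%N => //; move: n4; clear; lia.
  - by rewrite !in_ap; move: n4; clear; lia.
  by move=> s /descP[m hm ->]; rewrite in_ap; move: n4 hm; clear; lia.
have pos k : (k <= n - 3)%N ->
    stacked (desc (fpos n) k ++ fmid n :: desc (fneg n) (n - 3)).
  elim: k => // k IH hk /=.
  apply: (@stacked_ap _ _ _ _ _ (if k == 0%N then fmid n else fpos n k));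
    try by move: n4 hk; clear; lia.
  - by apply: IH; apply: ltnW.
  - rewrite mem_cat inE; case: eqP => k0; first by rewrite eqxx orbT.
    by apply/orP; left; apply/descP; exists k => //; move: k0; clear; lia.
  - by case: eqP => k0; rewrite !in_ap; move: n4 k0; clear; lia.
  move=> s; rewrite mem_cat inE => /or3P[/descP[m hm ->]|/eqP ->|/descP[m hm ->]];
    by rewrite in_ap; move: n4 hk; try move: hm; clear; lia.
have e1 : stacked (fend1 n :: desc (fpos n) (n - 3) ++ fmid n :: desc (fneg n) (n - 3)).
  apply: (@stacked_ap _ _ _ _ _ (fmid n)); try by move: n4; clear; lia.
  - exact: pos.
  - by rewrite mem_cat inE eqxx orbT.
  - by rewrite !in_ap; move: n4; clear; lia.
  move=> s; rewrite mem_cat inE => /or3P[/descP[m hm ->]|/eqP ->|/descP[m hm ->]];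
    by rewrite in_ap; move: n4; try move: hm; clear; lia.
apply: (@stacked_ap _ _ _ _ _ (fend1 n)); try by move: n4; clear; lia.
- exact: e1.
- by rewrite inE eqxx.
- by rewrite !in_ap; move: n4; clear; lia.
move=> s; rewrite inE mem_cat inE => /orP[/eqP->|/or3P[/descP[m hm ->]|/eqP ->|/descP[m hm ->]]];
  by rewrite in_ap; move: n4; try move: hm; clear; lia.
Qed.

End FacetsB.

(** * Unfolding the definition of B^{3,1}_n *)

Section BallB.
Implicit Types (n m k : nat) (s : {fset int}).

Lemma eq_generated (T : choiceType) (F G : cplx T) :
  F =i G -> generated F = generated G.
Proof. by move=> e; congr generated; apply/fsetP. Qed.

Lemma B_10_generated m :
  B 1 0 m = generated [fset s | s in [:: [fset -1; m%:Z]]].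
Proof.
apply/fsetP => s; rewrite B_10 fpowersetE; apply/idP/generatedP => [h|[t]].
  by exists [fset -1; m%:Z]; rewrite // mem_fset_seq inE.
by rewrite mem_fset_seq inE => /eqP ->.
Qed.

Definition edge_pos (i : nat) : {fset int} := [fset i%:Z; i.+1%:Z].
Definition edge_neg (i : nat) : {fset int} := [fset - i%:Z; - i.+1%:Z].

Lemma Delta1_edges m s : (2 <= m)%N ->
  let p := ([seq i%:Z | i <- iota 1 m] ++ [seq - i%:Z | i <- iota 1 m] ++ [:: 1]) in
  s \in [fset [fset e.1; e.2] | e in zip p (behead p)] <->
  [\/ exists2 i, (1 <= i < m)%N & s = edge_pos i,
      exists2 i, (1 <= i < m)%N & s = edge_neg i
    | s = [fset -1; m%:Z] \/ s = [fset 1; - m%:Z]].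
Proof.
move=> m2 p.
have sp : size p = (m + m).+1 by rewrite !size_cat !size_map size_iota /= addn1 addnS.
have nthp i : (i <= m + m)%N -> nth 0 p i =
    if (i < m)%N then i.+1%:Z else if (i < m + m)%N then - (i - m).+1%:Z else 1.
  move=> hi; rewrite !nth_cat !size_map !size_iota.
  case: ifP => h1; first by rewrite (nth_map 0%N) ?size_iota // nth_iota.
  have -> : (i - m < m)%N = (i < m + m)%N by move: h1; clear; lia.
  case: ifP => h2; first by rewrite (nth_map 0%N) ?size_iota ?nth_iota //; move: h1 h2; clear; lia.
  by rewrite (_ : (i - m - m = 0)%N) //; move: h1 h2 hi; clear; lia.
have sz : size (zip p (behead p)) = (m + m)%N.
  by rewrite size_zip size_behead sp /=; apply/minn_idPr.
have nthz i : (i < m + m)%N -> nth (0, 0) (zip p (behead p)) i = (nth 0 p i, nth 0 p i.+1).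
  move=> hi; rewrite nth_zip_cond sz hi nth_behead //.
have mem s' : s' \in [fset [fset e.1; e.2] | e in zip p (behead p)] <->
    exists2 i, (i < m + m)%N & s' = [fset nth 0 p i; nth 0 p i.+1].
  split=> [/imfsetP[e /=]|[i hi ->]].
    move/(nthP (0, 0)) => [i]; rewrite sz => hi; rewrite nthz // => <- ->.
    by exists i.
  apply/imfsetP; exists (nth 0 p i, nth 0 p i.+1) => //=.
  by rewrite -nthz // mem_nth // sz.
split.
  move/mem => [i hi ->]; rewrite !nthp //; last by apply: ltnW.
  case: (ltngtP i.+1 m) => h1.
  - by constructor 1; exists i.+1.
  - rewrite hi; case: ifP => h2.
      constructor 2; exists (i - m).+1; first by move: h1 h2; clear; lia.
      by rewrite subSn //; move: h1; clear; lia.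
    constructor 3; right; rewrite fsetUC; congr [fset _; _].
    by move: hi h2 m2; clear; lia.
  constructor 3; left; rewrite fsetUC h1 subnn.
  by have -> : (m < m + m)%N by move: m2; clear; lia.
case=> [[i hi ->]|[i hi ->]|[->|->]]; apply/mem.
- exists i.-1; first by move: hi; clear; lia.
  rewrite !nthp; try by move: hi; clear; lia.
  have -> : (i.-1 < m)%N by move: hi; clear; lia.
  have -> : (i.-1.+1 < m)%N by move: hi; clear; lia.
  by congr [fset _; _]; move: hi; clear; lia.
- exists (m + i.-1)%N; first by move: hi; clear; lia.
  rewrite !nthp; try by move: hi; clear; lia.
  have -> : (m + i.-1 < m)%N = false by move: hi; clear; lia.
  have -> : ((m + i.-1).+1 < m)%N = false by move: hi; clear; lia.
  have -> : (m + i.-1 < m + m)%N by move: hi; clear; lia.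
  have -> : ((m + i.-1).+1 < m + m)%N by move: hi; clear; lia.
  by congr [fset _; _]; move: hi; clear; lia.
- exists m.-1; first by move: m2; clear; lia.
  rewrite !nthp; try by move: m2; clear; lia.
  have -> : (m.-1 < m)%N by move: m2; clear; lia.
  have -> : (m.-1.+1 < m)%N = false by move: m2; clear; lia.
  have -> : (m.-1.+1 < m + m)%N by move: m2; clear; lia.
  by rewrite fsetUC; congr [fset _; _]; move: m2; clear; lia.
exists (m + m).-1; first by move: m2; clear; lia.
rewrite !nthp; try by move: m2; clear; lia.
have -> : ((m + m).-1 < m)%N = false by move: m2; clear; lia.
have -> : ((m + m).-1.+1 < m)%N = false by move: m2; clear; lia.
have -> : ((m + m).-1 < m + m)%N by move: m2; clear; lia.
have -> : ((m + m).-1.+1 < m + m)%N = false by move: m2; clear; lia.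
by rewrite fsetUC; congr [fset _; _]; move: m2; clear; lia.
Qed.

Definition path_edges m : seq {fset int} :=
  [fset 1; - m%:Z] :: [seq edge_pos i | i <- iota 1 m.-1] ++ [seq edge_neg i | i <- iota 1 m.-1].

Lemma B_11_generated m : (2 <= m)%N -> B 1 1 m = generated [fset s | s in path_edges m].
Proof.
move=> m2; rewrite (@B_top 1) // /delete -[1.*2.-1]/1%N Delta_1 /Delta1 /path_complex B_10.
set E := [fset _ | _ in zip _ _]; have EP s : s \in E <-> _ := Delta1_edges s m2.
have c2 (a b : int) : a != b -> #|` [fset a; b]| = 2 by rewrite cardfs2 => ->.
rewrite (@facets_generated _ 2); last first.
  by move=> s /EP[[i _ ->]|[i _ ->]|[]->]; apply: c2; move: m2; clear; lia.
apply: eq_generated => s; rewrite mem_fset_seq !inE fpowersetE /=.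
have nsub (a b : int) : (b != -1) && (b != m%:Z) -> ~~ ([fset a; b] `<=` [fset -1; m%:Z]).
  by case/andP => h1 h2; rewrite fsubUset !fsub1set !inE (negPf h1) (negPf h2) andbF.
apply/andP/idP => [[/EP[[i hi ->]|[i hi ->]|[]->] ns]|].
- by rewrite mem_cat map_f ?orbT // mem_iota; move: hi; clear; lia.
- by rewrite mem_cat [X in _ || (_ || X)]map_f ?orbT // mem_iota; move: hi; clear; lia.
- by rewrite fsubset_refl in ns.
- by rewrite eqxx.
rewrite mem_cat => /or3P[/eqP->|/mapP[i]|/mapP[i]]; rewrite ?mem_iota.
- split; first by apply/EP; constructor 3; right.
  by apply: nsub; move: m2; clear; lia.
- move=> hi ->; split; first by apply/EP; constructor 1; exists i => //; move: hi; clear; lia.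
  rewrite /edge_pos fsetUC; apply: nsub; move: hi; clear; lia.
- move=> hi ->; split; first by apply/EP; constructor 2; exists i => //; move: hi; clear; lia.
  by apply: nsub; move: hi; clear; lia.
Qed.

Lemma B_31_generated n : (4 <= n)%N -> B 3 1 n = generated [fset s | s in facetsB n].
Proof.
move=> n4; rewrite B_rec // (@B_rec 2 1) // (@B_rec 2 0) // fsetU0.
rewrite -!subn1 -subnDA -[(1 + 1)%N]/2%N.
rewrite B_11_generated; last by move: n4; clear; lia.
rewrite !B_10_generated !oppc_generated !cone_generated -generatedU cone_generated.
have -> : generated [fset (n - 1)%:Z |` t | t in [fset s | s in [:: [fset -1; (n - 2)%:Z]]]]
    = generated [fset s | s in [:: (n - 1)%:Z |` [fset -1; (n - 2)%:Z]]].
  apply: eq_generated => s; rewrite mem_fset_seq inE; apply/imfsetP/eqP => [[t /=]|->].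
    by rewrite mem_fset_seq inE => /eqP-> ->.
  by exists [fset -1; (n - 2)%:Z]; rewrite //= mem_fset_seq inE.
rewrite oppc_generated cone_generated -generatedU; apply: eq_generated => s.
rewrite mem_fset_seq; apply/idP/idP.
  rewrite inE => /orP[/imfsetP[u /=]|/imfsetP[u /=]]; last first.
    rewrite mem_fset_seq inE => /eqP -> ->; apply/mem_facetsB; constructor 3; constructor 3.
    by apply/fsetP => x; rewrite in_ap !inE mem_oppf !inE; move: n4; clear; lia.
  rewrite inE => /orP[/imfsetP[t /=]|/imfsetP[t /=]]; rewrite mem_fset_seq inE; last first.
    move=> /eqP -> -> ->; apply/mem_facetsB; constructor 3; constructor 2.
    by apply/fsetP => x; rewrite in_ap !inE mem_oppf !inE; move: n4; clear; lia.
  rewrite mem_cat => /or3P[/eqP->|/mapP[i]|/mapP[i]]; rewrite ?mem_iota.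
  - move=> -> ->; apply/mem_facetsB; constructor 3; constructor 1.
    by apply/fsetP => x; rewrite in_ap !inE; move: n4; clear; lia.
  - move=> hi -> -> ->; apply/mem_facetsB; constructor 2; exists i.
      by move: hi n4; clear; lia.
    by apply/fsetP => x; rewrite in_ap !inE; move: n4; clear; lia.
  - move=> hi -> -> ->; apply/mem_facetsB; constructor 1; exists i.
      by move: hi n4; clear; lia.
    by apply/fsetP => x; rewrite in_ap !inE; move: n4; clear; lia.
have cone1 t x y :
    t \in path_edges (n - 2) -> x = y |` ((n - 1)%:Z |` t) -> y = n%:Z ->
    x \in [fset n%:Z |` t0 | t0 in
      [fset (n - 1)%:Z |` t0 | t0 in [fset s | s in path_edges (n - 2)]] `|`
      [fset - (n - 1)%:Z |` t0 | t0 in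
        [fset s | s in [seq oppf i | i <- [:: [fset -1; (n - 2)%:Z]]]]]].
  move=> tP -> ->; apply/imfsetP; exists ((n - 1)%:Z |` t) => //=.
  by rewrite inE; apply/orP; left; apply/imfsetP; exists t; rewrite //= mem_fset_seq.
move/mem_facetsB => [[m hm ->]|[m hm ->]|[]->]; rewrite inE; apply/orP.
- left; apply: (@cone1 (edge_neg m) _ n%:Z) => //.
    by rewrite inE mem_cat [X in _ || (_ || X)]map_f ?orbT // mem_iota; move: hm; clear; lia.
  by apply/fsetP => x; rewrite in_ap !inE; move: n4; clear; lia.
- left; apply: (@cone1 (edge_pos m) _ n%:Z) => //.
    by rewrite inE mem_cat map_f ?orbT // mem_iota; move: hm; clear; lia.
  by apply/fsetP => x; rewrite in_ap !inE; move: n4; clear; lia.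
- left; apply: (@cone1 [fset 1; - (n - 2)%:Z] _ n%:Z) => //; first by rewrite inE eqxx.
  by apply/fsetP => x; rewrite in_ap !inE; move: n4; clear; lia.
- left; apply/imfsetP; exists (- (n - 1)%:Z |` oppf [fset -1; (n - 2)%:Z]) => /=.
    rewrite inE; apply/orP; right; apply/imfsetP.
    by exists (oppf [fset -1; (n - 2)%:Z]); rewrite //= mem_fset_seq inE.
  by apply/fsetP => x; rewrite in_ap !inE mem_oppf !inE; move: n4; clear; lia.
right; apply/imfsetP; exists (oppf ((n - 1)%:Z |` [fset -1; (n - 2)%:Z])) => /=.
  by rewrite mem_fset_seq inE.
by apply/fsetP => x; rewrite in_ap !inE mem_oppf !inE; move: n4; clear; lia.
Qed.

End BallB.

(** * The cross-polytope as initial sphere *)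

Section Base.
Variable R : realType.
Implicit Types (s t : {fset int}).

Definition cross_facets : cplx int := [fset s in cross_boundary 4 | #|` s| == 4].

Lemma cross_boundaryE s : (s \in cross_boundary 4) = (s `<=` V 4) && antipode_free s.
Proof. by rewrite !inE fpowersetE. Qed.

Lemma cross_facetsE s :
  (s \in cross_facets) = [&& s `<=` V 4, antipode_free s & #|` s| == 4].
Proof. by rewrite !inE /= fpowersetE -andbA. Qed.

Lemma V_succ k : V k.+1 = [fset k.+1%:Z; - k.+1%:Z] `|` V k.
Proof. by apply/fsetP => v; rewrite mem_V in_fsetU in_fset2 mem_V; clear; lia. Qed.

Lemma antipode_free_card k s : s `<=` V k -> antipode_free s -> (#|` s| <= k)%N.
Proof.
elim: k s => [|k IH] s sV fs.
  suff -> : s = fset0 by rewrite cardfs0.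
  apply/fsetP => v; rewrite inE; apply/negbTE/negP => /(fsubsetP sV).
  by rewrite mem_V; clear; lia.
have /antipode_freeP h := fs.
have key v : s `<=` V k.+1 -> v \in [fset k.+1%:Z; - k.+1%:Z] -> - v \notin s ->
    (#|` s| <= k.+1)%N.
  move=> _ vk nv; apply: (@leq_trans (#|` s `\ v|).+1).
    by rewrite [X in (X <= _)%N](cardfsD1 v) -add1n leq_add2r leq_b1.
  rewrite ltnS; apply: IH; last first.
    apply/antipode_freeP => w; rewrite !inE => /andP[_ /h ws].
    by rewrite negb_and ws orbT.
  apply/fsubsetP => w; rewrite inE => /andP[wv ws].
  have := fsubsetP sV _ ws; rewrite V_succ in_fsetU => /orP[|//].
  have nws : w != - v by apply: contraNneq nv => <-.
  by move: vk wv nws; rewrite !inE; clear; lia.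
case: (boolP (k.+1%:Z \in s)) => ks.
  by apply: (key k.+1%:Z) => //; rewrite ?inE ?eqxx // h.
by apply: (key (- k.+1%:Z)) => //; rewrite ?opprK // !inE eqxx orbT.
Qed.

(** If [s] has fewer than [k] elements, then [s] and its antipode together do not exhaust the 2k
    elements of [V k], and any element left out can be added to [s]. *)
Lemma antipode_free_extend k s : s `<=` V k -> antipode_free s -> exists t,
  [/\ s `<=` t, t `<=` V k, antipode_free t & #|` t| = k].
Proof.
move=> sV fs; have [m le_m] := ubnP (k - #|` s|)%N.
elim: m s sV fs le_m => // m IH s sV fs le_m.
have := antipode_free_card sV fs; rewrite leq_eqVlt => /predU1P[e|lt_s].
  by exists s.
have /antipode_freeP hs := fs.
suff [v vV [v1 v2]] : exists2 v, v \in V k & v \notin s /\ - v \notin s.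
  have fvs : antipode_free (v |` s).
    apply/antipode_freeP => w; rewrite !inE => /predU1P[->|ws]; rewrite negb_or.
      by rewrite v2 andbT; move: vV; rewrite mem_V; clear; lia.
    rewrite hs // andbT eqr_oppLR; apply: contraNneq v2 => <-.
    by [].
  have cvs : #|` v |` s| = #|` s|.+1 by rewrite cardfsU1 v1.
  have [||t [st tV ft ct]] := IH (v |` s) _ fvs.
  - by rewrite fsubUset fsub1set vV.
  - by rewrite cvs; move: le_m lt_s; clear; lia.
  by exists t; split=> //; apply: fsubset_trans st; apply: fsubsetUr.
have cV : #|` V k| = k.*2.
  elim: k {IH sV fs le_m lt_s hs} => [|k IHk].
    by apply/eqP; rewrite cardfs_eq0; apply/eqP/fsetP => v; rewrite mem_V in_fset0; clear; lia.
  rewrite V_succ -fsetUA !cardfsU1 IHk in_fset1U !mem_V.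
  by clear; lia.
have sub : V k `<=` s `|` oppf s -> (k.*2 <= #|` s|.*2)%N.
  move/fsubset_leq_card; rewrite cV => h; apply: leq_trans h _.
  by rewrite cardfsU card_oppf addnn leq_subr.
have : ~~ (V k `<=` s `|` oppf s).
  by apply/negP => /sub; rewrite leq_double leqNgt lt_s.
move=> /fsubsetPn[v vV]; rewrite inE negb_or mem_oppf => /andP[v1 v2].
by exists v.
Qed.

Lemma generated_cross_facets : generated cross_facets = cross_boundary 4.
Proof.
apply/fsetP => s; rewrite cross_boundaryE; apply/generatedP/andP => [[t]|[sV fs]].
  rewrite cross_facetsE => /and3P[tV /antipode_freeP ft _] st; split.
    exact: fsubset_trans tV.
  apply/antipode_freeP => v vs; apply: contra (ft _ (fsubsetP st _ vs)).
  exact: (fsubsetP st).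
have [t [st tV ft ct]] := antipode_free_extend sV fs.
by exists t => //; rewrite cross_facetsE tV ft ct.
Qed.

(** Two vertices that extend the same triangle are equal or antipodal, since otherwise five elements
    of [V 4] would contain no antipodal pair. *)
Lemma cross_facets_pseudomanifold : pseudomanifold cross_facets.
Proof.
move=> t s1 s2 s3 t3 F1 F2 F3 t1 t2 t3'.
have ext s : s \in cross_facets -> t `<=` s ->
    exists x, [/\ s = x |` t, x \in V 4, x \notin t & - x \notin t].
  rewrite cross_facetsE => /and3P[sV /antipode_freeP fs /eqP s4] ts.
  have /fsubsetPn[x xs xt] : ~~ (s `<=` t).
    by apply/negP => /fsubset_leq_card; rewrite s4 t3.
  exists x; split=> //; last by apply: contra (fs _ xs); apply: (fsubsetP ts).
  - apply/esym/eq_of_card; first by rewrite fsubUset fsub1set xs.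
    by rewrite cardfsU1 xt t3 s4.
  - exact: (fsubsetP sV).
have ft : antipode_free t /\ t `<=` V 4.
  move: F1; rewrite cross_facetsE => /and3P[sV /antipode_freeP fs _].
  split; last exact: fsubset_trans sV.
  apply/antipode_freeP => v vt; apply: contra (fs _ (fsubsetP t1 _ vt)).
  exact: (fsubsetP t1).
have uniq_ext x y : x \in V 4 -> x \notin t -> - x \notin t ->
    y \in V 4 -> y \notin t -> - y \notin t -> y = x \/ y = - x.
  move=> xV xt nxt yV yt nyt; have [->|yx] := eqVneq y x; first by left.
  have [->|ynx] := eqVneq y (- x); first by right.
  have [/antipode_freeP hf tV] := ft.
  have : antipode_free (x |` (y |` t)).
    apply/antipode_freeP => w; rewrite !inE => /or3P[/eqP->|/eqP->|wt]; rewrite !negb_or.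
    - rewrite nxt [- x == y]eq_sym ynx ?andbT.
      by move: xV; rewrite mem_V; clear; lia.
    - rewrite nyt [- y == x]eqr_oppLR ynx ?andbT /=.
      by move: yV; rewrite mem_V; clear; lia.
    rewrite hf // andbT !eqr_oppLR.
    by apply/andP; split; [apply: contraNneq nxt|apply: contraNneq nyt] => <-.
  move/antipode_free_card => /(_ 4).
  rewrite !fsubUset !fsub1set xV yV tV => /(_ isT).
  by rewrite !cardfsU1 !inE negb_or eq_sym yx xt yt t3.
have [x1 [-> x1V x1t nx1]] := ext _ F1 t1; have [x2 [-> x2V x2t nx2]] := ext _ F2 t2.
have [x3 [-> x3V x3t nx3]] := ext _ F3 t3'.
have [->|->] := uniq_ext _ _ x1V x1t nx1 x2V x2t nx2; first by constructor 1.
have [->|->] := uniq_ext _ _ x1V x1t nx1 x3V x3t nx3; first by constructor 2.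
by constructor 3.
Qed.

Lemma cs_sphere_cross : cs_sphere R cross_facets 4.
Proof.
split.
- by move=> s; rewrite cross_facetsE => /and3P[_ _ /eqP].
- exact: cross_facets_pseudomanifold.
- move=> s; rewrite !cross_facetsE card_oppf => /and3P[sV /antipode_freeP fs ->].
  rewrite andbT; apply/andP; split.
    apply/fsubsetP => v; rewrite mem_oppf => /(fsubsetP sV); rewrite !mem_V.
    by clear; lia.
  by apply/antipode_freeP => v; rewrite !mem_oppf => /fs.
- by move=> s; rewrite cross_facetsE => /and3P[].
- by move=> s; rewrite cross_facetsE => /and3P[].
- move=> a b aV bV ab.
  have [||t [st tV ft ct]] := @antipode_free_extend 4 [fset a; b].
  - by rewrite fsubUset !fsub1set aV.
  - apply/antipode_freeP => v; move: aV bV ab; rewrite !mem_V !inE; clear.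
    by lia.
  exists t; first by rewrite cross_facetsE tV ft ct.
  by move: st; rewrite fsubUset !fsub1set.
by rewrite generated_cross_facets; apply: cross_boundary4.
Qed.

End Base.

Section DeltaFacets.
Variable R : realType.
Implicit Types (n m k : nat) (s t : {fset int}).

Lemma facetsB_sub n s : (4 <= n)%N -> s \in facetsB n -> s `<=` V n.
Proof.
move=> n4 /mem_facetsB[[m hm ->]|[m hm ->]|[]->]; apply/fsubsetP => x;
  rewrite mem_V in_ap; move: n4; try move: hm; clear; lia.
Qed.

Lemma facetsB_free n s : (4 <= n)%N -> s \in facetsB n -> antipode_free s.
Proof.
move=> n4 /mem_facetsB[[m hm ->]|[m hm ->]|[]->]; apply/antipode_freeP => x;
  rewrite !in_ap; move: n4; try move: hm; clear; lia.
Qed.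

(** Every facet except [fend2] contains n and not -n, so one of two antipodal facets would be
    [fend2]. The other would then contain -1 and n-2, which share no facet. *)
Lemma facetsB_opp n s : (4 <= n)%N -> s \in facetsB n -> oppf s \notin facetsB n.
Proof.
move=> n4 sB; have no s' : s' \in facetsB n -> (-1 \in s') && (n%:Z - 2 \in s') -> False.
  by move=> /mem_facetsB[[m hm ->]|[m hm ->]|[]->];
    rewrite !in_ap; move: n4; try move: hm; clear; lia.
have top s' : s' \in facetsB n -> s' = fend2 n \/ (n%:Z \in s' /\ - n%:Z \notin s').
  move=> /mem_facetsB[[m hm ->]|[m hm ->]|[]->]; try (by left); right;
    by rewrite !in_ap; move: n4; try move: hm; clear; lia.
have e2 : (1 \in fend2 n) && (2 - n%:Z \in fend2 n) by rewrite !in_ap; clear; lia.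
apply/negP => oB; have [es|[ns mns]] := top _ sB.
  apply: (no _ oB); rewrite !mem_oppf es opprB opprK.
  exact: e2.
have [es|[ons _]] := top _ oB; last by move: ons; rewrite mem_oppf (negPf mns).
by apply: (no _ sB); move: e2; rewrite -es !mem_oppf opprB.
Qed.

Lemma facetsB_vert n a : (4 <= n)%N -> a \in V n -> exists2 s, s \in facetsB n & a \in s.
Proof.
move=> n4; rewrite mem_V => ha.
have [h|] := boolP ((- (n%:Z - 2) <= a) && (a < 0)).
  exists (fneg n (if a == -1 then 1%N else `|a|%N.-1)).
    by apply: facetsB_fneg; move: n4 h; clear; case: ifP; lia.
  by rewrite in_ap; move: n4 h; clear; case: ifP; lia.
have [h _|h1 h2] := boolP ((0 < a) && (a <= n%:Z - 2)).
  exists (fpos n (if a == 1 then 1%N else `|a|%N.-1)).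
    by apply: facetsB_fpos; move: n4 h; clear; case: ifP; lia.
  by rewrite in_ap; move: n4 h; clear; case: ifP; lia.
have [h|h] := boolP (0 < a).
  exists (fmid n); first exact: facetsB_fmid.
  by rewrite in_ap; move: n4 ha h h1; clear; lia.
exists (fend2 n); first exact: facetsB_fend2.
by rewrite in_ap; move: n4 ha h h2; clear; lia.
Qed.

(** The recursion of [Delta 3] on facets, constant up to n = 4. *)
Fixpoint D (n : nat) : cplx int :=
  if n is m.+1 then
    if (m < 4)%N then cross_facets else replace2 (D m) (facetsB m) m.+1%:Z
  else cross_facets.

Lemma D_step n : (4 <= n)%N -> D n.+1 = replace2 (D n) (facetsB n) n.+1%:Z.
Proof. by move=> n4 /=; rewrite ltnNge n4. Qed.

(** Each of the three vertices is matched with one of the four entries of a facet. Inconsistent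
    matchings are refuted by [lia]; the others determine the index of the facet. *)
Local Ltac uniqueB := move=> ? /mem_facetsB[[? ? ->]|[? ? ->]|[]->];
  rewrite !in_ap; case/or4P=> /eqP ?; try (by exfalso; lia);
  case/or4P=> /eqP ?; try (by exfalso; lia); case/or4P=> /eqP ?;
  first [ by exfalso; lia
        | lazymatch goal with
          | |- fneg _ ?a = fneg _ ?b => by have -> : a = b by lia
          | |- fpos _ ?a = fpos _ ?b => by have -> : a = b by lia
          | |- ?x = ?x => reflexivity
          end ].

(** This triangle and those of the next four lemmas are the ones whose cones with apex m+1 are, up
    to the antipode, the facets of B^{3,1}_{m+1}. For j = m-2 the triangle belongs to [fend1]
    instead of an [fneg]. *)
Lemma bd_neg m j : (4 <= m)%N -> (1 <= j <= m - 2)%N ->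
  bd (facetsB m) (tri (- j.+1%:Z) (- j%:Z) m%:Z).
Proof.
move=> m4 hj; have [hj'|hj'] := leqP j (m - 3).
  apply: (@bd_tri _ _ _ _ (fneg m j)); try by move: m4 hj; clear; lia.
  - by apply: facetsB_fneg; move: hj hj'; clear; lia.
  - by rewrite !in_ap; clear; lia.
  uniqueB.
apply: (@bd_tri _ _ _ _ (fend1 m)); try by move: m4 hj; clear; lia.
- exact: facetsB_fend1.
- by rewrite !in_ap; move: m4 hj hj'; clear; lia.
uniqueB.
Qed.

Lemma bd_pos m j : (4 <= m)%N -> (1 <= j <= m - 2)%N ->
  bd (facetsB m) (tri j.+1%:Z j%:Z m%:Z).
Proof.
move=> m4 hj; have [hj'|hj'] := leqP j (m - 3).
  apply: (@bd_tri _ _ _ _ (fpos m j)); try by move: m4 hj; clear; lia.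
  - by apply: facetsB_fpos; move: hj hj'; clear; lia.
  - by rewrite !in_ap; clear; lia.
  uniqueB.
apply: (@bd_tri _ _ _ _ (fpos m (m - 3))); try by move: m4 hj; clear; lia.
- by apply: facetsB_fpos; move: m4; clear; lia.
- by rewrite !in_ap; move: m4 hj hj'; clear; lia.
uniqueB.
Qed.

Lemma bd_mid m : (4 <= m)%N -> bd (facetsB m) (tri 1 (1 - m%:Z) m%:Z).
Proof.
move=> m4; apply: (@bd_tri _ _ _ _ (fend1 m)); try by move: m4; clear; lia.
- exact: facetsB_fend1.
- by rewrite !in_ap; move: m4; clear; lia.
uniqueB.
Qed.

Lemma bd_end1 m : (4 <= m)%N -> bd (facetsB m) (tri (- m%:Z) 1 (1 - m%:Z)).
Proof.
move=> m4; apply: (@bd_tri _ _ _ _ (fend2 m)); try by move: m4; clear; lia.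
- exact: facetsB_fend2.
- by rewrite !in_ap; move: m4; clear; lia.
uniqueB.
Qed.

Lemma bd_end2 m : (4 <= m)%N -> bd (facetsB m) (tri (-1) (m%:Z - 1) m%:Z).
Proof.
move=> m4; apply: (@bd_tri _ _ _ _ (fneg m 1)); try by move: m4; clear; lia.
- by apply: facetsB_fneg; move: m4; clear; lia.
- by rewrite !in_ap; move: m4; clear; lia.
uniqueB.
Qed.

Lemma D_cone m t : cs_sphere R (D m) m -> cs_ball (D m) (facetsB m) m -> (4 <= m)%N ->
  bd (facetsB m) t -> m.+1%:Z |` t \in D m.+1.
Proof.
move=> hD hB m4 bt; rewrite D_step //; apply/(replace2P _ hD hB); right.
by exists t => //; left.
Qed.

Lemma cs_ball_facetsB n : (4 <= n)%N -> cs_sphere R (D n) n ->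
  {subset facetsB n <= D n} -> cs_ball (D n) (facetsB n) n.
Proof.
move=> n4 hD sub; split=> //; first exact: stacked_facetsB.
  by move=> s; apply: facetsB_opp.
by move=> a; apply: facetsB_vert.
Qed.

(** Sphere and ball advance together: the ball at n is needed to build the next sphere, and the next
    ball consists of cones over its boundary. *)
Lemma D_sphere_ball n : (4 <= n)%N ->
  cs_sphere R (D n) n /\ cs_ball (D n) (facetsB n) n.
Proof.
elim: n => // n IH; rewrite leq_eqVlt => /predU1P[[<-]|n4].
  have hD := cs_sphere_cross R; split=> //; apply: cs_ball_facetsB => //.
  move=> s sB; rewrite cross_facetsE (facetsB_sub _ sB) // (facetsB_free _ sB) //.
  by rewrite (stacked_pure (stacked_facetsB _) sB).
have {IH}[hD hB] := IH n4; have hD' : cs_sphere R (D n.+1) n.+1.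
  by rewrite D_step //; apply: cs_sphere_replace2.
split=> //; apply: cs_ball_facetsB; [exact: leqW | exact: hD' | ].
have cone x a b c t : bd (facetsB n) t -> ap x a b c =i n.+1%:Z |` t ->
    ap x a b c \in D n.+1.
  by move=> bt e; rewrite (_ : ap x a b c = n.+1%:Z |` t); [apply: D_cone|apply/fsetP].
move=> s /mem_facetsB[[j hj ->]|[j hj ->]|[]->].
- apply: cone (bd_neg n4 (j := j) _) _; first by move: hj; clear; lia.
  by move=> x; rewrite in_ap inE in_tri inE; clear; lia.
- apply: cone (bd_pos n4 (j := j) _) _; first by move: hj; clear; lia.
  by move=> x; rewrite in_ap inE in_tri inE; clear; lia.
- apply: cone (bd_mid n4) _.
  by move=> x; rewrite in_ap inE in_tri inE; clear; lia.
- apply: cone (bd_end1 n4) _.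
  by move=> x; rewrite in_ap inE in_tri inE; clear; lia.
(* The facet [fend2] contains -(n+1), so it is the antipode of a cone with apex n+1. *)
rewrite -(oppfK (fend2 _)); apply: (cs_opp hD'); rewrite oppf_ap.
apply: cone (bd_end2 n4) _.
by move=> x; rewrite in_ap inE in_tri inE; clear; lia.
Qed.

Lemma Delta_D n : (4 <= n)%N -> Delta 3 n = generated (D n).
Proof.
elim: n => // n IH; rewrite leq_eqVlt => /predU1P[[<-]|n4].
  by rewrite Delta_base // generated_cross_facets.
have [hD hB] := D_sphere_ball n4.
by rewrite D_step // (Delta_step_generated _ hD hB) ?IH ?B_31_generated.
Qed.

End DeltaFacets.

(** * The facets of B(I) *)

Section FacetsI.
Implicit Types (n m k c i : nat) (s t : {fset int}) (P : pred nat).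

(** The last element of [P] below [m] is the index i_j that determines the positive pair of the
    facet numbered [m]. Reading the index set as a predicate avoids positions in a list. *)
Fixpoint cur P m : option nat :=
  if m is m'.+1 then if P m' then Some m' else cur P m' else None.

Variant cur_spec P m : option nat -> Prop :=
| CurNone of (forall i, (i < m)%N -> ~~ P i) : cur_spec P m None
| CurSome c of (c < m)%N & P c & (forall i, (c < i < m)%N -> ~~ P i) :
    cur_spec P m (Some c).

Lemma curP P m : cur_spec P m (cur P m).
Proof.
elim: m => [|m IH] /=; first by constructor.
case: ifP => Pm.
  by constructor => // i /andP[h1 h2]; move: h1 h2; rewrite ltnS => h1 /(leq_trans h1); rewrite ltnn.
case: IH => [h|c cm Pc h].
  by constructor => i; rewrite ltnS leq_eqVlt => /predU1P[->|/h//]; rewrite Pm.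
constructor; rewrite ?(ltnW cm) ?ltnS ?(ltnW cm) // => i /andP[ci].
rewrite ltnS leq_eqVlt => /predU1P[->|im]; first by rewrite Pm.
by apply: h; rewrite ci.
Qed.

Definition pair_lo n (o : option nat) : int := if o is Some c then n%:Z - c%:Z - 1 else n%:Z - 1.
Definition pair_hi n (o : option nat) : int := if o is Some c then n%:Z - c%:Z + 1 else n%:Z.

Definition f12 n i := ap i%:Z 1 2 (i%:Z + 2).
Definition f12n n := ap 1 2 (n%:Z - 1) n%:Z.
(* For m = i_j + 1 this is {1, -n+i_j+2, n-i_j-1, n-i_j+1}, and otherwise the
   facet of B(I) that the paper indexes by m. *)
Definition fnew n P m := ap (m%:Z + 1 - n%:Z) (if P m.-1 then 1 else m%:Z - n%:Z)
  (pair_lo n (cur P m)) (pair_hi n (cur P m)).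

(** Starting from {1, 2, n-1, n}, the stack adds the vertices n-2, ..., 3, then 2-n, 1-n, -n, then
    3-n, ..., -1. Each remaining vertex is thus introduced exactly once. *)
Definition facetsI n P : seq {fset int} :=
  desc (fun j => fnew n P j.+1) (n - 3) ++
  [:: fend2 n, fend1 n, fmid n & desc (fun j => f12 n (n - 1 - j)) (n - 4) ++ [:: f12n n]].

Definition admissible n P : Prop := forall i, P i -> (3 <= i <= n - 6)%N.

Lemma mem_facetsI n P s : (10 <= n)%N -> s \in facetsI n P <->
  [\/ exists2 i, (3 <= i <= n - 2)%N & s = f12 n i,
      exists2 m, (2 <= m <= n - 2)%N & s = fnew n P m
    | [\/ s = fmid n, s = fend1 n, s = fend2 n | s = f12n n]].
Proof.
move=> n10; rewrite mem_cat !inE mem_cat inE; split.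
  case/orP=> [/descP[j hj ->]|/or4P[/eqP->|/eqP->|/eqP->|/orP[/descP[j hj ->]|/eqP->]]].
  - by constructor 2; exists j.+1; rewrite //; move: hj n10; clear; lia.
  - by constructor 3; constructor 3.
  - by constructor 3; constructor 2.
  - by constructor 3; constructor 1.
  - by constructor 1; exists (n - 1 - j)%N => //; move: hj n10; clear; lia.
  - by constructor 3; constructor 4.
case=> [[i hi ->]|[m hm ->]|[]->]; rewrite ?eqxx ?orbT //.
  have -> : f12 n i \in desc (fun j => f12 n (n - 1 - j)) (n - 4).
    apply/descP; exists (n - 1 - i)%N; first by move: hi n10; clear; lia.
    by congr f12; move: hi n10; clear; lia.
  by rewrite !orbT.
have -> // : fnew n P m \in desc (fun j => fnew n P j.+1) (n - 3).
apply/descP; exists m.-1; first by move: hm n10; clear; lia.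
by rewrite prednK //; move: hm; clear; lia.
Qed.

Variant fnew_spec n P m : {fset int} -> Prop :=
| FnewTop of (forall i, (i < m)%N -> ~~ P i) :
    fnew_spec n P m (ap (m%:Z + 1 - n%:Z) (m%:Z - n%:Z) (n%:Z - 1) n%:Z)
| FnewStart c of m = c.+1 & P c :
    fnew_spec n P m (ap (m%:Z + 1 - n%:Z) 1 (n%:Z - c%:Z - 1) (n%:Z - c%:Z + 1))
| FnewNext c of (c.+1 < m)%N & P c & (forall i, (c < i < m)%N -> ~~ P i) :
    fnew_spec n P m (ap (m%:Z + 1 - n%:Z) (m%:Z - n%:Z) (n%:Z - c%:Z - 1) (n%:Z - c%:Z + 1)).

Lemma fnewP n P m : (2 <= m)%N -> fnew_spec n P m (fnew n P m).
Proof.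
move=> m2; rewrite /fnew; case: curP => [h|c cm Pc h] /=.
  rewrite (negPf (h _ _)) ?prednK //; last by move: m2; clear; lia.
  exact: FnewTop.
have [e|ne] := eqVneq m c.+1; first by rewrite e /= Pc; apply: FnewStart.
rewrite (negPf (h _ _)) /=; last by move: cm ne m2; clear; lia.
by apply: FnewNext => //; move: cm ne; clear; lia.
Qed.

Lemma stacked_facetsI n P : (10 <= n)%N -> admissible n P -> stacked (facetsI n P).
Proof.
move=> n10 adm.
have h12 k : (k <= n - 4)%N ->
    stacked (desc (fun j => f12 n (n - 1 - j)) k ++ [:: f12n n]).
  elim: k => [|k IH] hk /=.
    by apply/stacked1/card_ap; rewrite ?in_tri; move: n10; clear; lia.
  (* The tetrahedron {1, 2, i, i+2} is glued to {1, 2, i+2, i+4}, two steps earlier in the stack;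
     the first two are glued to {1, 2, n-1, n}. *)
  apply: (@stacked_ap _ _ _ _ _ (if (k <= 1)%N then f12n n else f12 n (n - 1 - k.-1)));
    try by move: n10 hk; clear; lia.
  - by apply: IH; apply: ltnW.
  - rewrite mem_cat inE; case: leqP => k1; first by rewrite eqxx orbT.
    by apply/orP; left; apply/descP; exists k.-1 => //; move: k1; clear; lia.
  - by case: leqP => k1; rewrite !in_ap; move: n10 k1 hk; clear; lia.
  move=> s; rewrite mem_cat inE => /orP[/descP[j hj ->]|/eqP ->];
    by rewrite in_ap; move: n10 hk; try move: hj; clear; lia.
pose base := desc (fun j => f12 n (n - 1 - j)) (n - 4) ++ [:: f12n n].
have baseP s : s \in base -> (exists2 i, (3 <= i <= n - 2)%N & s = f12 n i) \/ s = f12n n.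
  rewrite mem_cat inE => /orP[/descP[j hj ->]|/eqP->]; [left|by right].
  by exists (n - 1 - j)%N => //; move: hj n10; clear; lia.
have base_in i : (3 <= i <= n - 2)%N -> f12 n i \in base.
  move=> hi; rewrite mem_cat; apply/orP; left; apply/descP.
  exists (n - 1 - i)%N; first by move: hi n10; clear; lia.
  by congr f12; move: hi n10; clear; lia.
have h3 : stacked (fmid n :: base).
  (* Here 1 is already present, so [fmid] enters through its vertex 2-n. *)
  rewrite /fmid (_ : ap 1 (2 - n%:Z) (n%:Z - 1) n%:Z = ap (2 - n%:Z) 1 (n%:Z - 1) n%:Z); last first.
    by apply/fsetP => x; rewrite !in_ap orbCA.
  apply: (@stacked_ap _ _ _ _ _ (f12n n)); try by move: n10; clear; lia.
  - by apply: h12; move: n10; clear; lia.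
  - by rewrite mem_cat !inE eqxx orbT.
  - by rewrite !in_ap; clear; lia.
  by move=> s /baseP[[i hi ->]| ->]; rewrite in_ap; move: n10; try move: hi; clear; lia.
have h4 : stacked [:: fend1 n, fmid n & base].
  apply: (@stacked_ap _ _ _ _ _ (fmid n)); try by move: n10; clear; lia.
  - exact: h3.
  - by rewrite inE eqxx.
  - by rewrite !in_ap; clear; lia.
  move=> s; rewrite inE => /predU1P[->|/baseP[[i hi ->]| ->]];
    by rewrite in_ap; move: n10; try move: hi; clear; lia.
have h5 : stacked [:: fend2 n, fend1 n, fmid n & base].
  apply: (@stacked_ap _ _ _ _ _ (fend1 n)); try by move: n10; clear; lia.
  - exact: h4.
  - by rewrite inE eqxx.
  - by rewrite !in_ap; clear; lia.
  move=> s; rewrite !inE => /or3P[/eqP->|/eqP->|/baseP[[i hi ->]| ->]];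
    by rewrite in_ap; move: n10; try move: hi; clear; lia.
suff h k : (k <= n - 3)%N -> stacked (desc (fun j => fnew n P j.+1) k ++
    [:: fend2 n, fend1 n, fmid n & base]) by apply: h.
elim: k => [//|k IH] hk; have sk := IH (ltnW hk).
have new s : s \in desc (fun j => fnew n P j.+1) k ++
      [:: fend2 n, fend1 n, fmid n & base] -> k.+2%:Z + 1 - n%:Z \notin s.
  rewrite mem_cat !inE => /orP[/descP[j hj ->]|/or4P[/eqP->|/eqP->|/eqP->|/baseP[[i hi ->]| ->]]];
    try by rewrite in_ap; move: n10 hk; try move: hi; clear; lia.
  case: fnewP => [|_|c _ Pc|c _ Pc _]; first by move: hj; clear; lia.
  - by rewrite in_ap; move: n10 hk hj; clear; lia.
  - by rewrite in_ap; have := adm _ Pc; move: n10 hk hj; clear; lia.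
  - by rewrite in_ap; have := adm _ Pc; move: n10 hk hj; clear; lia.
rewrite /=.
have [Pk|nPk] := boolP (P k.+1).
  have hk1 := adm _ Pk.
  have -> : fnew n P k.+2 = ap (k.+2%:Z + 1 - n%:Z) 1 (n%:Z - k.+1%:Z - 1) (n%:Z - k.+1%:Z + 1).
    by rewrite /fnew /= Pk.
  (* At an element of [P] the row of [fnew] is interrupted, and the facet is glued along {1, n-i-1,
     n-i+1} to {1, 2, n-i-1, n-i+1}, where i = k+1. *)
  apply: (@stacked_ap _ _ _ _ _ (f12 n (n - 2 - k))) => //; try by move: n10 hk hk1; clear; lia.
  - rewrite mem_cat !inE base_in ?orbT //; move: n10 hk1; clear; lia.
  - by rewrite !in_ap; move: n10 hk1; clear; lia.
have e : fnew n P k.+2 = ap (k.+2%:Z + 1 - n%:Z) (k.+2%:Z - n%:Z)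
    (pair_lo n (cur P k.+1)) (pair_hi n (cur P k.+1)).
  by rewrite /fnew /= (negPf nPk).
(* The first member of the row is glued to [fmid], the later ones to their predecessor. *)
rewrite e; case: (posnP k) => k0.
  have -> : cur P k.+1 = None.
    by rewrite k0 /=; case: ifP => // /adm; clear; lia.
  apply: (@stacked_ap _ _ _ _ _ (fmid n)); rewrite /= ?k0; try by move: n10; clear; lia.
  - by rewrite k0 in sk.
  - by rewrite !inE eqxx ?orbT.
  - by rewrite !in_ap; clear; lia.
  by move=> s sF; have := new s; rewrite k0 => /(_ sF).
have c0 c : cur P k.+1 = Some c -> (3 <= c <= n - 6)%N && (c <= k)%N.
  by case: curP => // c' ck Pc _ [<-]; rewrite adm //=.
apply: (@stacked_ap _ _ _ _ _ (fnew n P k.+1)) => //;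
  try by case ec: (cur P k.+1) => [c|] /=; try (have := c0 _ ec); move: n10 hk; clear; lia.
- rewrite mem_cat; apply/orP; left; apply/descP; exists k => //.
  by rewrite leqnn k0.
- rewrite /fnew !in_ap !eqxx ?orbT /= (_ : k.+2%:Z - n%:Z = k.+1%:Z + 1 - n%:Z) ?eqxx //.
  by clear; lia.
Qed.

End FacetsI.

(** * B(I) as a ball in Delta^3_n *)

Section BallI.
Variable R : realType.
Implicit Types (n m k c i j : nat) (s t : {fset int}) (P : pred nat).

Lemma facetsB_level k s : s \in facetsB k ->
  ((k%:Z - 1 \in s) || (1 - k%:Z \in s)) && ((k%:Z \in s) || (- k%:Z \in s)).
Proof.
by move=> /mem_facetsB[[m hm ->]|[m hm ->]|[]->]; rewrite !in_ap; clear; lia.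
Qed.

Lemma D_keep n s : (4 <= n)%N -> s \in D n -> s \notin facetsB n ->
  oppf s \notin facetsB n -> s \in D n.+1.
Proof.
move=> n4 sD s1 s2; have [hD hB] := D_sphere_ball R n4.
by rewrite D_step //; apply/(replace2P _ hD hB); left.
Qed.

(** A facet removed at a stage n > k contains n or -n, whereas the vertices of [s] lie in [V k].
    Only stage k itself could remove [s]. *)
Lemma D_permanent k n s : (4 <= k <= n)%N -> s \in D k -> s \notin facetsB k ->
  oppf s \notin facetsB k -> s \in D n.
Proof.
case/andP => k4 kn sD s1 s2; have [hD hB] := D_sphere_ball R k4.
have sV := fsubsetP (cs_sub hD sD).
have := kn; rewrite leq_eqVlt => /predU1P[<- //|]; elim: n {kn} => // n IH.
rewrite ltnS leq_eqVlt => /predU1P[<-|kn]; first exact: D_keep.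
have no u : u \in facetsB n -> (n%:Z \notin s) && (- n%:Z \notin s) by
  move=> _; apply/andP; split; apply/negP => /sV; rewrite mem_V; move: kn; clear; lia.
apply: D_keep; first by apply: leq_trans (ltnW kn).
- exact: IH.
- apply/negP => sB; have := facetsB_level sB; have := no _ sB.
  by case/andP => /negPf-> /negPf->; rewrite andbF.
apply/negP => sB; have := facetsB_level sB; have := no _ sB; rewrite !mem_oppf opprK.
by case/andP => /negPf-> /negPf->; rewrite andbF.
Qed.

Local Ltac uniqueB := move=> ? /mem_facetsB[[? ? ->]|[? ? ->]|[]->];
  rewrite !in_ap; case/or4P=> /eqP ?; try (by exfalso; lia);
  case/or4P=> /eqP ?; try (by exfalso; lia); case/or4P=> /eqP ?;
  first [ by exfalso; lia
        | lazymatch goal with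
          | |- fneg _ ?a = fneg _ ?b => by have -> : a = b by lia
          | |- fpos _ ?a = fpos _ ?b => by have -> : a = b by lia
          | |- ?x = ?x => reflexivity
          end ].

(** Boundary triangles containing m-1 instead of m. Their cones with apex m+1 have no vertex of
    absolute value m, so they avoid the next ball and stay for good. *)
Lemma bd_neg1 m j : (4 <= m)%N -> (1 <= j <= m - 3)%N ->
  bd (facetsB m) (tri (- j.+1%:Z) (- j%:Z) (m%:Z - 1)).
Proof.
move=> m4 hj; apply: (@bd_tri _ _ _ _ (fneg m j)); try by move: m4 hj; clear; lia.
- exact: facetsB_fneg.
- by rewrite !in_ap; clear; lia.
uniqueB.
Qed.

Lemma bd_pos1 m j : (4 <= m)%N -> (1 <= j <= m - 3)%N ->
  bd (facetsB m) (tri j.+1%:Z j%:Z (m%:Z - 1)).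
Proof.
move=> m4 hj; apply: (@bd_tri _ _ _ _ (fpos m j)); try by move: m4 hj; clear; lia.
- exact: facetsB_fpos.
- by rewrite !in_ap; clear; lia.
uniqueB.
Qed.

Lemma bd_mid1 m : (4 <= m)%N -> bd (facetsB m) (tri 1 (2 - m%:Z) (m%:Z - 1)).
Proof.
move=> m4; apply: (@bd_tri _ _ _ _ (fmid m)); try by move: m4; clear; lia.
- exact: facetsB_fmid.
- by rewrite !in_ap; clear; lia.
uniqueB.
Qed.

Lemma D_new k n t (x a b c : int) : (5 <= k <= n)%N -> bd (facetsB k.-1) t ->
  ap x a b c =i k%:Z |` t -> k%:Z - 1 \notin ap x a b c -> 1 - k%:Z \notin ap x a b c ->
  ap x a b c \in D n.
Proof.
case/andP => k5 kn bt e n1 n2; have k4 : (4 <= k.-1)%N by move: k5; clear; lia.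
have ek : k.-1.+1 = k by move: k5; clear; lia.
have [hD hB] := D_sphere_ball R k4; have := D_cone hD hB k4 bt; rewrite ek => tD.
apply: (@D_permanent k); first by rewrite kn ltnW.
- by rewrite (_ : ap x a b c = k%:Z |` t) //; apply/fsetP.
- by apply/negP => /facetsB_level; rewrite (negPf n1) (negPf n2).
apply/negP => /facetsB_level; rewrite !mem_oppf !opprB.
by rewrite (negPf n1) (negPf n2).
Qed.

Lemma D_neg k n j : (5 <= k <= n)%N -> (1 <= j <= k - 4)%N ->
  ap (- j.+1%:Z) (- j%:Z) (k%:Z - 2) k%:Z \in D n.
Proof.
move=> hk hj; apply: (@D_new k _ _ _ _ _ _ hk (@bd_neg1 k.-1 j _ _)).
- by move: hk; clear; lia.
- by move: hj hk; clear; lia.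
- by move=> x; rewrite in_ap inE in_tri inE; move: hk; clear; lia.
- by rewrite in_ap; move: hj hk; clear; lia.
- by rewrite in_ap; move: hj hk; clear; lia.
Qed.

Lemma D_pos k n j : (5 <= k <= n)%N -> (1 <= j <= k - 4)%N ->
  ap j.+1%:Z j%:Z (k%:Z - 2) k%:Z \in D n.
Proof.
move=> hk hj; apply: (@D_new k _ _ _ _ _ _ hk (@bd_pos1 k.-1 j _ _)).
- by move: hk; clear; lia.
- by move: hj hk; clear; lia.
- by move=> x; rewrite in_ap inE in_tri inE; move: hk; clear; lia.
- by rewrite in_ap; move: hj hk; clear; lia.
- by rewrite in_ap; move: hj hk; clear; lia.
Qed.

Lemma D_mid k n : (5 <= k <= n)%N -> ap 1 (3 - k%:Z) (k%:Z - 2) k%:Z \in D n.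
Proof.
move=> hk; apply: (@D_new k _ _ _ _ _ _ hk (@bd_mid1 k.-1 _)).
- by move: hk; clear; lia.
- by move=> x; rewrite in_ap inE in_tri inE; move: hk; clear; lia.
- by rewrite in_ap; move: hk; clear; lia.
- by rewrite in_ap; move: hk; clear; lia.
Qed.

Lemma D_facetsB n s : (4 <= n)%N -> s \in facetsB n -> s \in D n.
Proof. by move=> n4; have [_ hB] := D_sphere_ball R n4; apply: (ball_sub hB). Qed.

Lemma eq_ap (x a b c x' a' b' c' : int) :
  ap x a b c =i ap x' a' b' c' -> ap x a b c = ap x' a' b' c'.
Proof. by move=> e; apply/fsetP. Qed.

Lemma facetsI_sub n P : (10 <= n)%N -> admissible n P -> {subset facetsI n P <= D n}.
Proof.
move=> n10 adm s; have n4 : (4 <= n)%N by apply: leq_trans n10.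
case/(mem_facetsI P s n10) => [[i hi ->]|[m hm ->]|[]->].
- have := @D_pos i.+2 n 1; rewrite /f12.
  rewrite (@eq_ap _ _ _ _ i%:Z 1 2 (i%:Z + 2)).
    by apply; move: hi; clear; lia.
  by move=> x; rewrite !in_ap; clear; lia.
- case: fnewP => [|h|c em Pc|c cm Pc h]; first by move: hm; clear; lia.
  + rewrite (_ : ap _ _ _ _ = fneg n (n - m - 1)).
      by apply/D_facetsB => //; apply: facetsB_fneg; move: hm n10; clear; lia.
    by apply: eq_ap => x; rewrite !in_ap; move: hm n10; clear; lia.
  (* The stage k = n-c+1 is the one at which {k-2, k} is {n-c-1, n-c+1}. *)
  + have := @D_mid (n - c + 1) n; have hc := adm _ Pc.
    rewrite (@eq_ap _ _ _ _ (m%:Z + 1 - n%:Z) 1 (n%:Z - c%:Z - 1) (n%:Z - c%:Z + 1)).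
      by apply; move: hc; clear; lia.
    by move=> x; rewrite !in_ap; move: hc em n10; clear; lia.
  have := @D_neg (n - c + 1) n (n - m - 1); have hc := adm _ Pc.
  rewrite (@eq_ap _ _ _ _ (m%:Z + 1 - n%:Z) (m%:Z - n%:Z) (n%:Z - c%:Z - 1) (n%:Z - c%:Z + 1)).
    by apply; move: hc cm hm; clear; lia.
  by move=> x; rewrite !in_ap; move: hc cm hm n10; clear; lia.
- by apply/D_facetsB => //; apply: facetsB_fmid.
- by apply/D_facetsB => //; apply: facetsB_fend1.
- by apply/D_facetsB => //; apply: facetsB_fend2.
rewrite /f12n (@eq_ap _ _ _ _ 2 1 (n%:Z - 1) n%:Z); last first.
  by move=> x; rewrite !in_ap; clear; lia.
by apply/D_facetsB => //; apply: (@facetsB_fpos n 1); move: n10; clear; lia.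
Qed.

(** In every facet except [fend2] the largest absolute value is attained only by a positive vertex,
    which cannot hold for two antipodal facets. The antipode {-1, n-2, n-1, n} of [fend2] is
    excluded directly. *)
Lemma facetsI_opp n P s : (10 <= n)%N -> admissible n P -> s \in facetsI n P ->
  oppf s \notin facetsI n P.
Proof.
move=> n10 adm sI.
have no s' : s' \in facetsI n P ->
    [&& -1 \in s', n%:Z - 2 \in s', n%:Z - 1 \in s' & n%:Z \in s'] -> False.
  case/(mem_facetsI P s' n10) => [[i hi ->]|[m hm ->]|[]->];
    try by rewrite !in_ap; move: n10; try move: hi; clear; lia.
  case: fnewP => [|h|c em Pc|c cm Pc h]; first by move: hm; clear; lia.
  - by rewrite !in_ap; move: n10 hm; clear; lia.
  - by rewrite !in_ap; have := adm _ Pc; move: n10 hm em; clear; lia.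
  - by rewrite !in_ap; have := adm _ Pc; move: n10 hm cm; clear; lia.
have top s' : s' \in facetsI n P -> s' = fend2 n \/
    exists2 y, y \in s' & forall x, x \in s' -> - y < x <= y.
  case/(mem_facetsI P s' n10) => [[i hi ->]|[m hm ->]|[]->].
  - right; exists (i%:Z + 2); first by rewrite in_ap eqxx !orbT.
    by move=> x; rewrite in_ap; move: hi; clear; lia.
  - case: fnewP => [|h|c em Pc|c cm Pc h]; first by move: hm; clear; lia.
    + right; exists n%:Z; first by rewrite in_ap eqxx !orbT.
      by move=> x; rewrite in_ap; move: n10 hm; clear; lia.
    + right; exists (n%:Z - c%:Z + 1); first by rewrite in_ap eqxx !orbT.
      by move=> x; rewrite in_ap; have := adm _ Pc; move: n10 hm em; clear; lia.
    + right; exists (n%:Z - c%:Z + 1); first by rewrite in_ap eqxx !orbT.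
      by move=> x; rewrite in_ap; have := adm _ Pc; move: n10 hm cm; clear; lia.
  - right; exists n%:Z; first by rewrite in_ap eqxx !orbT.
    by move=> x; rewrite in_ap; move: n10; clear; lia.
  - right; exists n%:Z; first by rewrite in_ap eqxx !orbT.
    by move=> x; rewrite in_ap; move: n10; clear; lia.
  - by left.
  right; exists n%:Z; first by rewrite in_ap eqxx !orbT.
  by move=> x; rewrite in_ap; move: n10; clear; lia.
have e2 : [&& 1 \in fend2 n, 2 - n%:Z \in fend2 n, 1 - n%:Z \in fend2 n & - n%:Z \in fend2 n].
  by rewrite !in_ap; clear; lia.
apply/negP => oI; have [es|[y ys hy]] := top _ sI.
  by apply: (no _ oI); rewrite !mem_oppf es !opprB opprK.
have [es|[z]] := top _ oI; first by apply: (no _ sI); move: e2; rewrite -es !mem_oppf !opprB opprK.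
rewrite mem_oppf => /hy h1 /(_ (- y)); rewrite mem_oppf opprK => /(_ ys).
by move: h1; clear; lia.
Qed.

Lemma facetsI_vert n P a : (10 <= n)%N -> a \in V n -> exists2 s, s \in facetsI n P & a \in s.
Proof.
move=> n10; rewrite mem_V => ha; have mI s := mem_facetsI P s n10.
have [h|h1] := boolP ((- (n%:Z - 3) <= a) && (a < 0)).
  exists (fnew n P (n - 1 - `|a|)%N); last by rewrite in_ap; move: n10 h; clear; lia.
  by apply/mI; constructor 2; exists (n - 1 - `|a|)%N => //; move: h n10; clear; lia.
have [h|h2] := boolP ((3 <= a) && (a <= n%:Z - 2)).
  exists (f12 n `|a|%N); last by rewrite in_ap; move: h; clear; lia.
  by apply/mI; constructor 1; exists `|a|%N => //; move: h; clear; lia.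
have [h|h3] := boolP (0 < a).
  exists (f12n n); last by rewrite in_ap; move: ha h h2 n10; clear; lia.
  by apply/mI; constructor 3; constructor 4.
exists (fend2 n); last by rewrite in_ap; move: ha h1 h3 n10; clear; lia.
by apply/mI; constructor 3; constructor 3.
Qed.

Lemma cs_ball_facetsI n P : (10 <= n)%N -> admissible n P -> cs_ball (D n) (facetsI n P) n.
Proof.
move=> n10 adm; split.
- exact: stacked_facetsI.
- exact: facetsI_sub.
- by move=> s; apply: facetsI_opp.
- by move=> a; apply: facetsI_vert.
Qed.

Lemma index_setsP n I : I \in index_sets n -> sorted ltn I /\ admissible n (mem I).
Proof. by case/and3P => sI /allP aI _; split=> // i iI; apply: aI. Qed.

(** Since the list is sorted, no index lies strictly between two consecutive ones. Hence i_j is the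
    last index below [m] for all [m] from i_j + 1 to i_{j+1}, with n-2 closing the last range. *)
Lemma BI_facetsE n I : (10 <= n)%N -> I \in index_sets n ->
  BI_facets n I =i facetsI n (mem I).
Proof.
move=> n10 /index_setsP[sI adm] s.
have adm' i : i \in I -> (3 <= i <= n - 6)%N := adm i.
have idxE k : (k < size I)%N -> idx n I k = nth 0%N I k.
  by move=> hk; apply: set_nth_default.
have idx_in k : (k < size I)%N -> idx n I k \in I by apply: mem_nth.
have idx_lt k i : (k < size I)%N -> i \in I -> (i <= idx n I k)%N || (idx n I k.+1 <= i)%N.
  move=> hk iI; rewrite -(nth_index 0%N iI); set j := index i I.
  have hj : (j < size I)%N by rewrite index_mem.
  have mono (p q : nat) : (p <= q)%N -> (q < size I)%N -> (nth 0 I p <= nth 0 I q)%N.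
    move=> pq qI; move: sI; rewrite ltn_sorted_uniq_leq => /andP[_ lI].
    by apply: (sorted_leq_nth leq_trans leqnn) => //; rewrite inE // (leq_ltn_trans pq).
  have [jk|kj] := leqP j k; first by rewrite idxE // mono.
  by rewrite (idxE k.+1) ?mono ?orbT // (leq_ltn_trans kj).
have idx_top k : (idx n I k <= n - 2)%N.
  rewrite /idx; have [h|h] := ltnP k (size I); last by rewrite nth_default.
  case/andP: (adm' _ (mem_nth (n - 2)%N h)) => _ /leq_trans; apply.
  by move: n10; clear; lia.
have curI k m : (k < size I)%N -> (idx n I k < m <= idx n I k.+1)%N ->
    cur (mem I) m = Some (idx n I k).
  move=> hk hm; have kI := idx_in _ hk; case: curP => [/(_ (idx n I k))|c cm cI h].
    by rewrite /= kI; case/andP: hm => -> _ /(_ isT).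
  have c_le : (c <= idx n I k)%N by have := idx_lt _ _ hk cI; move: cm hm; clear; lia.
  congr Some; apply/eqP; rewrite eqn_leq c_le leqNgt; apply/negP => c_lt.
  by have := h (idx n I k); rewrite /= kI c_lt; case/andP: hm => -> _ /(_ isT).
have cur0 m : (m <= idx n I 0)%N -> cur (mem I) m = None.
  move=> hm; case: curP => // c cm /= cI _; move: hm; rewrite /idx.
  case: I cI sI {adm adm' idxE idx_in idx_lt idx_top curI} => // i0 I' cI /= sI.
  move: cI; rewrite inE => /predU1P[ec|cI]; first by move: cm; rewrite ec; clear; lia.
  by have /allP/(_ _ cI) := order_path_min ltn_trans sI; move: cm; clear; lia.
have pred_in k m : (k < size I)%N -> (idx n I k + 2 <= m <= idx n I k.+1)%N ->
    (m.-1 \in I) = false.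
  move=> hk hm; apply/negbTE/negP => mI; have := idx_lt _ _ hk mI.
  by move: hm; clear; lia.
have mI := mem_facetsI (mem I) s n10.
apply/idP/idP => [sB|/mI h].
  apply/mI; move: sB; rewrite /BI_facets 3!mem_cat.
  case/or4P => [/mapP[i]|sl|/mapP[m]|/flattenP[u /mapP[k]]].
  - rewrite mem_index_iota => hi ->; constructor 1; exists i.
      by move: hi n10; clear; lia.
    by apply/fsetP => x; rewrite in_ap !inE; clear; lia.
  - constructor 3; move: sl; rewrite !inE => /or4P[] /eqP ->.
    + by constructor 4; apply/fsetP => x; rewrite in_ap !inE; clear; lia.
    + by constructor 1; apply/fsetP => x; rewrite in_ap !inE; clear; lia.
    + by constructor 2; apply/fsetP => x; rewrite in_ap !inE; clear; lia.
    + by constructor 3; apply/fsetP => x; rewrite in_ap !inE; clear; lia.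
  - rewrite mem_index_iota => hm ->; constructor 2; exists m.
      by have := idx_top 0%N; move: hm; clear; lia.
    have e0 : cur (mem I) m = None by apply: cur0; move: hm; clear; lia.
    have -> : fnew n (mem I) m = ap (m%:Z + 1 - n%:Z) (m%:Z - n%:Z) (n%:Z - 1) n%:Z.
      rewrite /fnew e0; case: ifP => // mI'; move: e0.
      rewrite -(prednK (_ : 0 < m)%N) /=; last by move: hm; clear; lia.
      by case: ifP => // /negP[].
    by apply/fsetP => x; rewrite in_ap !inE; clear; lia.
  rewrite mem_iota => hk ->; rewrite inE => /predU1P[->|/mapP[m]].
    have hk' : (k < size I)%N by move: hk; clear; lia.
    have kI := idx_in _ hk'; have hi := adm' _ kI.
    constructor 2; exists (idx n I k).+1; first by move: hi n10; clear; lia.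
    by rewrite /fnew /= kI /=; apply/fsetP => x; rewrite in_ap !inE; clear; lia.
  rewrite mem_index_iota => hm ->; have hk' : (k < size I)%N by move: hk; clear; lia.
  have kI := idx_in _ hk'; have hi := adm' _ kI.
  constructor 2; exists m; first by have := idx_top k.+1; move: hm; clear; lia.
  have e1 : (m.-1 \in I) = false by apply: (@pred_in k) => //; move: hm; clear; lia.
  have e2 : cur (mem I) m = Some (idx n I k) by apply: curI => //; move: hm; clear; lia.
  rewrite /fnew e2 ifF // /pair_lo /pair_hi.
  by apply/fsetP => x; rewrite in_ap !inE; clear; lia.
rewrite /BI_facets 3!mem_cat; apply/or4P; case: h => [[i hi ->]|[m hm ->]|h].
- constructor 1; apply/mapP; exists i; first by rewrite mem_index_iota; move: hi n10; clear; lia.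
  by apply/fsetP => x; rewrite in_ap !inE; clear; lia.
- case: fnewP => [|h|c em /= cI|c cm /= cI h]; first by move: hm; clear; lia.
  + constructor 3; apply/mapP; exists m.
      rewrite mem_index_iota ltnS; case/andP: hm => -> hm /=.
      rewrite /idx.
      case: I h {sI adm adm' idxE idx_in idx_lt idx_top curI cur0 pred_in mI} => //= i0 I'.
      by move=> h; rewrite leqNgt; apply/negP => /h /=; rewrite inE eqxx.
    by apply/fsetP => x; rewrite in_ap !inE; clear; lia.
  + constructor 4; apply/flattenP; eexists.
      by apply/mapP; exists (index c I); [rewrite mem_iota index_mem cI | reflexivity].
    have e : idx n I (index c I) = c by rewrite /idx nth_index.
    rewrite inE e; apply/orP; left; apply/eqP.
    by apply/fsetP => x; rewrite in_ap !inE em; clear; lia.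
  constructor 4; apply/flattenP; eexists.
    by apply/mapP; exists (index c I); [rewrite mem_iota index_mem cI | reflexivity].
  have e : idx n I (index c I) = c by rewrite /idx nth_index.
  rewrite inE e; apply/orP; right; apply/mapP; exists m.
    rewrite mem_index_iota ltnS; apply/andP; split; first by move: cm; clear; lia.
    change (m <= idx n I (index c I).+1)%N.
    have [hs|hs] := ltnP (index c I).+1 (size I); last first.
      have -> : idx n I (index c I).+1 = (n - 2)%N by apply: nth_default.
      by move: hm; clear; lia.
    have nI := idx_in _ hs; rewrite leqNgt; apply/negP => hlt.
    have := h (idx n I (index c I).+1); rewrite /= nI hlt andbT => /(_ _).
    have : (c < idx n I (index c I).+1)%N.
      rewrite -{1}e !idxE ?index_mem //.
      by apply: (sorted_ltn_nth ltn_trans) => //; rewrite inE ?index_mem.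
    by move=> -> /(_ isT).
  by apply/fsetP => x; rewrite in_ap !inE; clear; lia.
constructor 2; rewrite !inE; apply/or4P; case: h => ->.
- by constructor 2; apply/eqP/fsetP => x; rewrite in_ap !inE; clear; lia.
- by constructor 3; apply/eqP/fsetP => x; rewrite in_ap !inE; clear; lia.
- by constructor 4; apply/eqP/fsetP => x; rewrite in_ap !inE; clear; lia.
- by constructor 1; apply/eqP/fsetP => x; rewrite in_ap !inE; clear; lia.
Qed.

End BallI.

(** * Missing triangles *)

Section Nonfaces.
Variable R : realType.
Implicit Types (n m k i j : nat) (s t u : {fset int}) (F : cplx int) (Fs : seq {fset int}).

Lemma generated_opp F k t : cs_sphere R F k -> (oppf t \in generated F) = (t \in generated F).
Proof.
move=> hF; apply/generatedP/generatedP => -[s sF ts].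
  by exists (oppf s); [apply: (cs_opp hF)|rewrite -oppfSl].
by exists (oppf s); [apply: (cs_opp hF)|rewrite oppfS].
Qed.

Lemma replace2_new F Fs k t : cs_sphere R F k -> cs_ball F Fs k ->
  t \in generated (replace2 F Fs k.+1%:Z) -> k.+1%:Z \in t ->
  exists2 u, u \in Fs & t `\ k.+1%:Z `<=` u.
Proof.
move=> hF hB /generatedP[s sG ts] kt; have ks := fsubsetP ts _ kt.
case/(replace2P _ hF hB): sG => [[/(cs_sub hF)/notin_V[]]|[t' /bdP[_ [u [uF tu _]]]]].
  by rewrite ks.
case=> es; first by exists u => //; apply: fsubset_trans tu; rewrite fsubDset -es.
have := fsubset_trans tu (cs_sub hF (ball_sub hB uF)); move/notin_V => [_ nk].
by move: ks; rewrite es mem_oppf !inE (negPf nk) orbF; clear; lia.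
Qed.

(** A new facet meets the old vertices in a boundary triangle of the ball or of its antipode, which
    was a face before. Hence missing triangles remain missing. *)
Lemma replace2_old F Fs k t : cs_sphere R F k -> cs_ball F Fs k -> t `<=` V k ->
  t \in generated (replace2 F Fs k.+1%:Z) -> t \in generated F.
Proof.
move=> hF hB /notin_V[k1 k2] /generatedP[s sG ts]; apply/generatedP.
case/(replace2P _ hF hB): sG => [[sF _ _]|[t' /bdP[_ [u [uF tu _]]]]]; first by exists s.
case=> es.
  exists u; first exact: (ball_sub hB).
  apply: fsubset_trans tu; apply/fsubsetP => x xt; have := fsubsetP ts _ xt.
  by rewrite es !inE => /predU1P[ex|//]; rewrite -ex xt in k1.
exists (oppf u); first exact/(cs_opp hF)/(ball_sub hB).
apply/fsubsetP => x xt; have := fsubsetP ts _ xt.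
rewrite es !mem_oppf !inE => /predU1P[ex|]; last exact: (fsubsetP tu).
by move: k2; rewrite -ex opprK xt.
Qed.

(** The two facets of the ball are the only facets over [t] in [F], and both are removed. The
    triangle is not in the boundary of the ball; in that of its antipode it would force a facet
    common to both balls. *)
Lemma replace2_interior F Fs k t s1 s2 : cs_sphere R F k -> cs_ball F Fs k ->
  #|` t| = 3 -> s1 \in Fs -> s2 \in Fs -> s1 <> s2 -> t `<=` s1 -> t `<=` s2 ->
  t \notin generated (replace2 F Fs k.+1%:Z).
Proof.
move=> hF hB t3 s1F s2F s12 ts1 ts2; have tV := fsubset_trans ts1 (cs_sub hF (ball_sub hB s1F)).
have [k1 k2] := notin_V tV.
have only s : s \in F -> t `<=` s -> s \in Fs.
  move=> sF ts; have [//|<-|<-//] :=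
    cs_pseudo hF t3 (ball_sub hB s1F) (ball_sub hB s2F) sF ts1 ts2 ts; by [].
apply/negP => /generatedP[s sG ts].
case/(replace2P _ hF hB): sG => [[/only/(_ ts)-> //]|[t' bt]].
case=> es.
  have tt' : t = t'.
    apply: eq_of_card; last by rewrite t3 (bd_card bt).
    apply/fsubsetP => x xt; have := fsubsetP ts _ xt.
    by rewrite es !inE => /predU1P[ex|//]; rewrite -ex xt in k1.
  case/bdP: bt => _ [s' [_ _ h]]; apply: s12.
  by rewrite (h s1) -?tt' // (h s2) -?tt'.
have tt' : oppf t = t'.
  apply: eq_of_card; last by rewrite card_oppf t3 (bd_card bt).
  rewrite oppfSl; apply/fsubsetP => x xt; have := fsubsetP ts _ xt.
  rewrite es !mem_oppf !inE => /predU1P[ex|//].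
  by move: k2; rewrite -ex opprK xt.
case/bdP: bt => _ [u [uF tu _]].
have : oppf u \in Fs.
  apply: only; first exact/(cs_opp hF)/(ball_sub hB).
  by rewrite -oppfSl tt'.
by apply/negP; apply: (ball_opp hB).
Qed.

Lemma D_persist k n t : (4 <= k <= n)%N -> t `<=` V k ->
  t \notin generated (D k) -> t \notin generated (D n).
Proof.
case/andP=> k4 + tV nt; elim: n => [|n IH]; first by move: k4; clear; lia.
rewrite leq_eqVlt => /predU1P[<- //|kn].
have n4 : (4 <= n)%N by apply: leq_trans k4 _.
have [hD hB] := D_sphere_ball R n4; rewrite D_step //.
apply: contra (IH kn); apply: (replace2_old hD hB); apply: fsubset_trans tV _.
by apply/fsubsetP => x; rewrite !mem_V; move: kn; clear; lia.
Qed.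

(** When k+1 is added, its link is the boundary of B^{3,1}_k, so two vertices without a common facet
    there cannot span a triangle with k+1. *)
Lemma D_nonadjacent k n (a b : int) : (4 <= k < n)%N -> (0 < `|a| <= k)%N -> (0 < `|b| <= k)%N ->
  (forall u, u \in facetsB k -> a \in u -> b \in u -> False) ->
  tri k.+1%:Z a b \notin generated (D n).
Proof.
case/andP => k4 kn ha hb h; apply: (@D_persist k.+1); first by rewrite kn leqW.
  by rewrite tri_sub !mem_V; move: ha hb; clear; lia.
have [hD hB] := D_sphere_ball R k4; rewrite D_step //; apply/negP => tG.
have [|u uB tu] := replace2_new hD hB tG; first by rewrite in_tri eqxx.
apply: (h u) => //; apply: (fsubsetP tu); rewrite !inE eqxx ?orbT andbT.
  by move: ha; clear; lia.
by move: hb; clear; lia.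
Qed.

Lemma D_interior k n (a b c : int) s1 s2 : (4 <= k < n)%N ->
  s1 \in facetsB k -> s2 \in facetsB k -> s1 <> s2 -> a != b -> a != c -> b != c ->
  [&& a \in s1, b \in s1 & c \in s1] -> [&& a \in s2, b \in s2 & c \in s2] ->
  tri a b c \notin generated (D n).
Proof.
case/andP=> k4 kn s1B s2B s12 ab ac bc h1 h2.
have ts1 : tri a b c `<=` s1 by rewrite tri_sub.
apply: (@D_persist k.+1); first by rewrite kn leqW.
  apply: fsubset_trans ts1 (fsubset_trans (facetsB_sub k4 s1B) _).
  by apply/fsubsetP => x; rewrite !mem_V; clear; lia.
have [hD hB] := D_sphere_ball R k4; rewrite D_step //.
by apply: (replace2_interior hD hB _ s1B s2B s12 ts1); rewrite ?card_tri ?tri_sub.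
Qed.

End Nonfaces.

Section DeltaI.
Variables (R : realType) (n : nat) (P : pred nat).
Hypotheses (n10 : (10 <= n)%N) (adm : admissible n P).
Implicit Types (a b c x y : int) (s t u : {fset int}).

Definition facetsDI : cplx int := replace2 (D n) (facetsI n P) n.+1%:Z.

Let n4 : (4 <= n)%N. Proof. exact: leq_trans n10. Qed.
Let hD : cs_sphere R (D n) n. Proof. by case: (D_sphere_ball R n4). Qed.
Let hB : cs_ball (D n) (facetsI n P) n. Proof. exact: cs_ball_facetsI. Qed.

Lemma cs_sphere_DI : cs_sphere R facetsDI n.+1.
Proof. exact: cs_sphere_replace2. Qed.

(** The facets of B(I) with their index ranges spelled out, so that a case analysis leaves goals for
    [lia]. *)
Variant facetI_spec : {fset int} -> Prop :=
| FI12 i of (3 <= i <= n - 2)%N : facetI_spec (ap i%:Z 1 2 (i%:Z + 2))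
| FITop m of (2 <= m <= n - 2)%N & (forall i, (i < m)%N -> ~~ P i) :
    facetI_spec (ap (m%:Z + 1 - n%:Z) (m%:Z - n%:Z) (n%:Z - 1) n%:Z)
| FIStart (c : nat) of (3 <= c <= n - 6)%N & P c :
    facetI_spec (ap (c%:Z + 2 - n%:Z) 1 (n%:Z - c%:Z - 1) (n%:Z - c%:Z + 1))
| FINext (c m : nat) of (3 <= c <= n - 6)%N & (c + 2 <= m <= n - 2)%N & P c
    & (forall i, (c < i < m)%N -> ~~ P i) :
    facetI_spec (ap (m%:Z + 1 - n%:Z) (m%:Z - n%:Z) (n%:Z - c%:Z - 1) (n%:Z - c%:Z + 1))
| FIMid : facetI_spec (fmid n)
| FIEnd1 : facetI_spec (fend1 n)
| FIEnd2 : facetI_spec (fend2 n)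
| FI12n : facetI_spec (f12n n).

Lemma facetsIP s : s \in facetsI n P -> facetI_spec s.
Proof.
case/(mem_facetsI P s n10) => [[i hi ->]|[m hm ->]|[]->];
  [exact: FI12 | | exact: FIMid | exact: FIEnd1 | exact: FIEnd2 | exact: FI12n].
case: fnewP => [|h|c em Pc|c cm Pc h]; first by case/andP: hm.
- exact: FITop.
- have -> : m%:Z + 1 - n%:Z = c%:Z + 2 - n%:Z by rewrite em; clear; lia.
  by apply: FIStart => //; apply: adm.
by apply: FINext => //; [apply: adm | move: cm hm; clear; lia].
Qed.

Local Ltac caseI := case/facetsIP => [??|???|???|??????||||]; rewrite !in_ap; lia.

Lemma facetsI_12 i : (3 <= i <= n - 2)%N -> ap i%:Z 1 2 (i%:Z + 2) \in facetsI n P.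
Proof. by move=> hi; apply/(mem_facetsI P _ n10); constructor 1; exists i. Qed.
Lemma facetsI_12n : f12n n \in facetsI n P.
Proof. by apply/(mem_facetsI P _ n10); constructor 3; constructor 4. Qed.
Lemma facetsI_mid : fmid n \in facetsI n P.
Proof. by apply/(mem_facetsI P _ n10); constructor 3; constructor 1. Qed.
Lemma facetsI_end2 : fend2 n \in facetsI n P.
Proof. by apply/(mem_facetsI P _ n10); constructor 3; constructor 3. Qed.
Lemma facetsI_new m : (2 <= m <= n - 2)%N -> fnew n P m \in facetsI n P.
Proof. by move=> hm; apply/(mem_facetsI P _ n10); constructor 2; exists m. Qed.

Lemma DI_nonadjacent a b : (0 < `|a| <= n)%N -> (0 < `|b| <= n)%N ->
  (forall u, u \in facetsI n P -> [&& a \in u & b \in u] -> False) ->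
  tri n.+1%:Z a b \notin generated facetsDI.
Proof.
move=> ha hb h; apply/negP => tG.
have [|u uB tu] := replace2_new hD hB tG; first by rewrite in_tri eqxx.
apply: (h u) => //; apply/andP; split; apply: (fsubsetP tu); rewrite !inE eqxx ?orbT andbT.
  by move: ha; clear; lia.
by move: hb; clear; lia.
Qed.

Lemma DI_old a b c : (0 < `|a| <= n)%N -> (0 < `|b| <= n)%N -> (0 < `|c| <= n)%N ->
  tri a b c \notin generated (D n) -> tri a b c \notin generated facetsDI.
Proof.
move=> ha hb hc; apply: contra; apply: (replace2_old hD hB).
by rewrite tri_sub !mem_V ha hb hc.
Qed.

Lemma DI_interior a b c s1 s2 : s1 \in facetsI n P -> s2 \in facetsI n P -> s1 <> s2 ->
  a != b -> a != c -> b != c ->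
  [&& a \in s1, b \in s1 & c \in s1] -> [&& a \in s2, b \in s2 & c \in s2] ->
  tri a b c \notin generated facetsDI.
Proof.
move=> s1B s2B s12 ab ac bc h1 h2.
apply: (replace2_interior hD hB _ s1B s2B s12); rewrite ?card_tri ?tri_sub //.
Qed.

Lemma DI_opp t : (oppf t \in generated facetsDI) = (t \in generated facetsDI).
Proof. exact: generated_opp cs_sphere_DI. Qed.

Definition missing a b c : Prop :=
  [/\ (0 < `|c| <= n.+1)%N, `|c|%N != `|a|%N, `|c|%N != `|b|%N &
      tri a b c \notin generated facetsDI].

Lemma triC a b c : tri a b c = tri b a c.
Proof. by apply/fsetP => x; rewrite !in_tri orbCA. Qed.

Lemma oppf_tri a b c : oppf (tri a b c) = tri (- a) (- b) (- c).
Proof. by rewrite /tri !oppfU !oppf1. Qed.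

Lemma tri_rot a b c : tri a b c = tri b c a.
Proof. by apply/fsetP => x; rewrite !in_tri orbC -orbA. Qed.

Lemma missingC a b c : missing a b c -> missing b a c.
Proof. by case=> *; split=> //; rewrite triC. Qed.

Lemma missingN a b c : missing (- a) (- b) (- c) -> missing a b c.
Proof.
case=> h1 h2 h3 h4; split; try by move: h1 h2 h3; clear; lia.
by rewrite -DI_opp oppf_tri.
Qed.

Definition misses_two a b : Prop :=
  exists c c', [/\ c != c', missing a b c & missing a b c'].

Lemma misses_twoC a b : misses_two a b -> misses_two b a.
Proof. by case=> c [c' [cc' /missingC h /missingC h']]; exists c, c'. Qed.

Lemma misses_twoN a b : misses_two (- a) (- b) -> misses_two a b.
Proof.
case=> c [c' [cc' h h']]; exists (- c), (- c'); split.
- by rewrite eqr_opp.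
- by apply: missingN; rewrite opprK.
- by apply: missingN; rewrite opprK.
Qed.

(** Within a facet of B(I), negative vertices differ by at most 2, and so do positive ones other
    than 1 and 2. Thus two distant vertices of the sign of [a] serve. For 1 and 2 the choice 3-n,
    4-n works because indices are at least 3. *)
Lemma misses_apex a : (0 < `|a| <= n)%N -> misses_two a n.+1%:Z.
Proof.
move=> ha.
have miss y : (0 < `|y| <= n)%N -> `|y|%N != `|a|%N ->
    (forall u, u \in facetsI n P -> [&& a \in u & y \in u] -> False) ->
    missing a n.+1%:Z y.
  move=> hy ya h; split=> //; try by move: hy; clear; lia.
  by rewrite triC; apply: DI_nonadjacent.
have [a12|a12] := boolP ((a == 1) || (a == 2)).
  exists (3 - n%:Z), (4 - n%:Z); split; first by clear; lia.
    by apply: miss; [move: n10; clear; lia| move: n10 a12; clear; lia| move=> u; caseI].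
  by apply: miss; [move: n10; clear; lia| move: n10 a12; clear; lia| move=> u; caseI].
have [a6|a6] := boolP ((0 < a) && (a <= 6)).
  exists 9, 10; split=> //.
    by apply: miss; [move: n10; clear; lia| move: n10 a6; clear; lia| move=> u; caseI].
  by apply: miss; [move: n10; clear; lia| move: n10 a6; clear; lia| move=> u; caseI].
have [a7|a7] := boolP (0 < a).
  exists 3, 4; split=> //.
    by apply: miss; [move: n10; clear; lia| move: n10 a6 a7; clear; lia| move=> u; caseI].
  by apply: miss; [move: n10; clear; lia| move: n10 a6 a7; clear; lia| move=> u; caseI].
have [a8|a8] := boolP (-6 <= a).
  exists (-9), (-10); split=> //.
    by apply: miss; [move: n10; clear; lia| move: n10 a8 a7; clear; lia| move=> u; caseI].
  by apply: miss; [move: n10; clear; lia| move: n10 a8 a7; clear; lia| move=> u; caseI].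
exists (-3), (-4); split=> //.
  by apply: miss; [move: n10; clear; lia| move: n10 a8 a7; clear; lia| move=> u; caseI].
by apply: miss; [move: n10; clear; lia| move: n10 a8 a7; clear; lia| move=> u; caseI].
Qed.

Local Ltac caseB := move=> ? /mem_facetsB[[? ? ->]|[? ? ->]|[]->]; rewrite !in_ap; lia.

Let missing_D a b c : (0 < `|a| <= n)%N -> (0 < `|b| <= n)%N -> (0 < `|c| <= n)%N ->
  `|c|%N != `|a|%N -> `|c|%N != `|b|%N -> tri a b c \notin generated (D n) -> missing a b c.
Proof.
move=> ha hb hc ca cb nt; split=> //; first by move: hc; clear; lia.
exact: DI_old.
Qed.

Let missing_nonadjacent (k : nat) a b : (4 <= k < n)%N ->
  (0 < `|a| <= k)%N -> (0 < `|b| <= k)%N -> `|b|%N != `|a|%N ->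
  (forall u, u \in facetsB k -> a \in u -> b \in u -> False) ->
  missing a k.+1%:Z b.
Proof.
move=> hk ha hb ab h; apply: missing_D; try by move: hk ha hb ab; clear; lia.
by rewrite triC; apply: (D_nonadjacent R hk ha hb).
Qed.

(** The triangles {1, k-1, k} and {2-k, k-1, k} are those in which [fmid] meets its two neighbours
    along the path, so they are interior. For k = n the same happens in B(I). *)
Lemma misses_consecutive (k : nat) : (4 <= k <= n)%N -> misses_two (k%:Z - 1) k%:Z.
Proof.
move=> hk; have [kn|kn] := ltnP k n.
  have hk' : (4 <= k < n)%N by move: hk kn; clear; lia.
  exists 1, (2 - k%:Z); split; first by move: hk; clear; lia.
    apply: missing_D; try by move: hk n10; clear; lia.
    apply: (D_interior R hk' (facetsB_fmid k) (@facetsB_fpos k 1 _));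
      rewrite ?in_ap; try by move: hk; clear; lia.
    move/fsetP/(_ (2 - k%:Z)); rewrite !in_ap; move: hk; clear; lia.
  apply: missing_D; try by move: hk n10; clear; lia.
  apply: (D_interior R hk' (facetsB_fmid k) (@facetsB_fneg k (k - 3) _));
    rewrite ?in_ap; try by move: hk; clear; lia.
  move/fsetP/(_ 1); rewrite !in_ap; move: hk; clear; lia.
have -> : k = n by move: hk kn; clear; lia.
exists 1, (2 - n%:Z); split; first by move: n10; clear; lia.
  split; try by move: n10; clear; lia.
  apply: (@DI_interior _ _ _ _ _ facetsI_12n facetsI_mid); rewrite ?in_ap;
    try by move: n10; clear; lia.
  by move/fsetP/(_ 2); rewrite !in_ap; move: n10; clear; lia.
split; try by move: n10; clear; lia.
have e : fnew n P 2 = ap (2%:Z + 1 - n%:Z) (2%:Z - n%:Z) (n%:Z - 1) n%:Z.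
  have nP i : (i < 3)%N -> P i = false.
    by move=> hi; apply/negP => /adm; move: hi; clear; lia.
  by rewrite /fnew /= !nP.
apply: (@DI_interior _ _ _ _ _ facetsI_mid (@facetsI_new 2 _)); rewrite ?e ?in_ap;
  try by move: n10; clear; lia.
by move/fsetP/(_ 1); rewrite !in_ap; move: n10; clear; lia.
Qed.

Lemma misses_12 : misses_two 1 2.
Proof.
exists 5, 6; split=> //.
  split; try by move: n10; clear; lia.
  apply: (@DI_interior _ _ _ _ _ (@facetsI_12 3 _) (@facetsI_12 5 _)); rewrite ?in_ap //;
    try by move: n10; clear; lia.
  by move/fsetP/(_ 3); rewrite !in_ap.
split; try by move: n10; clear; lia.
apply: (@DI_interior _ _ _ _ _ (@facetsI_12 4 _) (@facetsI_12 6 _)); rewrite ?in_ap //;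
  try by move: n10; clear; lia.
by move/fsetP/(_ 4); rewrite !in_ap.
Qed.

Lemma missing_gap2 (k : nat) : (5 <= k <= n)%N -> missing (k%:Z - 2) k%:Z (1 - k%:Z).
Proof.
case/andP=> k5 kn; have -> : k%:Z = k.-1.+1%:Z by move: k5; clear; lia.
apply: missing_nonadjacent; try by move: k5 kn; clear; lia.
caseB.
Qed.

Lemma misses_gap2 (k : nat) : (7 <= k < n)%N -> misses_two (k%:Z - 2) k%:Z.
Proof.
move=> hk; have h1 : missing (k%:Z - 2) k%:Z (1 - k%:Z).
  by apply: missing_gap2; move: hk; clear; lia.
have [kn|kn] := ltnP k.+1 n.
  exists (1 - k%:Z), (k%:Z + 1); split=> //; first by move: hk; clear; lia.
  apply: missing_D; try by move: hk; clear; lia.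
  have hk' : (4 <= k.+1 < n)%N by rewrite kn; move: hk; clear; lia.
  apply: (D_interior R hk' (@facetsB_fpos k.+1 (k - 2) _) (@facetsB_fpos k.+1 (k - 3) _));
    rewrite ?in_ap; try by move: hk; clear; lia.
  move/fsetP/(_ (k%:Z - 1)); rewrite !in_ap; move: hk; clear; lia.
(* For k = n-1 the second missed vertex is -(n+1), since 3-n and 1-n share no facet of B(I). *)
exists (1 - k%:Z), (- n.+1%:Z); split=> //; first by move: hk; clear; lia.
split; try by move: hk; clear; lia.
rewrite -DI_opp oppf_tri -tri_rot opprK -tri_rot.
rewrite tri_rot; apply: DI_nonadjacent; try by move: hk; clear; lia.
by move=> u; have ek : k = n.-1 by [move: hk kn; clear; lia]; rewrite ek; caseI.
Qed.

(** No facet of B^{3,1}_9 contains [a] and [b], or their antipodes, so both 10 and -10 are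
    missed. *)
Lemma misses_small a b : (`|a| < `|b|)%N -> (0 < b <= 6) -> a != 0 -> a != b - 1 ->
  misses_two a b.
Proof.
move=> ab b6 a0 ab1.
have h u : u \in facetsB 9 -> a \in u -> b \in u -> False.
  by move: u; caseB.
have h' u : u \in facetsB 9 -> - a \in u -> - b \in u -> False.
  by move: u; caseB.
have n9 : (4 <= 9 < n)%N by move: n10; clear; lia.
exists 10, (-10); split=> //.
  apply: missing_D; try by move: n10 ab b6 a0; clear; lia.
  by rewrite -tri_rot; apply: (D_nonadjacent R n9) => //; move: ab b6 a0; clear; lia.
apply: missingN; apply: missing_D; try by move: n10 ab b6 a0; clear; lia.
by rewrite -tri_rot; apply: (D_nonadjacent R n9) => //; move: ab b6 a0; clear; lia.
Qed.

(** Apart from k-2 and k-1, a vertex close to zero shares facets of B^{3,1}_{k-1} only with vertices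
    near it on the path. So two vertices of absolute value at most 4 can be kept away from [a]. *)
Lemma misses_large (k : nat) a : (7 <= k <= n)%N -> (0 < `|a| < k)%N ->
  a != k%:Z - 1 -> a != k%:Z - 2 -> misses_two a k%:Z.
Proof.
move=> hk ha a1 a2; have -> : k%:Z = k.-1.+1%:Z by move: hk; clear; lia.
have miss y : (0 < `|y| <= 4)%N -> `|y|%N != `|a|%N ->
    (forall u, u \in facetsB k.-1 -> a \in u -> y \in u -> False) ->
    missing a k.-1.+1%:Z y.
  by move=> hy ya; apply: missing_nonadjacent => //; move: hk ha hy; clear; lia.
have [a3|a3] := boolP (a == 2).
  by exists (-1), (-3); split=> //; apply: miss;
    [by [] | by move: a3; clear; lia | caseB | by [] | by move: a3; clear; lia | caseB].
have [a4|a4] := boolP (a == 3).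
  by exists (-1), (-2); split=> //; apply: miss;
    [by [] | by move: a4; clear; lia | caseB | by [] | by move: a4; clear; lia | caseB].
have [a5|a5] := boolP (0 < a).
  by exists (-2), (-3); split=> //; apply: miss;
    [by [] | by move: a3 a4 a5; clear; lia | caseB | by [] | by move: a3 a4 a5; clear; lia | caseB].
have [a6|a6] := boolP (a == -2).
  by exists 3, 4; split=> //; apply: miss;
    [by [] | by move: a6; clear; lia | caseB | by [] | by move: a6; clear; lia | caseB].
have [a7|a7] := boolP (a == -3).
  by exists 2, 4; split=> //; apply: miss;
    [by [] | by move: a7; clear; lia | caseB | by [] | by move: a7; clear; lia | caseB].
by exists 2, 3; split=> //; apply: miss;
  [by [] | by move: a5 a6 a7; clear; lia | caseB | by [] | by move: a5 a6 a7; clear; lia | caseB].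
Qed.

Lemma two_missing_or_special a b : (0 < `|a| <= n.+1)%N -> (0 < `|b| <= n.+1)%N ->
  `|a|%N != `|b|%N ->
  misses_two a b \/ [\/ [fset a; b] = [fset 2; 3], [fset a; b] = [fset -2; -3],
    [fset a; b] = [fset n%:Z - 2; n%:Z] | [fset a; b] = [fset 2 - n%:Z; - n%:Z]].
Proof.
have half x y : (0 < `|x| <= n.+1)%N -> (0 < y <= n.+1%:Z) -> (`|x| < `|y|)%N ->
    misses_two x y \/ (x = 2 /\ y = 3) \/ (x = n%:Z - 2 /\ y = n%:Z).
  move=> hx hy xy; have [yn|yn] := boolP (y == n.+1%:Z).
    by left; rewrite (eqP yn); apply: misses_apex; move: hx xy yn; clear; lia.
  have [k ek] : exists k : nat, y = k%:Z by exists `|y|%N; move: hy; clear; lia.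
  rewrite ek in hy xy yn *.
  have kn : (k <= n)%N by move: hy yn; clear; lia.
  have [x1|x1] := boolP (x == k%:Z - 1).
    rewrite (eqP x1); have [k4|k4] := leqP 4 k.
      by left; apply: misses_consecutive; rewrite k4.
    have [->|k2] := eqVneq k 2%N; first by left; apply: misses_12.
    by right; left; move: k4 k2 hx hy x1; clear; lia.
  have [k7|k7] := ltnP k 7.
    by left; apply: misses_small => //; move: k7 hy hx; clear; lia.
  have [x2|x2] := boolP (x == k%:Z - 2).
    rewrite (eqP x2); have [kn'|kn'] := ltnP k n.
      by left; apply: misses_gap2; rewrite k7.
    by right; right; move: kn kn'; clear; lia.
  left; apply: misses_large => //; first by rewrite k7.
  by move: hx xy; clear; lia.
have two (x y z w : int) : x = z -> y = w -> [fset x; y] = [fset z; w] by move=> -> ->.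
move=> ha hb ab.
have full x y : (0 < `|x| <= n.+1)%N -> (0 < `|y| <= n.+1)%N -> (`|x| < `|y|)%N ->
    misses_two x y \/ [\/ [fset x; y] = [fset 2; 3], [fset x; y] = [fset -2; -3],
    [fset x; y] = [fset n%:Z - 2; n%:Z] | [fset x; y] = [fset 2 - n%:Z; - n%:Z]].
  move=> hx hy xy; have [y0|y0] := boolP (0 < y).
    have [|?|[[-> ->]|[-> ->]]] := half x y hx _ xy; first by move: hy y0; clear; lia.
    - by left.
    - by right; constructor 1.
    - by right; constructor 3.
  have [|||/misses_twoN ?|[[h1 h2]|[h1 h2]]] := half (- x) (- y).
  - by move: hx; clear; lia.
  - by move: hy y0; clear; lia.
  - by move: xy; clear; lia.
  - by left.
  - by right; constructor 2; apply: two; [move: h1|move: h2]; clear; lia.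
  - by right; constructor 4; apply: two; [move: h1|move: h2]; clear; lia.
have [h|h] := ltnP `|a|%N `|b|%N; first exact: full.
rewrite [[fset a; b]]fsetUC; have [|/misses_twoC ?|h'] := full b a hb ha.
- by move: ab h; clear; lia.
- by left.
- by right.
Qed.

Lemma missing_2n : missing (n%:Z - 2) n%:Z (1 - n%:Z).
Proof. by apply: missing_gap2; move: n10; clear; lia. Qed.

Lemma missing_23 : missing 2 3 (-1).
Proof.
apply: missingN; apply: missing_D; try by move: n10; clear; lia.
have n5 : (4 <= 4 < n)%N by move: n10; clear; lia.
apply: (D_interior R n5 (facetsB_fend1 4) (facetsB_fend2 4)); rewrite ?in_ap //.
by move/fsetP/(_ 4); rewrite !in_ap.
Qed.

Lemma DI_keep x a b c : ap x a b c \in D n ->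
  (forall u, u \in facetsI n P -> [&& x \in u, a \in u, b \in u & c \in u] -> False) ->
  (forall u, u \in facetsI n P -> [&& - x \in u, - a \in u, - b \in u & - c \in u] -> False) ->
  ap x a b c \in facetsDI.
Proof.
move=> sD h h'; apply/(replace2P _ hD hB); left; split=> //; apply/negP => sI.
  by apply: (h _ sI); rewrite !in_ap !eqxx !orbT.
by apply: (h' _ sI); rewrite !mem_oppf !opprK !in_ap !eqxx !orbT.
Qed.

Lemma DI_apex a b c : bd (facetsI n P) (tri a b c) -> ap n.+1%:Z a b c \in facetsDI.
Proof. by move=> bt; apply/(replace2P _ hD hB); right; exists (tri a b c) => //; left. Qed.

Lemma DI_face s t : s \in facetsDI -> t `<=` s -> t \in generated facetsDI.
Proof. by move=> sG ts; apply/generatedP; exists s. Qed.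

Lemma DI_face_ap x a b c t : ap x a b c \in generated facetsDI -> t `<=` ap x a b c ->
  t \in generated facetsDI.
Proof. by case/generatedP => s sG ss ts; apply: (DI_face sG); apply: fsubset_trans ss. Qed.

Lemma facet_face s : s \in facetsDI -> s \in generated facetsDI.
Proof. by move=> sG; apply: (DI_face sG). Qed.

Lemma DI_face_opp x a b c : ap (- x) (- a) (- b) (- c) \in generated facetsDI ->
  ap x a b c \in generated facetsDI.
Proof. by rewrite -oppf_ap DI_opp. Qed.

Local Ltac splitI := case/facetsIP => [??|???|???|??????||||]; rewrite !in_ap;
  case/or4P=> /eqP ?; try (by exfalso; lia);
  case/or4P=> /eqP ?; try (by exfalso; lia); case/or4P=> /eqP ?;
  first [ by exfalso; lia
        | lazymatch goal with
          | |- ap ?a _ _ (?a + 2) = ap ?b _ _ (?b + 2) => by have -> : a = b by lia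
          | |- ?x = ?x => reflexivity
          end ].

Lemma bd_2gap2 (i : nat) : (3 <= i <= n - 2)%N -> bd (facetsI n P) (tri 2 i%:Z (i%:Z + 2)).
Proof.
move=> hi; apply: (@bd_tri _ _ _ _ (ap i%:Z 1 2 (i%:Z + 2)));
  try by rewrite ?in_ap; move: hi; clear; lia.
- exact: facetsI_12.
by move=> u; splitI.
Qed.

Lemma bd_123 : bd (facetsI n P) (tri 1 2 3).
Proof.
apply: (@bd_tri _ _ _ _ (ap 3%:Z 1 2 (3%:Z + 2))) => //.
- by apply: facetsI_12; move: n10; clear; lia.
- by rewrite !in_ap.
by move=> u; splitI.
Qed.

Lemma bd_end2I : bd (facetsI n P) (tri (2 - n%:Z) (1 - n%:Z) (- n%:Z)).
Proof.
apply: (@bd_tri _ _ _ _ (fend2 n)); try by rewrite ?in_ap; move: n10; clear; lia.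
- exact: facetsI_end2.
by move=> u; splitI.
Qed.

Lemma bd_end2I' : bd (facetsI n P) (tri (2 - n%:Z) (- n%:Z) 1).
Proof.
apply: (@bd_tri _ _ _ _ (fend2 n)); try by rewrite ?in_ap; move: n10; clear; lia.
- exact: facetsI_end2.
by move=> u; splitI.
Qed.

(** The triangle lies in {1, 2, n-i-1, n-i+1}. A second facet of B(I) contains it exactly when [i]
    is an index, and otherwise it is a boundary triangle, coned from n+1. *)
Lemma recover (i : nat) : (3 <= i <= n - 6)%N ->
  P i = (tri 1 (n%:Z - i%:Z - 1) (n%:Z - i%:Z + 1) \notin generated facetsDI).
Proof.
move=> hi; pose s1 := ap (n - i - 1)%N%:Z 1 2 ((n - i - 1)%N%:Z + 2).
have s1I : s1 \in facetsI n P by apply: facetsI_12; move: hi n10; clear; lia.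
case: (boolP (P i)) => Pi; apply/esym.
  apply: (@DI_interior _ _ _ _ _ s1I (@facetsI_new i.+1 _));
    rewrite /fnew /= ?Pi /pair_lo /pair_hi /s1 ?in_ap; try by move: n10 hi; clear; lia.
  by move/fsetP/(_ 2); rewrite !in_ap; move: n10 hi; clear; lia.
apply/negbTE; rewrite negbK; apply: (DI_face (DI_apex (a := 1) (b := n%:Z - i%:Z - 1)
  (c := n%:Z - i%:Z + 1) _)); last exact: fsubsetUr.
apply: (@bd_tri _ _ _ _ s1) => //; rewrite /s1; try by rewrite ?in_ap; move: n10 hi; clear; lia.
move=> u; case/facetsIP => [i' hi'|???|c hc Pc|??????||||]; rewrite !in_ap /s1;
  case/or4P=> /eqP ?; try (by exfalso; lia);
  case/or4P=> /eqP ?; try (by exfalso; lia); case/or4P=> /eqP ?; try (by exfalso; lia).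
- by have -> : i' = (n - i - 1)%N by lia.
- by have e : c = i by [lia]; rewrite -e Pc in Pi.
Qed.

(** * Links of the edges {2, 3} and {n-2, n} *)

Lemma facet_23_apex : ap n.+1%:Z 1 2 3 \in generated facetsDI.
Proof. exact/facet_face/DI_apex/bd_123. Qed.

Lemma facet_2gap2_apex (i : nat) : (3 <= i <= n - 2)%N ->
  ap n.+1%:Z 2 i%:Z (i%:Z + 2) \in generated facetsDI.
Proof. by move=> hi; apply/facet_face/DI_apex/bd_2gap2. Qed.

Lemma facet_23_gap2 (k : nat) : (6 <= k <= n)%N ->
  ap 3 2 (k%:Z - 2) k%:Z \in generated facetsDI.
Proof.
move=> hk; apply/facet_face/DI_keep.
- by apply: (@D_pos R k n 2); move: hk; clear; lia.
- by move=> u; caseI.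
by move=> u; caseI.
Qed.

Lemma facet_23_top : ap 3 2 (n%:Z - 1) n%:Z \in generated facetsDI.
Proof.
apply/facet_face/DI_keep.
- by apply: (D_facetsB R n4); apply: (@facetsB_fpos n 2); move: n10; clear; lia.
- by move=> u; caseI.
by move=> u; caseI.
Qed.

Lemma facet_123 : ap 1 2 3 (-4) \in generated facetsDI.
Proof.
apply/facet_face/DI_keep; try by move=> u; caseI.
apply: (@D_permanent R 4 n); first by move: n10; clear; lia.
- rewrite cross_facetsE card_ap ?in_tri // andbT; apply/andP; split.
    by apply/fsubsetP => x; rewrite mem_V in_ap; clear; lia.
  by apply/antipode_freeP => x; rewrite !in_ap; clear; lia.
- apply/negP => h; have : [&& 1 \in ap 1 2 3 (-4), 2 \in ap 1 2 3 (-4) & -4 \in ap 1 2 3 (-4)].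
    by rewrite !in_ap.
  by move: h; move: (ap 1 2 3 (-4)); caseB.
apply/negP; rewrite oppf_ap => h.
have : [&& -1 \in ap (-1) (-2) (-3) (- -4), -2 \in ap (-1) (-2) (-3) (- -4)
    & -3 \in ap (-1) (-2) (-3) (- -4)] by rewrite !in_ap.
by move: h; move: (ap (-1) (-2) (-3) (- -4)); caseB.
Qed.

Lemma facet_23_46 : ap 2 3 (-4) (-6) \in generated facetsDI.
Proof.
apply: DI_face_opp.
rewrite -[- 2]/(-2) (_ : ap _ _ _ _ = ap (- 3%:Z) (- 2%:Z) (6%:Z - 2) 6%:Z); last first.
  by apply: eq_ap => x; rewrite !in_ap orbCA.
apply/facet_face/DI_keep; try by move=> u; caseI.
by apply: (@D_neg R 6 n 2); move: n10; clear; lia.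
Qed.

Lemma facet_23_45 : ap 2 3 4 (-5) \in generated facetsDI.
Proof.
have h : ap 5%:Z (-4) (-2) (-3) \in generated facetsDI.
  apply/facet_face/DI_keep; try by move=> u; caseI.
  have [hD4 hB4] := D_sphere_ball R (leqnn 4).
  apply: (@D_permanent R 5 n); first by move: n10; clear; lia.
  - apply: (D_cone hD4 hB4 (leqnn 4)); apply: (@bd_tri _ _ _ _ (fend2 4)) => //.
    - exact: facetsB_fend2.
    - by rewrite !in_ap.
    by move=> ? /mem_facetsB[[? ? ->]|[? ? ->]|[]->]; rewrite !in_ap => *; try (by exfalso; lia).
  - apply/negP => h; have : [&& -4 \in ap 5%:Z (-4) (-2) (-3),
        -2 \in ap 5%:Z (-4) (-2) (-3) & 5 \in ap 5%:Z (-4) (-2) (-3)].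
      by rewrite !in_ap.
    by move: h; move: (ap 5%:Z (-4) (-2) (-3)); caseB.
  apply/negP; rewrite oppf_ap => h; have : [&& 4 \in ap (-5%:Z) (- -4) (- -2) (- -3),
      2 \in ap (-5%:Z) (- -4) (- -2) (- -3) & -5 \in ap (-5%:Z) (- -4) (- -2) (- -3)].
    by rewrite !in_ap.
  by move: h; move: (ap (-5%:Z) (- -4) (- -2) (- -3)); caseB.
apply: DI_face_opp; rewrite (_ : ap _ _ _ _ = ap 5%:Z (-4) (-2) (-3)) //.
by apply: eq_ap => x; rewrite !in_ap; clear; lia.
Qed.

Lemma facet_2n_top : ap (n%:Z - 3) (n%:Z - 2) (n%:Z - 1) n%:Z \in generated facetsDI.
Proof.
apply/facet_face/DI_keep; try by move=> u; caseI.
have -> : ap (n%:Z - 3) (n%:Z - 2) (n%:Z - 1) n%:Z = fpos n (n - 3).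
  by apply: eq_ap => x; rewrite !in_ap; move: n10; clear; lia.
by apply: (D_facetsB R n4); apply: facetsB_fpos; move: n10; clear; lia.
Qed.

Lemma facet_2n_apex : ap (- n.+1%:Z) (n%:Z - 2) (n%:Z - 1) n%:Z \in generated facetsDI.
Proof.
apply: DI_face_opp; rewrite opprK !opprB.
exact/facet_face/DI_apex/bd_end2I.
Qed.

Lemma facet_2n_low : ap (n%:Z - 4) (n%:Z - 3) (n%:Z - 2) n%:Z \in generated facetsDI.
Proof.
apply/facet_face/DI_keep; try by move=> u; caseI.
have := @D_pos R n n (n - 4); rewrite (@eq_ap _ _ _ _ (n%:Z - 4) (n%:Z - 3) (n%:Z - 2) n%:Z).
  by apply; move: n10; clear; lia.
by move=> x; rewrite !in_ap; move: n10; clear; lia.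
Qed.

Lemma facet_2n_1apex : ap (- n.+1%:Z) (n%:Z - 2) n%:Z (-1) \in generated facetsDI.
Proof.
apply: DI_face_opp; rewrite opprK !opprB opprK.
exact/facet_face/DI_apex/bd_end2I'.
Qed.

Lemma facet_2n_12 : ap (-2) (-1) (n%:Z - 2) n%:Z \in generated facetsDI.
Proof.
apply/facet_face/DI_keep; try by move=> u; caseI.
by apply: (@D_neg R n n 1); move: n10; clear; lia.
Qed.

(** Positive vertices, -4 and -5 are covered by explicit facets. For c = -k with 6 <= k <= n, two
    antipodal candidates {-3, -2, k-2, k} and {-3, -2, k, k+2} are available, and B(I) removes at
    most one of them. *)
Lemma face_23 c : (0 < `|c| <= n.+1)%N -> `|c|%N != 2 -> `|c|%N != 3 -> c != -1 ->
  tri 2 3 c \in generated facetsDI.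
Proof.
move=> hc c2 c3 c1.
have from x a b d y : ap x a b d \in generated facetsDI ->
    [&& 2 \in ap x a b d, 3 \in ap x a b d & y \in ap x a b d] ->
    tri 2 3 y \in generated facetsDI.
  by move=> h h'; apply: (DI_face_ap h); rewrite tri_sub.
have [->|e1] := eqVneq c 1.
  by apply: (from _ _ _ _ _ facet_23_apex); rewrite !in_ap; clear; lia.
have [->|en] := eqVneq c n.+1%:Z.
  by apply: (from _ _ _ _ _ facet_23_apex); rewrite !in_ap; clear; lia.
have [h|c0] := boolP (0 < c).
  pose k := if c <= 5 then `|c|.+2 else `|c|%N.
  apply: (from _ _ _ _ _ (@facet_23_gap2 k _)); rewrite ?in_ap /k; case: ifP => h5.
  - by move: h h5 c2 c3 e1 n10; clear; lia.
  - by move: h h5 hc en; clear; lia.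
  - by move: h h5; clear; lia.
  - by move: h h5; clear; lia.
have [->|e4] := eqVneq c (-4).
  by apply: (from _ _ _ _ _ facet_23_46); rewrite !in_ap; clear; lia.
have [->|e5] := eqVneq c (-5).
  by apply: (from _ _ _ _ _ facet_23_45); rewrite !in_ap; clear; lia.
have [->|nn] := eqVneq c (- n.+1%:Z).
  have hm : (2 <= n - 3 <= n - 2)%N by move: n10; clear; lia.
  have e : [fset -2; -3] `<=` fnew n P (n - 3).
    rewrite fsubUset !fsub1set; case: fnewP => [|_|d ed Pd|d _ Pd _]; first by case/andP: hm.
    - by rewrite !in_ap; move: n10; clear; lia.
    - by have := adm Pd; move: ed n10; clear; lia.
    - by rewrite !in_ap; move: n10; clear; lia.
  (* The edge {-2, -3} lies in B(I), hence on its boundary, which is the link of n+1. *)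
  have [|t bt et] := bd_edge (ball_stacked hB) (facetsI_new hm) e; first by rewrite cardfs2.
  rewrite -DI_opp oppf_tri opprK; apply/generatedP; exists (n.+1%:Z |` t).
    by apply/(replace2P _ hD hB); right; exists t => //; left.
  move: et; rewrite fsubUset !fsub1set tri_sub !inE eqxx => /andP[-> ->].
  by rewrite !orbT.
have c0' : c < 0 by move: hc c0; clear; lia.
pose k := `|c|%N; have ck : c = - k%:Z by rewrite /k; move: c0'; clear; lia.
have hk : (6 <= k <= n)%N by rewrite /k; move: hc c0' c1 c2 c3 e4 e5 nn; clear; lia.
(* A facet of this form in B(I) is the row member m = n-3, so its positive pair comes from the last
   index below n-3. Two values of [j] would give two such indices. *)
have noI u (j : nat) : u \in facetsI n P ->
    [&& -3 \in u, -2 \in u, j%:Z - 2 \in u & j%:Z \in u] ->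
    exists2 d, P d & [&& (3 <= d <= n - 6)%N, j%:Z == n%:Z - d%:Z + 1, (d < n - 3)%N &
      [forall i : 'I_(n - 3), (d < i)%N ==> ~~ P i]].
  case/facetsIP => [i hi|m hm h|d hd Pd|d m hd hm Pd h||||]; rewrite !in_ap;
    try by move=> *; exfalso; lia.
  move=> hj; exists d => //; have em : m = (n - 3)%N by move: hj hd hm n10; clear; lia.
  rewrite hd /=; apply/and3P; split; try by move: hj hd hm; clear; lia.
  by apply/forallP => i; apply/implyP => di; apply: h; rewrite di em /=.
have key (j : nat) : (6 <= j <= n)%N -> ap (- 3%:Z) (- 2%:Z) (j%:Z - 2) j%:Z \notin facetsI n P ->
    (k == j) || (k == j - 2)%N -> tri 2 3 c \in generated facetsDI.
  move=> hj nI kj; have h : ap (- 3%:Z) (- 2%:Z) (j%:Z - 2) j%:Z \in generated facetsDI.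
    apply/facet_face/(replace2P _ hD hB); left; split => //.
      by apply: (@D_neg R j n 2); move: hj; clear; lia.
    apply/negP => /facetsIP; move e: (oppf _) => u hu.
    have : [&& 3 \in u, 2 \in u & - j%:Z \in u].
      by rewrite -e !mem_oppf opprK !in_ap eqxx !orbT.
    by case: hu => [??|???|???|??????||||]; rewrite !in_ap; lia.
  rewrite -DI_opp oppf_tri; apply: (DI_face_ap h); rewrite tri_sub !in_ap ck.
  by move: kj hj; clear; lia.
have [h1|h1] := boolP (ap (- 3%:Z) (- 2%:Z) (k%:Z - 2) k%:Z \in facetsI n P); last first.
  by apply: (key k) => //; rewrite eqxx.
have [|d Pd /and4P[hd kd dn hP]] := noI _ k h1; first by rewrite !in_ap !eqxx !orbT.
have hk2 : (6 <= k.+2 <= n)%N by move: kd hd hk; clear; lia.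
apply: (key k.+2) => //; last by rewrite -addn2 addnK eqxx orbT.
apply/negP => h2; have [|d' Pd' /and4P[hd' kd' dn' /forallP hP']] := noI _ k.+2 h2.
  by rewrite !in_ap !eqxx !orbT.
by have := hP' (Ordinal dn); rewrite /= Pd implybF; move: kd kd'; clear; lia.
Qed.

Lemma apex_face a b c : (0 < `|a| <= n)%N -> (0 < `|b| <= n)%N -> (0 < `|c| <= n)%N ->
  ap n.+1%:Z a b c \in generated facetsDI ->
  exists2 u, u \in facetsI n P & [&& a \in u, b \in u & c \in u].
Proof.
move=> ha hb hc tG; have [|u uB tu] := replace2_new hD hB tG.
  by rewrite in_ap eqxx.
exists u => //; apply/and3P; split; apply: (fsubsetP tu);
  rewrite in_fsetD1 in_ap eqxx ?orbT andbT; move: ha hb hc; clear; lia.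
Qed.

Local Ltac apexI := case/apex_face; try (by move: n10; clear; lia); move=> ?; caseI.

Lemma nonface_236 : ap (- n.+1%:Z) 2 3 6 \in generated facetsDI -> False.
Proof. by rewrite -DI_opp oppf_ap opprK; apexI. Qed.

Lemma nonface_2n4 : ap n.+1%:Z (n%:Z - 2) n%:Z (4 - n%:Z) \in generated facetsDI -> False.
Proof. apexI. Qed.

Lemma nonface_12_2n : ap (- n.+1%:Z) (-1) (-2) (n%:Z - 2) \in generated facetsDI -> False.
Proof. by rewrite -DI_opp oppf_ap !opprK; apexI. Qed.

Lemma nonface_12_n : ap (- n.+1%:Z) (-1) (-2) n%:Z \in generated facetsDI -> False.
Proof. by rewrite -DI_opp oppf_ap !opprK; apexI. Qed.

End DeltaI.

(** * Rigidity *)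

Section Isomorphism.
Variables (R : realType) (n : nat) (P Q : pred nat).
Hypotheses (n10 : (10 <= n)%N) (admP : admissible n P) (admQ : admissible n Q).
Local Notation K := (generated (facetsDI n P)).
Local Notation L := (generated (facetsDI n Q)).
Implicit Types (a b c v w x y z : int) (s t u E : {fset int}) (f : int -> int).

(** The last condition both preserves and reflects faces, so nonfaces can be transported as well;
    [f] is constrained only on the vertices. *)
Definition vertex_iso f : Prop :=
  [/\ forall v, v \in V n.+1 -> f v \in V n.+1,
      forall v w, v \in V n.+1 -> w \in V n.+1 -> f v = f w -> v = w &
      forall s, s `<=` V n.+1 -> (f @` s \in L) = (s \in K)].

Lemma imfset_ap f x a b c : f @` (ap x a b c) = ap (f x) (f a) (f b) (f c).
Proof. by rewrite !imfsetU !imfset_fset1. Qed.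

Lemma imfset_tri f a b c : f @` (tri a b c) = tri (f a) (f b) (f c).
Proof. by rewrite !imfsetU !imfset_fset1. Qed.

Let sphere_K : cs_sphere R (facetsDI n P) n.+1. Proof. exact: cs_sphere_DI. Qed.
Let sphere_L : cs_sphere R (facetsDI n Q) n.+1. Proof. exact: cs_sphere_DI. Qed.

Lemma V_opp m v : (- v \in V m) = (v \in V m).
Proof. by rewrite !mem_V; clear; lia. Qed.

Lemma vertex_iso_inj f s : vertex_iso f -> s `<=` V n.+1 -> {in s &, injective f}.
Proof. by case=> _ inj _ sV v w vs ws; apply: inj; apply: (fsubsetP sV). Qed.

Lemma vertex_iso_onto f w : vertex_iso f -> w \in V n.+1 -> exists2 v, v \in V n.+1 & f v = w.
Proof.
move=> hf wV; have [fV _ _] := hf.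
have sub : f @` V n.+1 `<=` V n.+1.
  by apply/fsubsetP => _ /imfsetP[v /= vV ->]; apply: fV.
have e : f @` V n.+1 = V n.+1.
  apply: eq_of_card sub _.
  by have /card_in_imfsetP/eqP-> := vertex_iso_inj hf (fsubset_refl (V n.+1)).
by move: wV; rewrite -{1}e => /imfsetP[v /= vV ->]; exists v.
Qed.

(* The pairs {v, - v} are the only non-edges. *)
Lemma vertex_iso_opp f v : vertex_iso f -> v \in V n.+1 -> f (- v) = - f v.
Proof.
move=> hf vV; have [fV _ face] := hf; have fvV := fV _ vV.
have [w wV fw] : exists2 w, w \in V n.+1 & f w = - f v.
  by apply: vertex_iso_onto => //; rewrite V_opp.
have [<- //|wv] := eqVneq w (- v).
have [s sK /andP[vs ws]] := cs_edge sphere_K vV wV wv.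
have : [fset v; w] \in K.
  by apply/generatedP; exists s; rewrite // fsubUset !fsub1set vs.
rewrite -face ?fsubUset ?fsub1set ?vV // imfsetU !imfset_fset1 fw.
move=> /generatedP[u uL]; rewrite fsubUset !fsub1set => /andP[fu nfu].
by have /antipode_freeP/(_ _ fu) := cs_free sphere_L uL; rewrite nfu.
Qed.

Lemma vertex_iso_neg f : vertex_iso f -> vertex_iso (fun v => - f v).
Proof.
case=> fV inj face; split.
- by move=> v vV; rewrite V_opp fV.
- by move=> v w vV wV /oppr_inj; apply: inj.
move=> s sV; have -> : (fun v => - f v) @` s = oppf (f @` s).
  apply/fsetP => w; rewrite mem_oppf; apply/imfsetP/imfsetP => -[v /= vs].
    by move=> ->; exists v; rewrite //= opprK.
  by move=> e; exists v; rewrite //= -e opprK.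
by rewrite (generated_opp _ sphere_L) face.
Qed.

Definition link_edge E F x y : Prop := x |` (y |` E) \in generated F.

Lemma link_edgeC E F x y : link_edge E F x y -> link_edge E F y x.
Proof. by rewrite /link_edge fsetUCA. Qed.

(** The triangle on [y] and [E] lies in at most two facets, so [y] has at most two neighbours in the
    link of [E]. *)
Lemma link_choice E F y a b c : pure4 F -> pseudomanifold F -> #|` E| = 2 -> y \notin E ->
  link_edge E F y a -> link_edge E F y b -> link_edge E F y c ->
  a \notin y |` E -> b \notin y |` E -> c \notin y |` E -> [\/ a = b, a = c | b = c].
Proof.
move=> pF mF E2 yE /link_edgeC la /link_edgeC lb /link_edgeC lc aE bE cE.
have E3 : #|` y |` E| = 3 by rewrite cardfsU1 yE E2.
have inF z : z \notin y |` E -> link_edge E F z y -> z |` (y |` E) \in F.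
  move=> zE /generatedP[s sF sub]; rewrite (_ : z |` (y |` E) = s) //.
  by apply: eq_of_card; rewrite // cardfsU1 zE E3 (pF _ sF).
have eqz z w : z \notin y |` E -> z |` (y |` E) = w |` (y |` E) -> z = w.
  move=> zE /fsetP/(_ z); rewrite !in_fset1U eqxx /= => /esym/predU1P[//|].
  by rewrite -in_fset1U (negPf zE).
have [] := mF _ _ _ _ E3 (inF _ aE la) (inF _ bE lb) (inF _ cE lc); rewrite ?fsubsetUr //.
- by move/eqz => ->; [constructor 1|].
- by move/eqz => ->; [constructor 2|].
- by move/eqz => ->; [constructor 3|].
Qed.

Section Link23.
Variables (f : int -> int) (E : {fset int}).
Hypotheses (hf : vertex_iso f) (fE : f @` [fset 2; 3] = E).

Let fV v : v \in V n.+1 -> f v \in V n.+1. Proof. by case: hf => h _ _; apply: h. Qed.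
Let f_inj v w : v \in V n.+1 -> w \in V n.+1 -> f v = f w -> v = w.
Proof. by case: hf => _ h _; apply: h. Qed.
Let V23 : [fset 2; 3] `<=` V n.+1.
Proof. by rewrite fsubUset !fsub1set !mem_V; move: n10; clear; lia. Qed.

Lemma card_E : #|` E| = 2.
Proof.
have /card_in_imfsetP/eqP e := vertex_iso_inj hf V23.
by rewrite -fE e cardfs2.
Qed.

Lemma link_edge_iso x y : x \in V n.+1 -> y \in V n.+1 ->
  link_edge [fset 2; 3] (facetsDI n P) x y -> link_edge E (facetsDI n Q) (f x) (f y).
Proof.
case: hf => _ _ face xV yV; rewrite /link_edge -face.
  by rewrite !imfsetU !imfset_fset1 -fE imfsetU !imfset_fset1.
by rewrite !fsubUset !fsub1set xV yV !(fsubsetP V23) ?inE ?eqxx ?orbT.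
Qed.

Lemma notin_E v : v \in V n.+1 -> v \notin [fset 2; 3] -> f v \notin E.
Proof.
move=> vV v23; rewrite -fE; apply: contra v23 => /imfsetP[w /= w23].
by move=> e; rewrite (f_inj vV (fsubsetP V23 _ w23) e).
Qed.

Lemma link_next x y z Y :
  [&& x \in V n.+1, y \in V n.+1, z \in V n.+1 & uniq [:: x; y; z; 2; 3]] ->
  link_edge [fset 2; 3] (facetsDI n P) y x -> link_edge [fset 2; 3] (facetsDI n P) y z ->
  link_edge E (facetsDI n Q) (f y) Y -> Y \notin E -> Y != f y -> Y != f x -> f z = Y.
Proof.
case/and4P=> xV yV zV uniq5 lx lz lY YE Yy Yx.
have /and4P[/and3P[xy xz yz] x23 y23 z23] :
    [&& [&& x != y, x != z & y != z], x \notin [fset 2; 3], y \notin [fset 2; 3]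
      & z \notin [fset 2; 3]].
  by move: uniq5; rewrite /= !in_fset2 !inE; clear; lia.
have fne v w : v \in V n.+1 -> w \in V n.+1 -> v != w -> f v != f w.
  by move=> vV wV; apply: contra => /eqP/f_inj ->.
have [] := link_choice (cs_pure sphere_L) (cs_pseudo sphere_L) card_E (notin_E yV y23)
  (link_edge_iso yV xV lx) (link_edge_iso yV zV lz) lY.
- by rewrite in_fset1U negb_or fne ?notin_E.
- by rewrite in_fset1U negb_or fne ?notin_E // eq_sym.
- by rewrite in_fset1U negb_or Yy.
- by move/f_inj => e; rewrite e ?eqxx in xz.
- by move=> e; rewrite e eqxx in Yx.
- by [].
Qed.

End Link23.

Section Rigidity.
Variable f : int -> int.
Hypothesis hf : vertex_iso f.

Let fV v : v \in V n.+1 -> f v \in V n.+1. Proof. by case: hf => h _ _; apply: h. Qed.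
Let f_inj v w : v \in V n.+1 -> w \in V n.+1 -> f v = f w -> v = w.
Proof. by case: hf => _ h _; apply: h. Qed.
Let f_opp v : v \in V n.+1 -> f (- v) = - f v.
Proof. exact: vertex_iso_opp. Qed.
Let inV v : (0 < `|v| <= n.+1)%N -> v \in V n.+1. Proof. by rewrite mem_V. Qed.

Local Ltac vert := apply: inV; move: n10; clear; lia.

Let f_abs v w : v \in V n.+1 -> w \in V n.+1 -> `|f v|%N = `|f w|%N -> `|v|%N = `|w|%N.
Proof.
move=> vV wV e; have [h|h] : f v = f w \/ f v = - f w by move: e; clear; lia.
  by rewrite (f_inj vV wV h).
by rewrite (@f_inj v (- w) _ _) ?abszN ?V_opp // f_opp.
Qed.

Let abs_f v w : w \in V n.+1 -> `|v|%N = `|w|%N -> `|f v|%N = `|f w|%N.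
Proof.
move=> wV e; have [->//|->] : v = w \/ v = - w by move: e; clear; lia.
by rewrite f_opp ?abszN.
Qed.

Let face_tri a b c : a \in V n.+1 -> b \in V n.+1 -> c \in V n.+1 ->
  (tri (f a) (f b) (f c) \in L) = (tri a b c \in K).
Proof.
move=> aV bV cV; case: hf => _ _ face; rewrite -face ?imfset_tri //.
by rewrite !fsubUset !fsub1set aV bV cV.
Qed.

Let face_ap x a b c : x \in V n.+1 -> a \in V n.+1 -> b \in V n.+1 -> c \in V n.+1 ->
  ap x a b c \in K -> ap (f x) (f a) (f b) (f c) \in L.
Proof.
move=> xV aV bV cV h; case: hf => _ _ face; rewrite -imfset_ap face //.
by rewrite !fsubUset !fsub1set xV aV bV cV.
Qed.

Let V2 : 2 \in V n.+1. Proof. vert. Qed.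
Let V3 : 3 \in V n.+1. Proof. vert. Qed.

(* {2, 3} misses only -1, so its image misses at most one vertex. *)
Lemma special_image :
  [\/ [fset f 2; f 3] = [fset 2; 3], [fset f 2; f 3] = [fset -2; -3],
    [fset f 2; f 3] = [fset n%:Z - 2; n%:Z] | [fset f 2; f 3] = [fset 2 - n%:Z; - n%:Z]].
Proof.
have only d : missing n Q (f 2) (f 3) d -> d = f (-1).
  case; rewrite -mem_V => dV d2 d3 nd.
  have [c cV ec] := vertex_iso_onto hf dV; rewrite -ec in d2 d3 nd *.
  have [->//|c1] := eqVneq c (-1); case/negP: nd; rewrite face_tri //.
  apply: (face_23 R n10 admP) => //; first by rewrite -mem_V.
    by apply: contraNneq d2 => e; apply/eqP/(abs_f V2).
  by apply: contraNneq d3 => e; apply/eqP/(abs_f V3).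
have [|||h|//] := @two_missing_or_special R n Q n10 admQ (f 2) (f 3).
- by rewrite -mem_V; apply: fV.
- by rewrite -mem_V; apply: fV.
- by apply/negP => /eqP /(f_abs V2 V3).
case: h => c [c' [cc' /only e /only e']].
by rewrite e e' eqxx in cc'.
Qed.

(** Only -1 is missed by {2, 3}, so any vertex missed by the image edge is the image of -1. *)
Lemma missing_image a b d : [fset f 2; f 3] = [fset a; b] -> missing n Q a b d -> f (-1) = d.
Proof.
move=> e; case; rewrite -mem_V => dV da db nd.
have [c cV ec] := vertex_iso_onto hf dV; rewrite -ec in da db nd *.
have [->//|c1] := eqVneq c (-1); case/negP: nd.
have tri_pair x y z : tri x y z = [fset x; y] `|` [fset z] by [].
rewrite tri_pair -e -tri_pair face_tri //.
have ne w : w \in V n.+1 -> f w \in [fset a; b] -> `|c|%N != `|w|%N.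
  move=> wV; rewrite !inE => fw; apply/negP => /eqP ecw.
  have e3 := abs_f wV ecw.
  by move: fw da db; rewrite e3; case/orP => /eqP->; rewrite eqxx.
apply: (face_23 R n10 admP) => //; first by rewrite -mem_V.
  by apply: (ne 2) => //; rewrite -e !inE eqxx.
by apply: (ne 3) => //; rewrite -e !inE eqxx orbT.
Qed.

Local Notation lkK := (link_edge [fset 2; 3] (facetsDI n P)).

Let to_link F a b x y (z w : int) (E : {fset int}) : ap x y z w \in generated F ->
  a |` (b |` E) =i ap x y z w -> link_edge E F a b.
Proof. by move=> h e; rewrite /link_edge (_ : a |` (b |` E) = ap x y z w) //; apply/fsetP. Qed.

Local Ltac lk h := apply: (to_link h); move=> ?; rewrite !inE; clear; lia.

Let lk_1_apex : lkK 1 n.+1%:Z. Proof. lk (facet_23_apex R n10 admP). Qed.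
Let lk_apex_5 : lkK n.+1%:Z 5.
Proof.
have h := facet_2gap2_apex R n10 admP (i := 3).
by apply: (to_link (h _)) => [|x]; rewrite ?inE; [move: n10; clear; lia | clear; lia].
Qed.
Let lk_gap2 (k : nat) : (6 <= k <= n)%N -> lkK (k%:Z - 2) k%:Z.
Proof. by move=> hk; lk (facet_23_gap2 R n10 admP hk). Qed.
Let lk_top : lkK (n%:Z - 1) n%:Z. Proof. lk (facet_23_top R n10 admP). Qed.
Let lk_1_4 : lkK 1 (-4). Proof. lk (facet_123 R n10 admP). Qed.

Local Ltac distinct := by rewrite !mem_V /= !inE; move: n10; clear; lia.
Local Ltac neqs := rewrite ?in_fset2; move: n10; clear; lia.

Let split4 x y z w : ap x y z w = [fset x; y] `|` [fset z; w].
Proof. by apply/fsetP => t; rewrite in_ap !inE -!orbA. Qed.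

Let image_pair a b : [fset f 2; f 3] = [fset a; b] -> f @` [fset 2; 3] = [fset a; b].
Proof. by move=> <-; rewrite imfsetU !imfset_fset1. Qed.

Let f_minus1 v : f (-1) = - v -> f 1 = v.
Proof. by rewrite f_opp; [apply: oppr_inj | vert]. Qed.

Let choose E y a b v : f @` [fset 2; 3] = E -> y \in V n.+1 -> v \in V n.+1 ->
  lkK y v -> y \notin [fset 2; 3] -> v \notin [fset 2; 3] -> y != v ->
  link_edge E (facetsDI n Q) (f y) a -> link_edge E (facetsDI n Q) (f y) b -> a != b ->
  a \notin f y |` E -> b \notin f y |` E -> f v = a \/ f v = b.
Proof.
move=> fE yV vV lv y23 v23 yv la lb ab aE bE.
have [] := link_choice (cs_pure sphere_L) (cs_pseudo sphere_L) (card_E hf fE)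
  (notin_E hf fE yV y23) la lb (link_edge_iso hf fE yV vV lv) aE bE.
- rewrite in_fset1U negb_or (notin_E hf fE) // andbT.
  by apply: contra yv => /eqP/(f_inj vV yV) ->.
- by move=> e; rewrite e eqxx in ab.
- by left.
- by right.
Qed.

(** Walking both ways from 1 gives f(-4) = n+1 and f(5) = -6. The face {2, 3, 4, -5} then goes to
    {2, 3, -(n+1), 6}. *)
Lemma no_reflection : [fset f 2; f 3] = [fset 2; 3] -> f 1 = 1 -> f n.+1%:Z = -4 -> False.
Proof.
move=> e f1 fa; have fE := image_pair e.
have f4 : f (-4) = n.+1%:Z.
  apply: (link_next hf fE (x := n.+1%:Z) (y := 1));
    [distinct | exact: lk_1_apex | exact: lk_1_4 | | neqs | |].
  - by rewrite f1; lk (facet_23_apex R n10 admQ).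
  - by rewrite f1; neqs.
  - by rewrite fa; neqs.
have f4' : f 4 = - n.+1%:Z by rewrite -f4 -f_opp //; vert.
have f5 : f 5 = -6.
  apply: (link_next hf fE (x := 1) (y := n.+1%:Z));
    [distinct | exact/link_edgeC/lk_1_apex | exact: lk_apex_5 | | neqs | |].
  - by rewrite fa; lk (facet_23_46 R n10 admQ).
  - by rewrite fa.
  - by rewrite f1.
have f5' : f (-5) = 6 by rewrite f_opp ?f5 //; vert.
have := face_ap V2 V3 _ _ (facet_23_45 R n10 admP).
rewrite f4' f5' => h; apply: (nonface_236 R n10 admQ).
rewrite (_ : ap _ _ _ _ = ap (f 2) (f 3) (- n.+1%:Z) 6); first by apply: h; vert.
rewrite [RHS]split4 e -[RHS]split4.
by apply: eq_ap => x; rewrite !in_ap; clear; lia.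
Qed.

(** The link of {2, 3} runs through 1, n+1, 5, 7, 9, ... along the odd numbers, crosses the edge
    {n-1, n} and comes back along the even numbers to 6 and 4. Two fixed consecutive vertices fix
    the next one. *)
Lemma identity_faces : [fset f 2; f 3] = [fset 2; 3] -> f 1 = 1 -> f n.+1%:Z = n.+1%:Z ->
  forall k : nat, (4 <= k <= n)%N -> f k%:Z = k%:Z.
Proof.
move=> e f1 fa; have fE := image_pair e.
have step x y z :
    [&& x \in V n.+1, y \in V n.+1, z \in V n.+1 & uniq [:: x; y; z; 2; 3]] ->
    lkK y x -> lkK y z ->
    link_edge [fset 2; 3] (facetsDI n Q) y z -> f x = x -> f y = y -> f z = z.
  case/and4P=> xV yV zV uniq5 lx lz lz' fx fy.
  apply: (link_next hf fE (x := x) (y := y)) => //; first by apply/and4P.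
  - by rewrite fy.
  - by move: uniq5; rewrite /= in_fset2 !inE; clear; lia.
  - by rewrite fy; move: uniq5; rewrite /= !inE; clear; lia.
  by rewrite fx; move: uniq5; rewrite /= !inE; clear; lia.
have lkQ (k : nat) : (6 <= k <= n)%N ->
    link_edge [fset 2; 3] (facetsDI n Q) (k%:Z - 2) k%:Z.
  by move=> hk; lk (facet_23_gap2 R n10 admQ hk).
have lkQ_top : link_edge [fset 2; 3] (facetsDI n Q) (n%:Z - 1) n%:Z.
  by lk (facet_23_top R n10 admQ).
have f5 : f 5 = 5.
  apply: (step 1 n.+1%:Z);
    [distinct | exact/link_edgeC/lk_1_apex | exact: lk_apex_5 | | exact: f1 | exact: fa].
  have h := facet_2gap2_apex R n10 admQ (i := 3).
  by apply: (to_link (h _)) => [|x]; rewrite ?inE; [move: n10; clear; lia | clear; lia].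
have up (j : nat) : (7 + j.*2 <= n)%N ->
    f (5 + j.*2)%N%:Z = (5 + j.*2)%N%:Z /\ f (7 + j.*2)%N%:Z = (7 + j.*2)%N%:Z.
  elim: j => [|j IH] hj.
    split; first exact: f5.
    apply: (step n.+1%:Z 5);
      [distinct | exact/link_edgeC/lk_apex_5 | | | exact: fa | exact: f5].
    - by apply: (lk_gap2 (k := 7)); move: n10; clear; lia.
    - by apply: (lkQ 7%N); move: n10; clear; lia.
  have [|h1 h2] := IH; first by move: hj; clear; lia.
  have e1 : (5 + j.+1.*2 = 7 + j.*2)%N by rewrite doubleS.
  rewrite e1; split; first exact: h2.
  set k := (7 + j.+1.*2)%N.
  have e2 : (7 + j.*2)%N%:Z = k%:Z - 2 by rewrite /k; clear; lia.
  have e3 : (5 + j.*2)%N%:Z = (7 + j.*2)%N%:Z - 2 by clear; lia.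
  have hk : (9 <= k <= n)%N by rewrite hj /k; clear; lia.
  have hj' := hk; rewrite /k in hj'.
  apply: (step (5 + j.*2)%N%:Z (7 + j.*2)%N%:Z);
    [by rewrite !mem_V /= !inE; move: hj'; clear; lia | | | |
     exact: h1 | exact: h2].
  - by rewrite e3; apply/link_edgeC/lk_gap2; move: hk; rewrite /k; clear; lia.
  - by rewrite e2; apply: lk_gap2; move: hk; clear; lia.
  - by rewrite e2; apply: lkQ; move: hk; clear; lia.
have odd_fixed (k : nat) : (5 <= k <= n)%N -> odd k -> f k%:Z = k%:Z.
  move=> hk ok; have [->|k5] := eqVneq k 5%N; first exact: f5.
  have -> : k = (7 + (k - 7)./2.*2)%N by move: hk ok k5; clear; lia.
  by apply: (up _ _).2; move: hk ok k5; clear; lia.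
(* The largest odd and the largest even number up to n, between which the cycle turns back. *)
pose o := if odd n then n else n.-1; pose r := if odd n then n.-1 else n.
have oV : odd o by rewrite /o; case: ifP => //; move: n10; clear; lia.
have ho : (9 <= o <= n)%N by rewrite /o; case: ifP; move: n10; clear; lia.
have hr : (9 <= r <= n)%N by rewrite /r; case: ifP; move: n10; clear; lia.
have er : ~~ odd r by rewrite /r; case: ifP; move: n10; clear; lia.
have top F : link_edge [fset 2; 3] F (n%:Z - 1) n%:Z -> link_edge [fset 2; 3] F o%:Z r%:Z.
  have -> : n%:Z - 1 = n.-1%:Z by move: n10; clear; lia.
  by rewrite /o /r; case: ifP => _ // /link_edgeC.
have fr : f r%:Z = r%:Z.
  apply: (step (o - 2)%N%:Z o%:Z);
    [by rewrite !mem_V /= !inE; move: ho hr er oV; clear; lia | | | | |].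
  - apply/link_edgeC; have -> : (o - 2)%N%:Z = o%:Z - 2 by move: ho; clear; lia.
    by apply: lk_gap2; move: ho; clear; lia.
  - exact: top lk_top.
  - exact: top lkQ_top.
  - by apply: odd_fixed; move: ho oV; clear; lia.
  - by apply: odd_fixed => //; move: ho; clear; lia.
have down (j : nat) : (4 + j.*2 + 2 <= r)%N ->
    f (r - j.*2)%N%:Z = (r - j.*2)%N%:Z /\ f (r - j.*2 - 2)%N%:Z = (r - j.*2 - 2)%N%:Z.
  elim: j => [|j IH] hj.
    rewrite double0 subn0; split; first exact: fr.
    have e2 : (r - 2)%N%:Z = r%:Z - 2 by move: hr; clear; lia.
    apply: (step o%:Z r%:Z); [by rewrite !mem_V /= !inE; move: ho hr er oV; clear; lia | | | | |
       exact: fr].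
    - exact/link_edgeC/top/lk_top.
    - by rewrite e2; apply/link_edgeC/lk_gap2; move: hr; clear; lia.
    - by rewrite e2; apply/link_edgeC/lkQ; move: hr; clear; lia.
    by apply: odd_fixed => //; move: ho; clear; lia.
  have [|h1 h2] := IH; first by move: hj; clear; lia.
  have e1 : (r - j.+1.*2 = r - j.*2 - 2)%N by rewrite doubleS; clear; lia.
  rewrite e1; split; first exact: h2.
  set k := (r - j.*2)%N in h1 h2 *.
  have hk : (8 <= k <= r)%N by rewrite /k; move: hj; clear; lia.
  have ek : ~~ odd k by move: er; rewrite /k; move: hj; clear; lia.
  have e2 : (k - 2 - 2)%N%:Z = (k - 2)%N%:Z - 2 by move: hk; clear; lia.
  have e3 : (k - 2)%N%:Z = k%:Z - 2 by move: hk; clear; lia.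
  apply: (step k%:Z (k - 2)%N%:Z); [by rewrite !mem_V /= !inE; move: hk ek hr; clear; lia | | | |
     exact: h1 | exact: h2].
  - by rewrite e3; apply: lk_gap2; move: hk hr; clear; lia.
  - by rewrite e2; apply/link_edgeC/lk_gap2; move: hk hr; clear; lia.
  - by rewrite e2; apply/link_edgeC/lkQ; move: hk hr; clear; lia.
move=> k hk; have [ok|ek] := boolP (odd k).
  by apply: odd_fixed => //; move: hk ok; clear; lia.
have kr : (k <= r)%N by rewrite /r; case: ifP; move: hk ek; clear; lia.
have [->|kr'] := eqVneq k r; first exact: fr.
have -> : k = (r - (r - k - 2)./2.*2 - 2)%N by move: hk ek er kr kr'; clear; lia.
by apply: (down _ _).2; move: hk ek er kr kr'; clear; lia.
Qed.

(** The missed vertices force f(1) = n-1, whose neighbours in the link of {n-2, n} are n-3 and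
    -(n+1). If f(n+1) = n-3, the face {2, 3, 4, -5} goes to {n-2, n, n+1, 4-n}, not a face. *)
Lemma no_exchange : [fset f 2; f 3] = [fset n%:Z - 2; n%:Z] -> False.
Proof.
move=> e; have fE := image_pair e.
have f1 : f 1 = n%:Z - 1.
  apply: f_minus1; rewrite (missing_image e (missing_2n R n10 admQ)) opprB.
  by [].
have l3 : link_edge [fset n%:Z - 2; n%:Z] (facetsDI n Q) (n%:Z - 1) (n%:Z - 3).
  by lk (facet_2n_top R n10 admQ).
have la : link_edge [fset n%:Z - 2; n%:Z] (facetsDI n Q) (n%:Z - 1) (- n.+1%:Z).
  by lk (facet_2n_apex R n10 admQ).
have [|||||||||||fa|fa] := @choose _ 1 (n%:Z - 3) (- n.+1%:Z) n.+1%:Z fE.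
- vert.
- vert.
- exact: lk_1_apex.
- neqs.
- neqs.
- neqs.
- by rewrite f1; exact: l3.
- by rewrite f1; exact: la.
- neqs.
- by rewrite f1 in_fset1U in_fset2; move: n10; clear; lia.
- by rewrite f1 in_fset1U in_fset2; move: n10; clear; lia.
- have f4 : f (-4) = - n.+1%:Z.
    apply: (link_next hf fE (x := n.+1%:Z) (y := 1));
      [distinct | exact: lk_1_apex | exact: lk_1_4 | | neqs | |].
    + by rewrite f1; exact: la.
    + by rewrite f1; neqs.
    + by rewrite fa; neqs.
  have f4' : f 4 = n.+1%:Z by apply: oppr_inj; rewrite -f4 f_opp //; vert.
  have f5 : f 5 = n%:Z - 4.
    apply: (link_next hf fE (x := 1) (y := n.+1%:Z));
      [distinct | exact/link_edgeC/lk_1_apex | exact: lk_apex_5 | | neqs | |].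
    + by rewrite fa; lk (facet_2n_low R n10 admQ).
    + by rewrite fa; neqs.
    + by rewrite f1; neqs.
  have f5' : f (-5) = 4 - n%:Z by rewrite f_opp ?f5 ?opprB //; vert.
  have := face_ap V2 V3 _ _ (facet_23_45 R n10 admP).
  rewrite f4' f5' => h; apply: (nonface_2n4 R n10 admQ).
  rewrite (_ : ap _ _ _ _ = ap (f 2) (f 3) n.+1%:Z (4 - n%:Z)); first by apply: h; vert.
  rewrite [RHS]split4 e -[RHS]split4.
  by apply: eq_ap => x; rewrite !in_ap; clear; lia.
(* In the direction f(n+1) = -(n+1) the walk gives f(5) = -1 and f(7) = -2. The face {n+1, 2, 5, 7}
   then has no admissible image, whichever of n-2 and n is f(2). *)
have f5 : f 5 = -1.
  apply: (link_next hf fE (x := 1) (y := n.+1%:Z));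
    [distinct | exact/link_edgeC/lk_1_apex | exact: lk_apex_5 | | neqs | |].
  + by rewrite fa; lk (facet_2n_1apex R n10 admQ).
  + by rewrite fa; neqs.
  + by rewrite f1; neqs.
have f7 : f 7 = -2.
  apply: (link_next hf fE (x := n.+1%:Z) (y := 5));
    [distinct | exact/link_edgeC/lk_apex_5 | | | neqs | |].
  + by apply: (lk_gap2 (k := 7)); move: n10; clear; lia.
  + by rewrite f5; lk (facet_2n_12 R n10 admQ).
  + by rewrite f5.
  + by rewrite fa; neqs.
have := face_ap _ V2 _ _ (facet_2gap2_apex R n10 admP (i := 5) _).
rewrite fa f5 f7 => h.
have {h} h : ap (- n.+1%:Z) (f 2) (-1) (-2) \in L.
  by apply: h; first [vert | move: n10; clear; lia].
have : f 2 \in [fset n%:Z - 2; n%:Z] by rewrite -e !inE eqxx.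
rewrite in_fset2 => /orP[] /eqP f2; rewrite f2 in h.
  apply: (nonface_12_2n R n10 admQ).
  rewrite (_ : ap _ _ _ _ = ap (- n.+1%:Z) (n%:Z - 2) (-1) (-2)) //.
  by apply: eq_ap => x; rewrite !in_ap; clear; lia.
apply: (nonface_12_n R n10 admQ); rewrite (_ : ap _ _ _ _ = ap (- n.+1%:Z) n%:Z (-1) (-2)) //.
by apply: eq_ap => x; rewrite !in_ap; clear; lia.
Qed.

Lemma rigid_23 : [fset f 2; f 3] = [fset 2; 3] -> P =1 Q.
Proof.
move=> e i; have fE := image_pair e.
have f1 : f 1 = 1 by apply: f_minus1; rewrite (missing_image e (missing_23 R n10 admQ)).
have [hi|hi] := boolP (3 <= i <= n - 6)%N; last first.
  by apply/idP/idP => [/admP|/admQ]; rewrite (negPf hi).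
have fa : f n.+1%:Z = n.+1%:Z.
  have [|||||||||||//|fa] := @choose _ 1 n.+1%:Z (-4) n.+1%:Z fE.
  - vert.
  - vert.
  - exact: lk_1_apex.
  - neqs.
  - neqs.
  - neqs.
  - by rewrite f1; lk (facet_23_apex R n10 admQ).
  - by rewrite f1; lk (facet_123 R n10 admQ).
  - neqs.
  - by rewrite f1 in_fset1U in_fset2; move: n10; clear; lia.
  - by rewrite f1 in_fset1U in_fset2; move: n10; clear; lia.
  by case: (no_reflection e f1 fa).
have fk := identity_faces e f1 fa.
rewrite (recover R n10 admP hi) (recover R n10 admQ hi) -face_tri;
  try (apply: inV; move: hi n10; clear; lia).
have -> : n%:Z - i%:Z - 1 = (n - i - 1)%N%:Z by move: hi n10; clear; lia.
have -> : n%:Z - i%:Z + 1 = (n - i + 1)%N%:Z by move: hi n10; clear; lia.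
by rewrite f1 !fk //; move: hi n10; clear; lia.
Qed.

End Rigidity.

Theorem vertex_iso_rigid f : vertex_iso f -> P =1 Q.
Proof.
move=> hf; have hf' := vertex_iso_neg hf.
have neg a b : [fset f 2; f 3] = [fset a; b] -> [fset - f 2; - f 3] = [fset - a; - b].
  by move/(congr1 oppf); rewrite !oppfU !oppf1.
case: (special_image hf) => e.
- exact: rigid_23 hf e.
- by apply: (rigid_23 hf'); rewrite (neg _ _ e) !opprK.
- by case: (no_exchange hf e).
by case: (no_exchange hf'); rewrite (neg _ _ e) opprB opprK.
Qed.

End Isomorphism.

(** * Counting *)

Section Spheres.
Variables (R : realType) (F : cplx int) (k : nat).
Hypotheses (hF : cs_sphere R F k) (k0 : (0 < k)%N).

Lemma cs_sphere_face s : s \in generated F -> s `<=` V k.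
Proof. by case/generatedP => t /(cs_sub hF) tV /fsubset_trans; apply. Qed.

Lemma cs_sphere_neighborly : cs_neighborly 2 k (generated F).
Proof.
have pair a b : a \in V k -> b \in V k -> b != - a -> [fset a; b] \in generated F.
  move=> aV bV ab; have [s sF /andP[as_ bs]] := cs_edge hF aV bV ab.
  by apply/generatedP; exists s; rewrite // fsubUset !fsub1set as_.
have nz a : a \in V k -> a != - a by rewrite mem_V; clear; lia.
move=> s sV s2 /antipode_freeP free; have [s0|[a as_]] := fset_0Vmem s.
  have V1 : 1 \in V k by rewrite mem_V; move: k0; clear; lia.
  have /generatedP[t tF _] := pair _ _ V1 V1 (nz _ V1).
  by apply/generatedP; exists t; rewrite // s0.
have aV := fsubsetP sV _ as_; have [s1|[b]] := fset_0Vmem (s `\ a).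
  by rewrite -(fsetD1K as_) s1 fsetU0 -[[fset a]]fsetUid; apply: pair => //; apply: nz.
move=> bs; have bs' : b \in s by case/fsetD1P: bs.
rewrite (_ : s = [fset a; b]).
  by apply: pair (fsubsetP sV _ bs') _ => //; apply: contraTneq bs' => ->; apply: free.
apply/esym/eqP; rewrite eqEfcard fsubUset !fsub1set as_ bs' (leq_trans s2) //.
by rewrite cardfs2 eq_sym; case/fsetD1P: bs => ->.
Qed.

Lemma cs_sphere_vertex v : v \in V k -> [fset v] \in generated F.
Proof.
move=> vV; apply: cs_sphere_neighborly; rewrite ?fsub1set ?cardfs1 //.
by apply/antipode_freeP => w /fset1P->; rewrite inE; move: vV; rewrite mem_V; clear; lia.
Qed.

Lemma cs_sphere_vertices : vertices (generated F) = V k.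
Proof.
apply/fsetP => v; apply/bigfcupP/idP => [[s /andP[sF _]]|vV].
  by apply/fsubsetP/cs_sphere_face.
by exists [fset v]; rewrite ?inE // cs_sphere_vertex.
Qed.

Lemma cs_sphere_combinatorial : combinatorial_sphere R 3 (generated F).
Proof.
split; last exact: cs_PL hF.
have /generatedP[s sF _] : [fset 1] \in generated F.
  by apply: cs_sphere_vertex; rewrite mem_V.
exact: generated_complex sF.
Qed.

Lemma cs_sphere_symmetric : centrally_symmetric (generated F).
Proof.
split=> s /generatedP[t tF st].
  by apply/generatedP; exists (oppf t); rewrite ?oppfS //; apply: cs_opp hF _ tF.
apply/antipode_freeP => v vs; have /antipode_freeP free := cs_free hF tF.
by apply: contra (free v (fsubsetP st _ vs)); apply: (fsubsetP st).
Qed.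

End Spheres.

Section Counting.
Variables (R : realType) (n : nat).
Hypothesis n10 : (10 <= n)%N.

Lemma DeltaI_facets I : I \in index_sets n -> DeltaI n I = generated (facetsDI n (mem I)).
Proof.
move=> hI; have [_ adm] := index_setsP hI.
have n4 : (4 <= n)%N by apply: leq_trans n10.
have [hD _] := D_sphere_ball R n4.
exact: DeltaI_generated hD (cs_ball_facetsI R n10 adm) (Delta_D R n4) (BI_facetsE n10 hI).
Qed.

Lemma DeltaI_rigid I J : I \in index_sets n -> J \in index_sets n ->
  isomorphic (DeltaI n I) (DeltaI n J) -> I = J.
Proof.
move=> hI hJ; rewrite !DeltaI_facets //.
have [sI admI] := index_setsP hI; have [sJ admJ] := index_setsP hJ.
have sphI := cs_sphere_DI R n10 admI; have sphJ := cs_sphere_DI R n10 admJ.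
case=> f []; rewrite (cs_sphere_vertices sphI) // => inj img.
have face s : s \in generated (facetsDI n (mem I)) -> f @` s \in generated (facetsDI n (mem J)).
  by move=> sK; rewrite -img; apply/imfsetP; exists s.
have hf : vertex_iso n (mem I) (mem J) f.
  split=> [v vV|v w|s sV]; [| exact: inj |].
    have := face _ (cs_sphere_vertex sphI (ltn0Sn n) vV); rewrite imfset_fset1.
    by move/(cs_sphere_face sphJ); rewrite fsub1set.
  apply/idP/idP => [|/face//]; rewrite -img => /imfsetP[t /= tK e].
  have tV := cs_sphere_face sphI tK.
  suff -> : s = t by [].
  have sub s1 s2 : s1 `<=` V n.+1 -> s2 `<=` V n.+1 -> f @` s1 = f @` s2 -> s1 `<=` s2.
    move=> s1V s2V e12; apply/fsubsetP => v v1.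
    have /imfsetP[w /= w2 vw] : f v \in f @` s2 by rewrite -e12; apply/imfsetP; exists v.
    by rewrite (inj _ _ (fsubsetP s1V _ v1) (fsubsetP s2V _ w2) vw).
  by apply/eqP; rewrite eqEfsubset (sub _ _ sV tV e) (sub _ _ tV sV (esym e)).
apply: (irr_sorted_eq ltn_trans ltnn) => // i.
exact: (vertex_iso_rigid R n10 admI admJ hf i).
Qed.

(** All further elements are at least 5, so the leading 3 secures the gap condition for every
    subset. *)
Definition index_set (A : {set 'I_(n - 10)}) : seq nat :=
  3 :: [seq i <- iota 5 (n - 10) | [exists x in A, i == x + 5]]%N.

Lemma index_setP A : index_set A \in index_sets n.
Proof.
have mem5 i : i \in behead (index_set A) -> (5 <= i <= n - 6)%N.
  by rewrite mem_filter mem_iota => /andP[_]; move: n10; clear; lia.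
apply/and3P; split.
- rewrite /= path_sortedE; last exact: ltn_trans.
  apply/andP; split; first by apply/allP => i /mem5; clear; lia.
  by apply: sorted_filter (iota_ltn_sorted _ _); apply: ltn_trans.
- rewrite /=; apply/andP; split; first by move: n10; clear; lia.
  by apply/allP => i /mem5; clear; lia.
apply/implyP; move: mem5; rewrite /index_set /=; case: filter => [|j s] //= mem5 _.
by have := mem5 j; rewrite inE eqxx => /(_ isT); clear; lia.
Qed.

Lemma index_set_inj : injective index_set.
Proof.
move=> A B [e]; apply/setP => x.
have mem_x (C : {set 'I_(n - 10)}) :
    ((x + 5)%N \in [seq i <- iota 5 (n - 10) | [exists y in C, i == y + 5]%N]) = (x \in C).
  have hx : (5 <= x + 5 < 5 + (n - 10))%N by have := ltn_ord x; clear; lia.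
  rewrite mem_filter mem_iota hx andbT.
  by apply/exists_inP/idP => [[y yC]|xC]; [rewrite eqn_add2r => /eqP/val_inj -> | exists x].
by rewrite -!mem_x e.
Qed.

End Counting.

Theorem theorem7p9 (R : realType) :
  (forall n : nat, (10 <= n)%N ->
     forall I J : seq nat, I \in index_sets n -> J \in index_sets n ->
       I <> J -> ~ isomorphic (DeltaI n I) (DeltaI n J)) /\
  (exists c : R, 0 < c /\
     forall n : nat, (10 <= n)%N ->
       exists S : {fset {fset {fset int}}},
         [/\ c * 2 ^+ n <= #|` S|%:R,
             forall K, K \in S ->
               [/\ combinatorial_sphere R 3 K, vertices K = V n.+1,
                   centrally_symmetric K & cs_neighborly 2 n.+1 K]
           & forall K L, K \in S -> L \in S -> K <> L -> ~ isomorphic K L]).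
Proof.
split=> [n n10 I J hI hJ IJ /(DeltaI_rigid R n10 hI hJ)//|].
exists (2 ^- 10); split; first by rewrite invr_gt0 exprn_gt0.
move=> n n10; have iso_id (K : cplx int) : isomorphic K K.
  exists id; split=> //; apply/fsetP => s.
  apply/imfsetP/idP => [[t /= tK ->]|sK]; first by rewrite imfset_id.
  by exists s; rewrite ?imfset_id.
(* Equal complexes are isomorphic by the identity, so rigidity also yields the number of distinct
   complexes. *)
have inj : injective (DeltaI n \o @index_set n).
  move=> A B /= e; apply: (@index_set_inj n).
  by apply: (DeltaI_rigid R n10 (index_setP n10 A) (index_setP n10 B)); rewrite e.
exists [fset (DeltaI n \o @index_set n) A | A in [set: {set 'I_(n - 10)}]]; split.
- rewrite card_imfset //= -cardE -powersetT card_powerset cardsT card_ord natrX.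
  by rewrite -{1}(subnKC n10) exprD mulKf // expf_neq0 // pnatr_eq0.
- move=> K /imfsetP[A /= _ ->]; have hA := index_setP n10 A.
  rewrite (DeltaI_facets R n10 hA); have [_ adm] := index_setsP hA.
  have sph := cs_sphere_DI R n10 adm.
  split; [exact: cs_sphere_combinatorial sph _ | exact: cs_sphere_vertices sph _
    | exact: cs_sphere_symmetric sph | exact: cs_sphere_neighborly sph _].
move=> K L /imfsetP[A /= _ ->] /imfsetP[B /= _ ->] ne iso; apply: ne.
by rewrite (DeltaI_rigid R n10 (index_setP n10 A) (index_setP n10 B) iso).
Qed.
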